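(* Suppose the auctioneer conducts a dollar-based auction and issues equity in period 1: at the end of period 1, just before the auctioneer consumes, investors pay the auctioneer for the right to receive all future cash flows, i.e. the revenues generated from period 2 onward. In equilibrium investors must be indifferent between purchasing equity or not, and the auctioneer receives $$\beta\cdot\frac{1-\beta^{T-1}}{1-\beta}\,k$$ from the equity sale. Hence total period-1 revenues, including proceeds from the auction and from equity, are $$\sum_{i=1}^n b_{i,1}+\beta\cdot\frac{1-\beta^{T-1}}{1-\beta}\,k ,$$ and the auctioneer earns no further revenues after period 1. The resulting equilibrium is identical to that of the token-based auction with $\sigma_t=-1$ for all $t\le T$.
   Context: A private-value auction for a single object is repeated in periods $1,\dots,T$ ($T\ge 1$), with one auctioneer and $n\ge 2$ ex-ante identical, risk-neutral bidders (who also act as investors) whose liquidity constraints never bind. The auctioneer has a weakly concave per-period utility function. The auctioneer and the bidders share a discount factor $\beta\in(0,1)$ and may invest in a risk-free asset with gross per-period return $R=1/\beta$. At the beginning of each period each bidder $i$ privately draws a valuation $v_{i,t}>0$ from a continuous atomless distribution $F$ with support $[\underline v,\overline v]$, independently across bidders, and submits a bid denominated in dollars. The auction format is a standard one with revenue-maximizing reservation price $\underline b$; it determines dollar-denominated payments $b_{i,t}$. Expected total payments per period are $\mathbb{E}[\sum_i b_{i,t}]=k$, where $$k=\mathbb{E}\big[\max\{v_{\mathrm{Max}-1,t},\underline b\}\,\big|\,v_{\mathrm{Max},t}\ge\underline b\big]\cdot\Pr\{v_{\mathrm{Max},t}\ge\underline b\}$$ and $v_{\mathrm{Max},t}$, $v_{\mathrm{Max}-1,t}$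 are the highest and second-highest realized valuations in period $t$. Dollar-based auction: bidders pay in dollars and period-$t$ auction revenue is $\sum_i b_{i,t}$. Token-based auction: payments are settled in tokens created and initially owned by the auctioneer. At the start of period $t$ the auctioneer holds $A_t\ge 0$ tokens and bidder $i$ holds $a_{i,t}\ge 0$; the supply is $M_t=A_t+\sum_i a_{i,t}$; initially $A_1=M_1$ and $a_{i,1}=0$. After payments are determined, a frictionless token market opens in which auctioneer and bidders are price takers; $p_t$ is the equilibrium token price, and $Q_t$, $q_{i,t}$ are the net purchases (possibly negative) of the auctioneer and bidder $i$, with $Q_t+\sum_i q_{i,t}=0$ and $q_{i,t}\ge b_{i,t}/p_t-a_{i,t}$. Each bidder then transfers $b_{i,t}/p_t$ tokens to the auctioneer. The auctioneer's period-$t$ revenue is $-p_tQ_t$. The monetary policy, announced in advance, is a sequence $(\tau_t,\sigma_t)$ with $\tau_t,\sigma_t\ge-1$, and $$a_{i,t+1}=(1+\tau_t)\Big(a_{i,t}+q_{i,t}-\tfrac{b_{i,t}}{p_t}\Big),\qquad A_{t+1}=(1+\tau_t)\Big(A_t+Q_t+(1+\sigma_t)\sum_{i}\tfrac{b_{i,t}}{p_t}\Big),$$ so that $\sigma_t=-1$ means all tokens used for payment are destroyed. Equilibrium token prices satisfy $p_t=\max\{\sum_{i} b_{i,t}/M_t,\ \beta(1+\tau_t)p^e_{t+1}\}$, where $p^e_{t+1}$ is the expectation of $p_{t+1}$ conditional on information available in period $t$.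
   Formalization: ''Identical'' is mended: a token equilibrium is matched with equity only if the auctioneer sells all tokens when indifferent, or is strictly risk averse with risky revenues; bidders' flows then match in aggregate, since they may retrade tokens. Payoffs always agree. *)

(* Defs.v *)
From HB Require Import structures.
From mathcomp Require Import all_boot all_order all_algebra.
From mathcomp Require Import all_classical all_reals all_analysis.

Set Implicit Arguments.
Unset Strict Implicit.
Unset Printing Implicit Defensive.

Import Order.TTheory GRing.Theory Num.Theory.
Import numFieldNormedType.Exports.

Local Open Scope classical_set_scope.
Local Open Scope ring_scope.

(* Conventions.  Periods are the naturals 1, ..., T; a process is a function
   nat -> Omega -> R of which only the values at those dates matter.  Constraints
   that involve prices are required almost surely.  The gross risk-free return is
   beta^-1. *)

Definition in_periods (T t : nat) : bool := (1 <= t <= T)%N.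

Definition adapted_to (R : realType) (d : measure_display)
    (Omega : measurableType d) (G : set (set Omega)) (X : Omega -> R) : Prop :=
  forall B : set R, measurable B -> G (X @^-1` B).

Definition is_cond_exp (R : realType) (d : measure_display)
    (Omega : measurableType d) (P : probability Omega R)
    (G : set (set Omega)) (X Y : Omega -> R) : Prop :=
  [/\ adapted_to G Y, P.-integrable [set: Omega] (EFin \o Y) &
      forall A, G A -> \int[P]_(w in A) Y w = \int[P]_(w in A) X w].

Definition cond_mean (R : realType) (d : measure_display)
    (Omega : measurableType d) (P : probability Omega R)
    (X : Omega -> R) (A : set Omega) : R :=
  (\int[P]_(w in A) X w) / fine (P A).

(* [lo, hi] is the smallest closed set of full measure. *)
Definition has_support (R : realType) (F : probability R R) (lo hi : R) : Prop :=
  F `[lo, hi]%classic = 1%E /\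
  forall C : set R, closed C -> F C = 1%E -> `[lo, hi]%classic `<=` C.

Definition weakly_concave (R : realType) (u : R -> R) : Prop :=
  forall x y l : R, 0 <= x -> 0 <= y -> 0 <= l -> l <= 1 ->
    l * u x + (1 - l) * u y <= u (l * x + (1 - l) * y).

Definition strictly_concave (R : realType) (u : R -> R) : Prop :=
  forall x y l : R, 0 <= x -> 0 <= y -> x != y -> 0 < l -> l < 1 ->
    l * u x + (1 - l) * u y < u (l * x + (1 - l) * y).

(* The repeated auction, as far as it is common to the two payment schemes. *)
Record auction_env (R : realType) (d : measure_display)
    (Omega : measurableType d) (P : probability Omega R) := AuctionEnv {
  bidders : nat;
  periods : nat;
  discount : R;
  utility : R -> R;                              (* of the auctioneer *)
  value_dist : probability R R;
  value_lo : R;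
  value_hi : R;
  reserve : R;
  mean_revenue : R;                              (* k *)
  valuation : nat -> 'I_bidders -> {RV P >-> R};
  winner : nat -> Omega -> option 'I_bidders;
  payment : nat -> 'I_bidders -> Omega -> R;     (* in dollars *)
  info : nat -> set (set Omega)                  (* known when the token (or
                                                    equity) market of t opens *)
}.

Arguments valuation {R d Omega P} E t i : rename.
Arguments payment {R d Omega P} E t i _ : rename.

Definition total_payment (R : realType) (d : measure_display)
    (Omega : measurableType d) (P : probability Omega R) (E : auction_env P)
    (t : nat) (w : Omega) : R :=
  \sum_(i < bidders E) payment E t i w.

(* order_value E t 0 is the highest and order_value E t 1 the second-highest
   realized valuation of period t. *)
Definition order_value (R : realType) (d : measure_display)
    (Omega : measurableType d) (P : probability Omega R) (E : auction_env P)
    (t j : nat) (w : Omega) : R :=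
  nth 0 (sort (fun x y : R => y <= x)
           [seq valuation E t i w | i <- enum 'I_(bidders E)]) j.

Definition reserve_revenue (R : realType) (d : measure_display)
    (Omega : measurableType d) (P : probability Omega R) (E : auction_env P)
    (t : nat) (r : R) : R :=
  let sale := [set w | r <= order_value E t 0 w] in
  cond_mean P (fun w => Num.max (order_value E t 1 w) r) sale * fine (P sale).

Definition valuation_info (R : realType) (d : measure_display)
    (Omega : measurableType d) (P : probability Omega R) (E : auction_env P)
    (t : nat) : set (set Omega) :=
  <<s [set A | exists (i : 'I_(bidders E)) (B : set R),
         measurable B /\ A = valuation E t i @^-1` B] >>.

Record auction_model (R : realType) (d : measure_display)
    (Omega : measurableType d) (P : probability Omega R)
    (E : auction_env P) : Prop := AuctionModel {
  two_bidders : (2 <= bidders E)%N;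
  one_period : (1 <= periods E)%N;
  discount_gt0 : 0 < discount E;
  discount_lt1 : discount E < 1;
  utility_concave : weakly_concave (utility E);
  utility_nondecreasing :
    forall x y, 0 <= x -> x <= y -> utility E x <= utility E y;
  (* atomless, i.e. with a continuous distribution function *)
  value_dist_atomless : forall x : R, value_dist E [set x] = 0%E;
  value_dist_support : has_support (value_dist E) (value_lo E) (value_hi E);
  valuation_law : forall t i, in_periods (periods E) t ->
    forall B : set R, measurable B ->
      distribution P (valuation E t i) B = value_dist E B;
  valuation_gt0 : forall t i, in_periods (periods E) t ->
    {ae P, forall w, 0 < valuation E t i w};
  valuation_indep : forall t, in_periods (periods E) t ->
    forall B : 'I_(bidders E) -> set R, (forall i, measurable (B i)) ->
      P (\bigcap_(i in [set: 'I_(bidders E)]) (valuation E t i @^-1` B i)) =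
      (\prod_(i < bidders E) P (valuation E t i @^-1` B i))%E;
  info_sigma : forall t, sigma_algebra [set: Omega] (info E t);
  info_measurable : forall t, info E t `<=` measurable;
  info_nondecreasing : forall t, info E t `<=` info E t.+1;
  (* valuations are drawn afresh at the beginning of each period *)
  info_indep : forall t, in_periods (periods E) t -> in_periods (periods E) t.+1 ->
    forall A B, info E t A -> valuation_info E t.+1 B ->
      P (A `&` B) = (P A * P B)%E;
  (* standard format: a highest-valuation bidder obtains the object whenever
     some valuation reaches the reservation price *)
  winner_meas : forall t i, in_periods (periods E) t ->
    valuation_info E t [set w | winner E t w = Some i];
  winner_some : forall t, in_periods (periods E) t -> {ae P, forall w,
    forall i, winner E t w = Some i ->
      reserve E <= valuation E t i w /\
      forall j, valuation E t j w <= valuation E t i w};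
  winner_none : forall t, in_periods (periods E) t -> {ae P, forall w,
    winner E t w = None -> forall j, valuation E t j w < reserve E};
  (* the format turns the valuations of the period into payments *)
  payment_meas : forall t i, in_periods (periods E) t ->
    adapted_to (valuation_info E t) (payment E t i);
  payment_info : forall t i, in_periods (periods E) t ->
    adapted_to (info E t) (payment E t i);
  payment_ge0 : forall t i, in_periods (periods E) t ->
    {ae P, forall w, 0 <= payment E t i w};
  payment_mean : forall t, in_periods (periods E) t ->
    'E_P[total_payment E t]%E = (mean_revenue E)%:E;
  mean_revenueE : forall t, in_periods (periods E) t ->
    mean_revenue E = reserve_revenue E t (reserve E);
  reserve_optimal : forall t r, in_periods (periods E) t ->
    reserve_revenue E t r <= reserve_revenue E t (reserve E)
}.

(* Total discounted payoff of bidder i: the value of the objects won plus the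
   dollar flow [flow] (net of payments).  Investing in the risk-free asset at
   rate beta^-1 does not change it, so it is left out. *)
Definition bidder_payoff (R : realType) (d : measure_display)
    (Omega : measurableType d) (P : probability Omega R) (E : auction_env P)
    (i : 'I_(bidders E)) (flow : nat -> Omega -> R) : \bar R :=
  'E_P[fun w => (\sum_(1 <= t < (periods E).+1) discount E ^+ t.-1 *
         ((winner E t w == Some i)%:R * valuation E t i w + flow t w))%R]%E.

(* The auctioneer consumes c t and invests s t in the risk-free asset, out of
   the revenue [rev t] and the proceeds of the earlier investment. *)
Definition consumption_plan (R : realType) (d : measure_display)
    (Omega : measurableType d) (P : probability Omega R) (E : auction_env P)
    (rev c s : nat -> Omega -> R) : Prop :=
  [/\ forall t, in_periods (periods E) t ->
        adapted_to (info E t) (c t) /\ adapted_to (info E t) (s t),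
      forall t w, in_periods (periods E) t -> 0 <= c t w /\ 0 <= s t w,
      forall w, s 0%N w = 0 &
      {ae P, forall w, forall t, in_periods (periods E) t ->
        c t w + s t w = rev t w + (discount E)^-1 * s t.-1 w}].

(* The integral is well defined since the utility is bounded below by its value
   at 0. *)
Definition auctioneer_payoff (R : realType) (d : measure_display)
    (Omega : measurableType d) (P : probability Omega R) (E : auction_env P)
    (c : nat -> Omega -> R) : \bar R :=
  'E_P[fun w => (\sum_(1 <= t < (periods E).+1)
                   discount E ^+ t.-1 * utility E (c t w))%R]%E.

(* With an equity issue, one share entitles its owner to the auction revenues of periods 2, ..., T.
   It is traded once, at the end of period 1, at the price e; bidder i buys the
   fraction x i. *)

Definition equity_admissible (R : realType) (d : measure_display)
    (Omega : measurableType d) (P : probability Omega R) (E : auction_env P)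
    (e y : Omega -> R) : Prop :=
  [/\ adapted_to (info E 1) y, {ae P, forall w, 0 <= y w},
      P.-integrable [set: Omega] (EFin \o y) &
      P.-integrable [set: Omega] (EFin \o (fun w => y w * e w))].

Definition equity_flow (R : realType) (d : measure_display)
    (Omega : measurableType d) (P : probability Omega R) (E : auction_env P)
    (e y : Omega -> R) (i : 'I_(bidders E)) (t : nat) (w : Omega) : R :=
  - payment E t i w +
  (if t == 1%N then - (y w * e w) else y w * total_payment E t w).

Definition equity_revenue (R : realType) (d : measure_display)
    (Omega : measurableType d) (P : probability Omega R) (E : auction_env P)
    (e : Omega -> R) (x : 'I_(bidders E) -> Omega -> R)
    (t : nat) (w : Omega) : R :=
  total_payment E t w +
  (if t == 1%N then (\sum_i x i w) * e w
   else - ((\sum_i x i w) * total_payment E t w)).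

Definition equity_equilibrium (R : realType) (d : measure_display)
    (Omega : measurableType d) (P : probability Omega R) (E : auction_env P)
    (e : Omega -> R) (x : 'I_(bidders E) -> Omega -> R)
    (c s : nat -> Omega -> R) : Prop :=
  [/\ adapted_to (info E 1) e,
      {ae P, forall w, \sum_i x i w = 1},
      forall i, equity_admissible E e (x i) /\
        forall y, equity_admissible E e y ->
          (bidder_payoff i (equity_flow e y i) <=
           bidder_payoff i (equity_flow e (x i) i))%E,
      consumption_plan E (equity_revenue e x) c s &
      forall c' s', consumption_plan E (equity_revenue e x) c' s' ->
        (auctioneer_payoff E c' <= auctioneer_payoff E c)%E].

Definition equity_value (R : realType) (d : measure_display)
    (Omega : measurableType d) (P : probability Omega R)
    (E : auction_env P) : R :=
  discount E * ((1 - discount E ^+ (periods E).-1) / (1 - discount E)) *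
  mean_revenue E.

Record token_policy (R : realType) := TokenPolicy {
  initial_supply : R;          (* M_1 = A_1 *)
  growth : nat -> R;           (* tau *)
  recycling : nat -> R         (* sigma *)
}.

Definition valid_policy (R : realType) (T : nat) (pol : token_policy R) : Prop :=
  0 < initial_supply pol /\
  forall t, in_periods T t -> -1 <= growth pol t /\ -1 <= recycling pol t.

(* Tokens transferred by bidder i.  At a zero price nothing has to be paid in
   equilibrium, and then 0 / 0 = 0 is the right number. *)
Definition tokens_due (R : realType) (d : measure_display)
    (Omega : measurableType d) (P : probability Omega R) (E : auction_env P)
    (p : nat -> Omega -> R) (t : nat) (i : 'I_(bidders E)) (w : Omega) : R :=
  payment E t i w / p t w.

(* a_{i,t} and A_t, starting from a_{i,1} = 0 and A_1 = M_1; the value at date 0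
   is a dummy. *)
Fixpoint bidder_tokens (R : realType) (d : measure_display)
    (Omega : measurableType d) (P : probability Omega R) (E : auction_env P)
    (pol : token_policy R) (p : nat -> Omega -> R) (i : 'I_(bidders E))
    (q : nat -> Omega -> R) (t : nat) (w : Omega) : R :=
  match t with
  | 0 => 0
  | t'.+1 =>
      if t' == 0%N then 0
      else (1 + growth pol t') *
           (bidder_tokens pol p i q t' w + q t' w - tokens_due p t' i w)
  end.

Fixpoint auctioneer_tokens (R : realType) (d : measure_display)
    (Omega : measurableType d) (P : probability Omega R) (E : auction_env P)
    (pol : token_policy R) (p Q : nat -> Omega -> R)
    (t : nat) (w : Omega) : R :=
  match t with
  | 0 => 0
  | t'.+1 =>
      if t' == 0%N then initial_supply pol
      else (1 + growth pol t') *
           (auctioneer_tokens E pol p Q t' w + Q t' w +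
            (1 + recycling pol t') *
              \sum_(i < bidders E) tokens_due p t' i w)
  end.

Definition token_supply (R : realType) (d : measure_display)
    (Omega : measurableType d) (P : probability Omega R) (E : auction_env P)
    (pol : token_policy R) (p Q : nat -> Omega -> R)
    (q : 'I_(bidders E) -> nat -> Omega -> R) (t : nat) (w : Omega) : R :=
  auctioneer_tokens E pol p Q t w +
  \sum_(i < bidders E) bidder_tokens pol p i (q i) t w.

Definition token_flow (R : realType) (d : measure_display)
    (Omega : measurableType d) (p q : nat -> Omega -> R)
    (t : nat) (w : Omega) : R := - (p t w * q t w).

Definition token_revenue (R : realType) (d : measure_display)
    (Omega : measurableType d) (p Q : nat -> Omega -> R)
    (t : nat) (w : Omega) : R := - (p t w * Q t w).

Definition bidder_token_plan (R : realType) (d : measure_display)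
    (Omega : measurableType d) (P : probability Omega R) (E : auction_env P)
    (pol : token_policy R) (p : nat -> Omega -> R) (i : 'I_(bidders E))
    (q : nat -> Omega -> R) : Prop :=
  (forall t, in_periods (periods E) t ->
     adapted_to (info E t) (q t) /\
     P.-integrable [set: Omega] (EFin \o token_flow p q t)) /\
  {ae P, forall w, forall t, in_periods (periods E) t ->
     tokens_due p t i w - bidder_tokens pol p i q t w <= q t w}.

(* The auctioneer cannot sell more tokens than it holds when the market opens. *)
Definition auctioneer_token_plan (R : realType) (d : measure_display)
    (Omega : measurableType d) (P : probability Omega R) (E : auction_env P)
    (pol : token_policy R) (p Q c s : nat -> Omega -> R) : Prop :=
  [/\ forall t, in_periods (periods E) t -> adapted_to (info E t) (Q t),
      {ae P, forall w, forall t, in_periods (periods E) t ->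
         0 <= auctioneer_tokens E pol p Q t w + Q t w} &
      consumption_plan E (token_revenue p Q) c s].

Definition auctioneer_token_optimal (R : realType) (d : measure_display)
    (Omega : measurableType d) (P : probability Omega R) (E : auction_env P)
    (pol : token_policy R) (p Q c s : nat -> Omega -> R) : Prop :=
  auctioneer_token_plan E pol p Q c s /\
  forall Q' c' s', auctioneer_token_plan E pol p Q' c' s' ->
    (auctioneer_payoff E c' <= auctioneer_payoff E c)%E.

(* pe t is the expectation of the next price p t.+1 given the information of
   period t; tokens are worthless after the last auction.  A positive supply is
   what makes the ratio of payments to supply, hence the price, well defined. *)
Record token_equilibrium (R : realType) (d : measure_display)
    (Omega : measurableType d) (P : probability Omega R) (E : auction_env P)
    (pol : token_policy R) (p pe Q : nat -> Omega -> R)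
    (q : 'I_(bidders E) -> nat -> Omega -> R)
    (c s : nat -> Omega -> R) : Prop := TokenEquilibrium {
  price_adapted : forall t, in_periods (periods E) t ->
    adapted_to (info E t) (p t) /\
    P.-integrable [set: Omega] (EFin \o p t);
  price_end : forall w, p (periods E).+1 w = 0;
  price_expected : forall t, in_periods (periods E) t ->
    is_cond_exp P (info E t) (p t.+1) (pe t);
  supply_gt0 : {ae P, forall w, forall t, in_periods (periods E) t ->
    0 < token_supply pol p Q q t w};
  price_eq : {ae P, forall w, forall t, in_periods (periods E) t ->
    p t w = Num.max (total_payment E t w / token_supply pol p Q q t w)
                    (discount E * (1 + growth pol t) * pe t w)};
  market_clearing : {ae P, forall w, forall t, in_periods (periods E) t ->
    Q t w + \sum_(i < bidders E) q i t w = 0};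
  bidders_optimal : forall i, bidder_token_plan pol p i (q i) /\
    forall q', bidder_token_plan pol p i q' ->
      (bidder_payoff i (token_flow p q') <=
       bidder_payoff i (token_flow p (q i)))%E;
  auctioneer_optimal : auctioneer_token_optimal E pol p Q c s
}.

Definition holds_no_tokens (R : realType) (d : measure_display)
    (Omega : measurableType d) (P : probability Omega R) (E : auction_env P)
    (pol : token_policy R) (p Q : nat -> Omega -> R) : Prop :=
  {ae P, forall w, forall t, in_periods (periods E) t ->
     auctioneer_tokens E pol p Q t w + Q t w = 0}.

(* A risk-neutral auctioneer is indifferent as to when it sells its tokens, which
   leaves the timing of its revenues undetermined.  This is the tie-breaking
   rule: whenever selling all its tokens as soon as it can is optimal, it does
   so. *)
Definition sells_when_indifferent (R : realType) (d : measure_display)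
    (Omega : measurableType d) (P : probability Omega R) (E : auction_env P)
    (pol : token_policy R) (p Q : nat -> Omega -> R) : Prop :=
  (exists Q' c' s', auctioneer_token_optimal E pol p Q' c' s' /\
     holds_no_tokens E pol p Q') ->
  holds_no_tokens E pol p Q.

(* When the next condition holds there are no ties: the auctioneer is strictly
   risk averse and the revenue of each future auction is risky. *)
Definition strictly_averse (R : realType) (d : measure_display)
    (Omega : measurableType d) (P : probability Omega R)
    (E : auction_env P) : Prop :=
  strictly_concave (utility E) /\
  forall t, (2 <= t <= periods E)%N ->
    ~ {ae P, forall w, total_payment E t w = mean_revenue E}.

(* Main.v *)
Require Import Defs.
From HB Require Import structures.
From mathcomp Require Import all_boot all_order all_algebra.
From mathcomp Require Import all_classical all_reals all_analysis.
From mathcomp Require Import measurable_realfun ring lra.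

Set Implicit Arguments.
Unset Strict Implicit.
Unset Printing Implicit Defensive.

Import Order.TTheory GRing.Theory Num.Theory.
Import numFieldNormedType.Exports.

Local Open Scope classical_set_scope.
Local Open Scope ring_scope.

(** Equity.  A share of the later auctions is independent of what is known when it is
    traded, so a bidder who buys [y] shares at the price [e] gains the expectation of
    [y * (V - e)], where [V] is the expected discounted revenue of those auctions;
    optimality for both [y] increased where [e < V] and [y] decreased where
    [e > V] forces [e = V].

    Tokens.  When all payments are burnt, the supply [M t] obeys
    [M t.+1 = (1 + tau t) (M t - S t / p t)], where [S t] is the total payment.  The
    supply stays positive, hence the price is determined by its
    expected continuation, and backward induction shows that the supply is worth
    [p t * M t = S t + V t]: tokens are shares of the later auctions.  So
    the auctioneer's initial tokens are worth its period-1 revenue with equity, and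
    their value is a martingale.

    Optimality.  Any plan of the auctioneer, with tokens or with equity, costs at most
    the initial wealth [W = S 1 + V 1] in expectation given period 1.  By the concavity of
    the utility (a supergradient at [W / annuity]) no plan beats the constant
    consumption [W / annuity], which is attained by selling everything at once.
    Under strict risk aversion the optimal consumption is constant, and a
    consumption known in advance cannot be financed by holding risky tokens. *)

(** * Integrals of real functions *)

(** Nothing makes the auctioneer's plans integrable: they are only adapted and nonnegative. So known
    factors are pulled out of conditional expectations for nonnegative unbounded functions, with
    integrals in [[0, +oo]], and integrability is carried forward along each budget. Two interfaces
    connect the schemes. [fair_prices] follows from any equilibrium with burnt tokens and also holds
    for the prices built from equity. [financed] is met by the auctioneer's plans under either
    scheme. Every equilibrium then gives the auctioneer [best_payoff] and a bidder [auction_payoff],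
    so payoffs agree without any comparison of trades. Weights known in period 1 suffice for risk
    aversion because the target consumption is itself known in period 1: the supergradient there is
    such a weight. It is bounded because the target stays above [V 1 / annuity T], which is positive
    unless [T = 1]; that case is treated apart. The model does not assert [k > 0]. This is derived
    from the optimality of the reserve price, and it makes [V t] positive before the last period, so
    that tokens have a positive price there and can be normalized by [V t]. *)

Section integrals.
Context (R : realType) (d : measure_display) (Omega : measurableType d)
  (P : probability Omega R).
Implicit Types f g : Omega -> R.

Local Notation intg f := (P.-integrable [set: Omega] (EFin \o f)).
Local Notation Ex f := (Rintegral P [set: Omega] f).

Lemma intg_measurable f : intg f -> measurable_fun [set: Omega] f.
Proof. by move=> /measurable_int /measurable_EFinP. Qed.

Lemma intg_le f g : measurable_fun [set: Omega] f ->
  {ae P, forall w, `|f w| <= g w} -> intg g -> intg f.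
Proof.
move=> mf fg ig; apply/integrableP; split; first exact/measurable_EFinP.
move/integrableP : (ig) => [mg]; apply: le_lt_trans.
apply: ae_ge0_le_integral => //.
- by apply/measurableT_comp => //; exact/measurable_EFinP.
- exact/measurableT_comp.
by apply: filterS fg => w + _; rewrite /= lee_fin => /le_trans; apply; exact: ler_norm.
Qed.

(** [P] is not assumed complete, so almost sure equality does not transfer measurability; hence the
    separate hypothesis on [g]. *)
Lemma intg_ae f g : measurable_fun [set: Omega] g ->
  {ae P, forall w, f w = g w} -> intg f -> intg g.
Proof.
move=> mg fg /integrable_norm ig; apply: intg_le ig => //.
by apply: filterS fg => w /= ->.
Qed.

Lemma Ex_ae f g : measurable_fun [set: Omega] f -> measurable_fun [set: Omega] g ->
  {ae P, forall w, f w = g w} -> Ex f = Ex g.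
Proof.
move=> mf mg fg; congr fine; apply: ae_eq_integral => //; try exact/measurable_EFinP.
by apply: filterS fg => w /= -> _.
Qed.

Lemma intgD f g : intg f -> intg g -> intg (fun w => f w + g w).
Proof.
move=> If Ig; have := integrableD measurableT If Ig.
by apply: eq_integrable => // w _.
Qed.

Lemma intgZ k f : intg f -> intg (fun w => k * f w).
Proof.
move=> If; have := integrableZl measurableT k If.
by apply: eq_integrable => // w _.
Qed.

Lemma intgN f : intg f -> intg (fun w => - f w).
Proof.
move=> /(intgZ (-1)); apply: eq_integrable => // w _ /=.
by rewrite mulN1r.
Qed.

Lemma intgB f g : intg f -> intg g -> intg (fun w => f w - g w).
Proof. by move=> If Ig; exact: intgD If (intgN Ig). Qed.

Lemma intg_cst k : intg (fun=> k).
Proof. exact: finite_measure_integrable_cst. Qed.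

Lemma intg_sum (I : Type) (r : seq I) (Q : pred I) (h : I -> Omega -> R) :
  (forall i, Q i -> intg (h i)) -> intg (fun w => \sum_(i <- r | Q i) h i w).
Proof.
move=> ih; have := integrable_sum (mu := P) measurableT r ih.
by apply: eq_integrable => // w _ /=; rewrite sumEFin.
Qed.

Lemma ExD f g : intg f -> intg g -> Ex (fun w => f w + g w) = Ex f + Ex g.
Proof. by move=> If Ig; rewrite RintegralD. Qed.

Lemma ExZ k f : intg f -> Ex (fun w => k * f w) = k * Ex f.
Proof. by move=> If; rewrite RintegralZl. Qed.

Lemma ExB f g : intg f -> intg g -> Ex (fun w => f w - g w) = Ex f - Ex g.
Proof. by move=> If Ig; rewrite RintegralB. Qed.

Lemma ExN f : intg f -> Ex (fun w => - f w) = - Ex f.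
Proof.
move=> If; have := ExZ (-1) If; rewrite mulN1r => <-.
by apply: eq_Rintegral => w _; rewrite mulN1r.
Qed.

Lemma Ex_cst k : Ex (fun=> k) = k.
Proof.
rewrite (_ : (fun=> k) = cst k)// Rintegral_cst//.
rewrite [X in fine X](_ : _ = 1%E) ?mulr1//; exact: probability_setT.
Qed.

Lemma Ex_sum (I : Type) (r : seq I) (Q : pred I) (h : I -> Omega -> R) :
  (forall i, Q i -> intg (h i)) ->
  Ex (fun w => \sum_(i <- r | Q i) h i w) = \sum_(i <- r | Q i) Ex (h i).
Proof.
move=> ih; elim: r => [|a r IH].
  under eq_Rintegral do rewrite big_nil.
  by rewrite big_nil Ex_cst.
under eq_Rintegral do rewrite big_cons.
rewrite big_cons; case: ifP => // Qa.
by rewrite ExD ?IH//; [exact: ih|exact: intg_sum].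
Qed.

Lemma EFin_Ex f : intg f -> (\int[P]_w (f w)%:E)%E = (Ex f)%:E.
Proof. by move=> If; rewrite fineK//; exact: integrable_fin_num. Qed.

Lemma expectation_Ex f : intg f -> 'E_P[f]%E = (Ex f)%:E.
Proof. by move=> If; rewrite unlock EFin_Ex. Qed.

Lemma Ex_ge0 f : measurable_fun [set: Omega] f ->
  {ae P, forall w, 0 <= f w} -> 0 <= Ex f.
Proof.
move=> mf f0; rewrite (@Ex_ae _ (fun w => Num.max (f w) 0))//.
- by apply: Rintegral_ge0 => w _; rewrite le_max lexx orbT.
- by apply: measurable_funrpos.
by apply: filterS f0 => w /max_idPl ->.
Qed.

Lemma Ex_le f g : intg f -> intg g -> {ae P, forall w, f w <= g w} -> Ex f <= Ex g.
Proof.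
move=> If Ig fg; rewrite -subr_ge0 -ExB//; apply: Ex_ge0.
  exact/intg_measurable/intgB.
by apply: filterS fg => w; rewrite subr_ge0.
Qed.

(** The passage from optimality to an identity: applied to the gain from a deviation, to the loss of
    utility against the best plan, and to terminal assets. *)
Lemma Ex_eq0_ae f : intg f -> {ae P, forall w, 0 <= f w} -> Ex f <= 0 ->
  {ae P, forall w, f w = 0}.
Proof.
move=> If f0 Ef0; have mf := intg_measurable If.
have /(ae_eq_integral_abs P measurableT) : measurable_fun [set: Omega] (EFin \o f).
  exact/measurable_EFinP.
move=> [+ _]; have -> : (\int[P]_x `|(EFin \o f) x|)%E = 0%E.
  have /(EFin_Ex) /= E : intg (Num.norm \o f) by exact: integrable_norm.
  rewrite [LHS]E; congr EFin; apply/eqP; rewrite eq_le; apply/andP; split.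
    apply: le_trans Ef0; apply: Ex_le => //; first exact: integrable_norm.
    by apply: filterS f0 => w /= /ger0_norm ->.
  by apply: Ex_ge0; [exact: measurableT_comp|apply: aeW => w /=; exact: normr_ge0].
by move=> /(_ erefl); apply: filterS => w /= /(_ I) [].
Qed.

Lemma Ex_ge0_intg f : measurable_fun [set: Omega] f -> {ae P, forall w, 0 <= f w} ->
  (\int[P]_w (f w)%:E < +oo)%E -> intg f.
Proof.
move=> mf f0 fin; apply/integrableP; split; first exact/measurable_EFinP.
rewrite (ae_eq_integral (EFin \o f))//.
- by apply/measurableT_comp => //; exact/measurable_EFinP.
- exact/measurable_EFinP.
by apply: filterS f0 => w w0 _ /=; rewrite ger0_norm.
Qed.

End integrals.

(** * Conditional expectation *)

Section adapted.
Context (R : realType) (d : measure_display) (Omega : measurableType d)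
  (G : set (set Omega)).
Implicit Types f g : Omega -> R.

(** Prices that may vanish stand in denominators. Inversion is continuous on the open set of nonzero
    numbers, and a single point remains. *)
Lemma measurable_inv : measurable_fun [set: R] (fun x : R => x^-1).
Proof.
have -> : [set: R] = [set x | x != 0] `|` [set 0].
  by apply/seteqP; split => x //= _; case: (eqVneq x 0) => ?; [right|left].
have o0 : open [set x : R | x != 0].
  rewrite (_ : [set x | _] = ~` [set 0]).
    by apply/closed_openC; exact: closed_eq.
  by apply/seteqP; split => x /=; move/eqP.
apply/measurable_funU => //; first exact: open_measurable.
split; last exact: measurable_fun_set1.
by apply: open_continuous_measurable_fun => // x; rewrite inE => x0; exact: inv_continuous.
Qed.

Hypothesis sG : sigma_algebra [set: Omega] G.

(** Passing to the type that carries the sigma-algebra [G] makes the closure lemmas for measurable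
    functions available for adapted ones. *)
Lemma adaptedP f : adapted_to G f <->
  measurable_fun [set: g_sigma_algebraType G] (f : g_sigma_algebraType G -> R).
Proof.
have GE := @sigma_algebra_id _ setT _ sG.
split=> [af _ B mB|mf B mB].
  by rewrite setTI; rewrite /measurable/= GE; exact: af.
by have := mf measurableT B mB; rewrite setTI /measurable/= GE.
Qed.

Lemma adapted_cst k : adapted_to G (fun=> k : R).
Proof. by apply/adaptedP; exact: measurable_cst. Qed.

Lemma adaptedD f g : adapted_to G f -> adapted_to G g ->
  adapted_to G (fun w => f w + g w).
Proof. by move=> /adaptedP mf /adaptedP mg; apply/adaptedP; exact: measurable_funD. Qed.

Lemma adaptedB f g : adapted_to G f -> adapted_to G g ->
  adapted_to G (fun w => f w - g w).
Proof. by move=> /adaptedP mf /adaptedP mg; apply/adaptedP; exact: measurable_funB. Qed.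

Lemma adaptedM f g : adapted_to G f -> adapted_to G g ->
  adapted_to G (fun w => f w * g w).
Proof. by move=> /adaptedP mf /adaptedP mg; apply/adaptedP; exact: measurable_funM. Qed.

Lemma adapted_comp (u : R -> R) f : measurable_fun [set: R] u -> adapted_to G f ->
  adapted_to G (fun w => u (f w)).
Proof. by move=> mu /adaptedP mf; apply/adaptedP; exact: measurableT_comp. Qed.

Lemma adaptedV f : adapted_to G f -> adapted_to G (fun w => (f w)^-1).
Proof. by move=> af; exact: (adapted_comp measurable_inv). Qed.

Lemma adapted_div f g : adapted_to G f -> adapted_to G g ->
  adapted_to G (fun w => f w / g w).
Proof. by move=> af ag; apply: adaptedM => //; exact: adaptedV. Qed.

Lemma adaptedZ k f : adapted_to G f -> adapted_to G (fun w => k * f w).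
Proof. by apply: adaptedM; exact: adapted_cst. Qed.

Lemma adapted_max f g : adapted_to G f -> adapted_to G g ->
  adapted_to G (fun w => Num.max (f w) (g w)).
Proof. by move=> /adaptedP mf /adaptedP mg; apply/adaptedP; exact: measurable_maxr. Qed.

Lemma adapted_sum (I : Type) (r : seq I) (h : I -> Omega -> R) :
  (forall i, adapted_to G (h i)) -> adapted_to G (fun w => \sum_(i <- r) h i w).
Proof.
by move=> ah; apply/adaptedP; apply: measurable_sum => i; exact/adaptedP.
Qed.

Lemma adapted_indic A : G A -> adapted_to G (\1_A : Omega -> R).
Proof.
move=> GA; apply/adaptedP; apply: measurable_indic.
by rewrite /measurable/= sigma_algebra_id.
Qed.

Lemma adapted_lt f g : adapted_to G f -> adapted_to G g -> G [set w | f w < g w].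
Proof.
move=> af ag; have := adaptedB af ag => /(_ `]-oo, 0[%classic (measurable_itv _)).
by congr G; apply/seteqP; split => w /=; rewrite in_itv/= subr_lt0.
Qed.

Lemma adapted_le f g : adapted_to G f -> adapted_to G g -> G [set w | f w <= g w].
Proof.
move=> af ag; have := adaptedB af ag => /(_ `]-oo, 0]%classic (measurable_itv _)).
by congr G; apply/seteqP; split => w /=; rewrite in_itv/= subr_le0.
Qed.

End adapted.

Lemma adapted_sub (R : realType) (d : measure_display) (Omega : measurableType d)
    (G G' : set (set Omega)) (f : Omega -> R) :
  G `<=` G' -> adapted_to G f -> adapted_to G' f.
Proof. by move=> GG af B mB; apply/GG/af. Qed.

Lemma adapted_measurable (R : realType) (d : measure_display) (Omega : measurableType d)
    (G : set (set Omega)) (f : Omega -> R) :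
  G `<=` measurable -> adapted_to G f -> measurable_fun [set: Omega] f.
Proof. by move=> Gm af _ B mB; rewrite setTI; apply/Gm/af. Qed.

Section conditional_expectation.
Context (R : realType) (d : measure_display) (Omega : measurableType d)
  (P : probability Omega R) (G : set (set Omega)).
Hypothesis sG : sigma_algebra [set: Omega] G.
Hypothesis Gm : G `<=` measurable.
Implicit Types X Y h : Omega -> R.

Import HBNNSimple.

(** The level sets of a [G]-simple weight lie in [G], so the right side involves [X] only through
    its integrals over sets of [G]. *)
Lemma integral_nnsfunM (h : {nnsfun (g_sigma_algebraType G) >-> R}) X :
  measurable_fun [set: Omega] X -> (forall w, 0 <= X w) ->
  (\int[P]_w (h w * X w)%:E =
   \sum_(y \in range h) (y%:E * \int[P]_(w in h @^-1` [set y]) (X w)%:E))%E.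
Proof.
move=> mX X0.
have mh y : measurable (h @^-1` [set y] : set Omega).
  apply: Gm; have := @measurable_funPTI _ _ _ _ h _ (measurable_set1 y).
  by rewrite /measurable/= sigma_algebra_id.
transitivity (\int[P]_w (\sum_(y \in range h)
    (y * \1_(h @^-1` [set y]) w * X w)%:E))%E.
  apply: eq_integral => w _; rewrite {1}fimfunE.
  by rewrite (fsbig_finite _ _ (fimfunP h)) fsbig_finite//= mulr_suml sumEFin.
rewrite ge0_integral_fsum//.
- apply: eq_fsbigr => y /[!inE] -[t _ yE].
  have y0 : 0 <= y by rewrite -yE.
  rewrite [in RHS]integral_mkcond -ge0_integralZl_EFin//.
  + apply: eq_integral => w _; rewrite -mulrA EFinM; congr (_ * _)%E.
    by rewrite /patch indicE; case: ifPn => _; rewrite ?mul1r ?mul0r.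
  + by move=> w _; rewrite /patch; case: ifPn => //; rewrite lee_fin.
  + apply/(measurable_restrictT _ (mh y)).
    by apply/measurable_EFinP; exact: measurable_funS mX.
- move=> y; apply/measurable_EFinP; apply: measurable_funM => //.
  by apply: measurable_funM => //; apply: measurable_indic.
- move=> y w _; rewrite lee_fin mulr_ge0// indicE.
  case: (boolP (w \in _)) => [|_]; last by rewrite mulr0.
  by rewrite inE/= => <-; rewrite mulr1.
Qed.

(** Simple weights are settled by their level sets; a general [h] is an increasing limit of
    [G]-simple functions, and monotone convergence applies without any integrability of the
    products. *)
Lemma pull_out_ge0 X Y h : measurable_fun [set: Omega] X ->
  measurable_fun [set: Omega] Y -> adapted_to G h ->
  (forall w, 0 <= X w) -> (forall w, 0 <= Y w) -> (forall w, 0 <= h w) ->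
  (forall A, G A -> \int[P]_(w in A) (X w)%:E = \int[P]_(w in A) (Y w)%:E)%E ->
  (\int[P]_w (h w * X w)%:E = \int[P]_w (h w * Y w)%:E)%E.
Proof.
move=> mX mY ah X0 Y0 h0 XY.
have mh : measurable_fun [set: g_sigma_algebraType G]
    (EFin \o (h : g_sigma_algebraType G -> R)).
  by apply/measurable_EFinP/adaptedP.
pose hn := nnsfun_approx measurableT mh.
have lim (Z : Omega -> R) : measurable_fun [set: Omega] Z -> (forall w, 0 <= Z w) ->
    (\int[P]_w (hn n w * Z w)%:E @[n --> \oo] --> \int[P]_w (h w * Z w)%:E)%E.
  move=> mZ Z0.
  have -> : (\int[P]_w (h w * Z w)%:E =
      \int[P]_w (limn (fun n => (hn n w * Z w)%:E)))%E.
    apply: eq_integral => w _; apply/esym/cvg_lim => //.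
    have := @cvg_nnsfun_approx _ _ _ _ measurableT _ mh.
    move=> /(_ (fun x _ => h0 x) w I) hc.
    under eq_fun do rewrite EFinM.
    rewrite EFinM; apply: cvgeM => //; first exact: cvg_cst.
  apply: cvg_monotone_convergence => //.
  - move=> n; apply/measurable_EFinP; apply: measurable_funM => //.
    apply: (@adapted_measurable _ _ _ G) => //; apply/adaptedP => //.
  - by move=> n w _; rewrite lee_fin mulr_ge0.
  - move=> w _ m n mn; rewrite lee_fin ler_wpM2r//.
    by have /lefP := nd_nnsfun_approx measurableT mh mn; apply.
have := lim X mX X0.
under eq_fun do rewrite integral_nnsfunM//.
have -> : (fun n => \sum_(y \in range (hn n)) y%:E *
    \int[P]_(w in hn n @^-1` [set y]) (X w)%:E)%E =
   (fun n => \int[P]_w (hn n w * Y w)%:E)%E.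
  apply/funext => n; rewrite integral_nnsfunM//; apply: eq_fsbigr => y _.
  rewrite XY//.
  have := @measurable_funPTI _ _ _ _ (hn n) _ (measurable_set1 y).
  by rewrite /measurable/= sigma_algebra_id.
move=> lX; have lY := lim Y mY Y0.
by have := cvg_unique _ lX lY; apply.
Qed.

End conditional_expectation.

Section conditional_expectation_ae.
Context (R : realType) (d : measure_display) (Omega : measurableType d)
  (P : probability Omega R).
Implicit Types X Y Z h : Omega -> R.

Local Notation intg f := (P.-integrable [set: Omega] (EFin \o f)).
Local Notation Ex f := (Rintegral P [set: Omega] f).

Lemma Rintegral_indic (A : set Omega) X :
  \int[P]_(w in A) X w = Ex (fun w => \1_A w * X w).
Proof.
rewrite Rintegral_mkcond; apply: eq_Rintegral => w _.
by rewrite /patch indicE; case: ifPn => _; rewrite ?mul1r ?mul0r.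
Qed.

Lemma measurable_indicM (A : set Omega) X : measurable A ->
  measurable_fun [set: Omega] X -> measurable_fun [set: Omega] (fun w => \1_A w * X w).
Proof. by move=> mA mX; apply: measurable_funM => //; exact: measurable_indic. Qed.

Lemma intg_indic (A : set Omega) X : measurable A -> intg X ->
  intg (fun w => \1_A w * X w).
Proof.
move=> mA IX; apply: intg_le (integrable_norm IX).
  exact/measurable_indicM/(intg_measurable IX).
apply: aeW => w /=; rewrite normrM ler_piMl// indicE.
by case: (_ \in _); rewrite ?normr1 ?normr0.
Qed.

Lemma ae_indic_ge0 (A : set Omega) X : {ae P, forall w, 0 <= X w} ->
  {ae P, forall w, 0 <= \1_A w * X w}.
Proof. by apply: filterS => w X0; rewrite mulr_ge0// indicE. Qed.

Lemma indic_in (A : set Omega) w : A w -> \1_A w = 1 :> R.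
Proof. by move=> Aw; rewrite indicE mem_set. Qed.

Lemma indic_out (A : set Omega) w : ~ A w -> \1_A w = 0 :> R.
Proof. by move=> Aw; rewrite indicE memNset. Qed.

(** The model gives nonnegativity only almost surely, while monotone convergence is used for
    functions nonnegative everywhere; truncation at 0 bridges the two. *)
Lemma integral_max0 (A : set Omega) X : measurable A -> intg X ->
  {ae P, forall w, 0 <= X w} ->
  (\int[P]_(w in A) (Num.max (X w) 0)%:E = (Ex (fun w => \1_A w * X w))%:E)%E.
Proof.
move=> mA IX X0; have mX := intg_measurable IX.
rewrite integral_mkcond -EFin_Ex; last exact: intg_indic.
apply: ae_eq_integral => //.
- apply/(measurable_restrictT _ mA)/measurable_EFinP.
  exact/(@measurable_funS _ _ _ _ setT)/measurable_funrpos.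
- exact/measurable_EFinP/measurable_indicM.
apply: filterS X0 => w X0 _; rewrite /patch; have /max_idPl -> := X0.
by rewrite indicE; case: ifPn => _; rewrite ?mul1r ?mul0r.
Qed.

Section sub_sigma_algebra.
Variable G : set (set Omega).
Hypothesis sG : sigma_algebra [set: Omega] G.
Hypothesis Gm : G `<=` measurable.

(** The set where the inequality fails belongs to [G], so it may serve as the test set; the excess
    on it has nonpositive mean. *)
Lemma adapted_ae_le Y Z : adapted_to G Y -> adapted_to G Z -> intg Y -> intg Z ->
  (forall A, G A -> Ex (fun w => \1_A w * Y w) <= Ex (fun w => \1_A w * Z w)) ->
  {ae P, forall w, Y w <= Z w}.
Proof.
move=> aY aZ IY IZ YZ; pose A := [set w | Z w < Y w].
have GA : G A by exact: adapted_lt.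
have mA := Gm GA.
have : {ae P, forall w, \1_A w * (Y w - Z w) = 0}.
  apply: Ex_eq0_ae.
  - exact/intg_indic/intgB.
  - apply: aeW => w; have [Aw|Aw] := pselect (A w).
      by rewrite indic_in// mul1r subr_ge0 ltW.
    by rewrite indic_out// mul0r.
  have := YZ _ GA; rewrite -subr_le0 -ExB; [|exact: intg_indic..].
  by under eq_Rintegral do rewrite -mulrBr.
apply: filterS => w; have [Aw|/negP] := pselect (A w).
  by rewrite indic_in// mul1r => /eqP; rewrite subr_eq0 => /eqP ->.
by rewrite -leNgt.
Qed.

Lemma adapted_ae_eq Y Z : adapted_to G Y -> adapted_to G Z -> intg Y -> intg Z ->
  (forall A, G A -> Ex (fun w => \1_A w * Y w) = Ex (fun w => \1_A w * Z w)) ->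
  {ae P, forall w, Y w = Z w}.
Proof.
move=> aY aZ IY IZ YZ.
have YleZ : {ae P, forall w, Y w <= Z w}.
  by apply: adapted_ae_le => // A /YZ ->.
have ZleY : {ae P, forall w, Z w <= Y w}.
  by apply: adapted_ae_le => // A /YZ ->.
by apply: filterS2 YleZ ZleY => w yz zy; apply/eqP; rewrite eq_le yz zy.
Qed.

Lemma cond_expE X Y A : is_cond_exp P G X Y -> G A ->
  Ex (fun w => \1_A w * Y w) = Ex (fun w => \1_A w * X w).
Proof.
move=> [_ _ /(_ A)].
by rewrite (Rintegral_indic A X) (Rintegral_indic A Y); exact.
Qed.

Lemma cond_exp_ge0 X Y : is_cond_exp P G X Y -> intg X ->
  {ae P, forall w, 0 <= X w} -> {ae P, forall w, 0 <= Y w}.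
Proof.
move=> XY IX X0; have [aY IY _] := XY.
apply: adapted_ae_le => //; [exact: adapted_cst|exact: intg_cst|].
move=> A GA; rewrite [leRHS](cond_expE XY GA).
have -> : Ex (fun w => \1_A w * 0) = 0.
  by rewrite -[RHS](Ex_cst P); apply: eq_Rintegral => w _; rewrite mulr0.
apply: Ex_ge0; last exact: ae_indic_ge0.
exact/measurable_indicM/(intg_measurable IX)/Gm.
Qed.

(** An equality in [[0, +oo]], so integrability of either product yields that of the other; the next
    two lemmas are these two directions. *)
Lemma pull_out X Y h : is_cond_exp P G X Y -> intg X ->
  {ae P, forall w, 0 <= X w} -> adapted_to G h -> {ae P, forall w, 0 <= h w} ->
  (\int[P]_w (h w * X w)%:E = \int[P]_w (h w * Y w)%:E)%E.
Proof.
move=> XY IX X0 ah h0; have Y0 := cond_exp_ge0 XY IX X0.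
have [_ IY _] := XY; have mh := adapted_measurable Gm ah.
have mX := intg_measurable IX; have mY := intg_measurable IY.
have E (Z : Omega -> R) : measurable_fun [set: Omega] Z -> {ae P, forall w, 0 <= Z w} ->
    (\int[P]_w (h w * Z w)%:E =
     \int[P]_w (Num.max (h w) 0 * Num.max (Z w) 0)%:E)%E.
  move=> mZ Z0; apply: ae_eq_integral => //.
  - exact/measurable_EFinP/measurable_funM.
  - apply/measurable_EFinP/measurable_funM; exact: measurable_funrpos.
  by apply: filterS2 h0 Z0 => w /max_idPl -> /max_idPl ->.
rewrite !E//; apply: (pull_out_ge0 sG Gm) => //; try exact: measurable_funrpos.
- by apply: adapted_max => //; exact: adapted_cst.
- by move=> w; rewrite le_max lexx orbT.
- by move=> w; rewrite le_max lexx orbT.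
- by move=> w; rewrite le_max lexx orbT.
- move=> A GA; rewrite !integral_max0//; try exact: Gm.
  by rewrite (cond_expE XY).
Qed.

Lemma pull_out_intg X Y h : is_cond_exp P G X Y -> intg X ->
  {ae P, forall w, 0 <= X w} -> adapted_to G h -> {ae P, forall w, 0 <= h w} ->
  intg (fun w => h w * Y w) ->
  intg (fun w => h w * X w) /\ Ex (fun w => h w * X w) = Ex (fun w => h w * Y w).
Proof.
move=> XY IX X0 ah h0 IhY; have E := pull_out XY IX X0 ah h0.
split; last by rewrite /Rintegral E.
apply: Ex_ge0_intg.
- apply: measurable_funM; first exact: adapted_measurable ah.
  exact: intg_measurable IX.
- by apply: filterS2 h0 X0 => w *; exact: mulr_ge0.
by rewrite E (EFin_Ex IhY) ltry.
Qed.

Lemma pull_out_intg_rev X Y h : is_cond_exp P G X Y -> intg X ->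
  {ae P, forall w, 0 <= X w} -> adapted_to G h -> {ae P, forall w, 0 <= h w} ->
  intg (fun w => h w * X w) ->
  intg (fun w => h w * Y w) /\ Ex (fun w => h w * X w) = Ex (fun w => h w * Y w).
Proof.
move=> XY IX X0 ah h0 IhX; have E := pull_out XY IX X0 ah h0.
have Y0 := cond_exp_ge0 XY IX X0; have [_ IY _] := XY.
split; last by rewrite /Rintegral E.
apply: Ex_ge0_intg.
- apply: measurable_funM; first exact: adapted_measurable ah.
  exact: intg_measurable IY.
- by apply: filterS2 h0 Y0 => w *; exact: mulr_ge0.
by rewrite -E (EFin_Ex IhX) ltry.
Qed.

End sub_sigma_algebra.

(** Independence is given for sets only. The roles are exchanged to reach functions: an indicator of
    [G] has a constant conditional expectation given [G'], and [X] is a known factor there. *)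
Lemma indep_cond_exp (G G' : set (set Omega)) X :
  sigma_algebra [set: Omega] G -> G `<=` measurable ->
  sigma_algebra [set: Omega] G' -> G' `<=` measurable ->
  (forall A B, G A -> G' B -> P (A `&` B) = (P A * P B)%E) ->
  adapted_to G' X -> intg X -> {ae P, forall w, 0 <= X w} ->
  is_cond_exp P G X (fun=> Ex X).
Proof.
move=> sG Gm sG' Gm' ind aX IX X0; split; [exact: adapted_cst|exact: intg_cst|].
move=> A GA; rewrite (Rintegral_indic A X) (Rintegral_indic A (fun=> Ex X)).
have mA := Gm _ GA.
have ip (B : set Omega) : measurable B -> Ex (\1_B : Omega -> R) = fine (P B).
  by move=> mB; rewrite /Rintegral integral_indic// setIT.
(* This is independence on sets, read as a conditional expectation given [G']. *)
have PA : is_cond_exp P G' (\1_A : Omega -> R) (fun=> fine (P A)).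
  split; [exact: adapted_cst|exact: intg_cst|].
  move=> B GB; have mB := Gm' _ GB.
  rewrite (Rintegral_indic B (\1_A)) (Rintegral_indic B (fun=> fine (P A))).
  rewrite (_ : (fun w => \1_B w * \1_A w) = (\1_(A `&` B) : Omega -> R)); last first.
    by apply/funext => w; rewrite indicI/= mulrC.
  rewrite ip; last exact: measurableI.
  rewrite ind// fineM ?fin_num_measure//.
  under eq_Rintegral do rewrite mulrC.
  by rewrite ExZ ?ip//; exact: integrable_indic.
have I1 : intg (\1_A : Omega -> R) by exact: integrable_indic.
have : intg (fun w => X w * fine (P A)).
  by apply: eq_integrable (intgZ (fine (P A)) IX) => // w _ /=; rewrite mulrC.
move=> /(pull_out_intg sG' Gm' PA I1 _ aX X0) [|_].
  by apply: aeW => w; rewrite indicE.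
under eq_Rintegral do rewrite mulrC.
under [in RHS]eq_Rintegral do rewrite mulrC.
move=> ->; rewrite ExZ//.
under eq_Rintegral do rewrite mulrC.
by rewrite ExZ// ip// mulrC.
Qed.

End conditional_expectation_ae.

(** * Concave utility *)

Section concave_utility.
Context (R : realType) (u : R -> R).
Hypothesis u_concave : weakly_concave u.
Hypothesis u_nd : forall x y, 0 <= x -> x <= y -> u x <= u y.

(** Concavity at [x] seen as a convex combination of [a] and [y], with the denominators cleared. *)
Lemma concave_three_points a x y : 0 <= a -> a < x -> x < y ->
  (y - x) * u a + (x - a) * u y <= (y - a) * u x.
Proof.
move=> a0 ax xy; have ya : 0 < y - a by lra.
have yn : y - a != 0 by rewrite gt_eqF.
have l0 : 0 <= (y - x) / (y - a) by rewrite divr_ge0 ?ltW//; lra.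
have l1 : (y - x) / (y - a) <= 1 by rewrite ler_pdivrMr//; lra.
have := @u_concave a y _ a0 _ l0 l1.
have -> : (y - x) / (y - a) * a + (1 - (y - x) / (y - a)) * y = x by field.
move=> /(_ ltac:(lra)); rewrite -(ler_pM2l ya); apply: le_trans.
rewrite le_eqVlt; apply/orP; left; apply/eqP; field.
exact: yn.
Qed.

Lemma supergradient : exists g : R -> R, forall x, 0 < x ->
  0 <= g x /\ forall y, 0 <= y -> u y <= u x + g x * (y - x).
Proof.
(* The supremum of the slopes of chords to the right of [x], that is, the right derivative. *)
pose A x := [set (u y - u x) / (y - x) | y in [set y | x < y]].
exists (fun x => sup (A x)) => x x0.
have A0 : A x !=set0.
  by exists ((u (x + 1) - u x) / (x + 1 - x)); exists (x + 1) => //=; lra.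
(* Slopes on the left dominate slopes on the right. As [x] is positive, there is a point of the
   domain on its left, so the supremum is finite. *)
have Aub a : 0 <= a -> a < x -> ubound (A x) ((u x - u a) / (x - a)).
  move=> a0 ax _ [y /= xy <-].
  rewrite ler_pdivrMr ?subr_gt0// mulrAC ler_pdivlMr ?subr_gt0//.
  by have := concave_three_points a0 ax xy; nra.
have As : has_sup (A x).
  by split=> //; exists ((u x - u 0) / (x - 0)); exact: Aub.
have Ale y : x < y -> (u y - u x) / (y - x) <= sup (A x).
  by move=> xy; apply: ub_le_sup; [exact: As.2|exists y].
split.
  apply: le_trans (Ale (x + 1) _); last lra.
  by rewrite divr_ge0 ?subr_ge0 ?u_nd//; lra.
move=> y y0; case: (ltgtP y x) => [yx|xy|->].
- have : sup (A x) <= (u x - u y) / (x - y).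
    by apply: sup_le_ub => //; exact: Aub.
  by rewrite ler_pdivlMr ?subr_gt0//; nra.
- by have := Ale _ xy; rewrite ler_pdivrMr ?subr_gt0//; nra.
- by rewrite subrr mulr0 addr0.
Qed.

(** The supergradient inequalities at [x] and at [y] are added. Monotonicity later gives both the
    measurability of the weight and its bound. *)
Lemma supergradient_nonincreasing g x y :
  (forall x, 0 < x -> forall y, 0 <= y -> u y <= u x + g x * (y - x)) ->
  0 < x -> x <= y -> g y <= g x.
Proof.
move=> gP x0; rewrite le_eqVlt => /predU1P[->//|xy].
have y0 : 0 < y by lra.
have := gP x x0 y (ltW y0); have := gP y y0 x (ltW x0) => h1 h2.
by rewrite -subr_ge0 -(pmulr_lge0 _ (_ : 0 < y - x)) ?subr_gt0//; nra.
Qed.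

Lemma supergradient_strict g x y : strictly_concave u ->
  (forall x, 0 < x -> forall y, 0 <= y -> u y <= u x + g x * (y - x)) ->
  0 < x -> 0 <= y -> x != y -> u y < u x + g x * (y - x).
Proof.
move=> su gP x0 y0 xy.
have h : (2^-1 : R) < 1 by rewrite invf_lt1// ltr1n.
have := su x y 2^-1 (ltW x0) y0 xy; rewrite invr_gt0 ltr0n => /(_ isT h).
(* At the midpoint the tangent bound combines with strict concavity; doubling the result gives the
   strict bound at [y]. *)
have := gP x x0 (2^-1 * x + (1 - 2^-1) * y).
have -> : 1 - 2^-1 = 2^-1 :> R by lra.
move=> /(_ ltac:(lra)) h1 h2; have := lt_le_trans h2 h1.
have -> : g x * (2^-1 * x + 2^-1 * y - x) = 2^-1 * (g x * (y - x)) by field.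
lra.
Qed.

Lemma strictly_concave_increasing x y : strictly_concave u ->
  0 <= x -> x < y -> u x < u y.
Proof.
move=> su x0 xy; have h : (2^-1 : R) < 1 by rewrite invf_lt1// ltr1n.
have y0 : 0 <= y by lra.
have := su x y 2^-1 x0 y0; rewrite (lt_eqF xy) invr_gt0 ltr0n => /(_ isT isT h) h1.
have := @u_nd x y x0 (ltW xy); rewrite le_eqVlt => /predU1P[uxy|//].
have : u (2^-1 * x + (1 - 2^-1) * y) <= u y by apply: u_nd; lra.
by move: h1; rewrite uxy; lra.
Qed.

Context (d : measure_display) (Omega : measurableType d) (P : probability Omega R).

Local Notation intg f := (P.-integrable [set: Omega] (EFin \o f)).
Local Notation Ex f := (Rintegral P [set: Omega] f).

(** [u] is monotone on nonnegative arguments only; composed with truncation at 0 it is monotone on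
    the whole line, hence measurable. *)
Lemma measurable_utility (c : Omega -> R) : measurable_fun [set: Omega] c ->
  (forall w, 0 <= c w) -> measurable_fun [set: Omega] (fun w => u (c w)).
Proof.
move=> mc c0.
rewrite (_ : (fun w => u (c w)) = (fun y => u (Num.max y 0)) \o c); last first.
  by apply/funext => w /=; have /max_idPl -> := c0 w.
apply: measurableT_comp => //; apply: nondecreasing_measurable => // y z yz.
apply: u_nd; first by rewrite le_max lexx orbT.
by rewrite ge_max !le_max yz lexx !orbT.
Qed.

(** The utility lies between the constant [u 0] and the tangent at 1, which is affine in [c]. *)
Lemma intg_utility (c : Omega -> R) : (forall w, 0 <= c w) -> intg c ->
  intg (fun w => u (c w)).
Proof.
move=> c0 Ic; have [g gP] := supergradient; have [g1 g1P] := gP 1 ltr01.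
apply: (@intg_le _ _ _ _ _ (fun w => (`|u 0| + `|u 1|) + g 1 * c w)).
- exact/measurable_utility/c0/(intg_measurable Ic).
- apply: aeW => w.
  have h0 := u_nd (lexx 0) (c0 w); have h1 := g1P _ (c0 w).
  have hu0 := ler_norm (- u 0); have hu1 := ler_norm (u 1).
  rewrite normrN in hu0; have := normr_ge0 (u 0); have := normr_ge0 (u 1).
  have : 0 <= g 1 * c w by rewrite mulr_ge0.
  by rewrite ler_norml; lra.
- by apply: intgD; [exact: intg_cst|exact: intgZ].
Qed.

(** * Consumption smoothing under a budget tested by bounded known weights *)

Section smoothing.
Variables (G : set (set Omega)) (I : eqType) (r : seq I) (Q : pred I) (a : I -> R).
Variables (c : I -> Omega -> R) (x : Omega -> R) (x0 : R).
Hypothesis sG : sigma_algebra [set: Omega] G.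
Hypothesis Gm : G `<=` measurable.
Hypothesis a_gt0 : forall i, Q i -> 0 < a i.
Hypothesis c_ge0 : forall i, Q i -> forall w, 0 <= c i w.
Hypothesis c_int : forall i, Q i -> intg (c i).
Hypothesis x0_gt0 : 0 < x0.
Hypothesis x_ge : forall w, x0 <= x w.
Hypothesis x_adapted : adapted_to G x.
Hypothesis x_int : intg x.
Let D := \sum_(i <- r | Q i) a i.
Hypothesis budget : forall (g : Omega -> R) K, adapted_to G g ->
  (forall w, 0 <= g w <= K) ->
  Ex (fun w => g w * \sum_(i <- r | Q i) a i * c i w) <= D * Ex (fun w => g w * x w).

(** The gap is the distance from [u (c i)] up to the tangent at [x]. Its slope [g (x w)] is adapted
    and lies between 0 and [g x0], so [budget] applies with it as weight and makes the sum of the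
    first-order terms nonpositive in mean. *)
Lemma smoothing_gap : exists gap : I -> Omega -> R,
  [/\ forall i w, Q i -> 0 <= gap i w,
      strictly_concave u -> forall i w, Q i -> gap i w = 0 -> c i w = x w,
      forall i, Q i -> intg (gap i) &
      Ex (fun w => \sum_(i <- r | Q i) a i * u (c i w)) +
      \sum_(i <- r | Q i) a i * Ex (gap i) <= D * Ex (fun w => u (x w))].
Proof.
have [g gP] := supergradient.
have gP2 z : 0 < z -> forall y, 0 <= y -> u y <= u z + g z * (y - z).
  by move=> /gP[].
have x_gt0 w : 0 < x w := lt_le_trans x0_gt0 (x_ge w).
pose K := g x0; pose h w := g (x w).
have h0K w : 0 <= h w <= K.
  rewrite (gP (x w) _).1//= /K /h.
  exact: (supergradient_nonincreasing gP2).
have ah : adapted_to G h.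
  (* The slope is monotone on positive arguments only; cutting the argument at [x0] makes it
     monotone on the line without changing [h]. *)
  have -> : h = (fun w => g (Num.max (x w) x0)).
    by apply/funext => w; have /max_idPl -> := x_ge w.
  apply: (adapted_comp sG (u := fun y => g (Num.max y x0))) => //.
  apply: nonincreasing_measurable => // y z yz.
  apply: (supergradient_nonincreasing gP2); first by rewrite lt_max x0_gt0 orbT.
  by rewrite ge_max !le_max yz lexx !orbT.
have mh := adapted_measurable Gm ah.
have Ih f : intg f -> intg (fun w => h w * f w).
  move=> If; apply: (@intg_le _ _ _ _ _ (fun w => K * `|f w|)).
  - by apply: measurable_funM => //; exact: intg_measurable If.
  - apply: aeW => w; have /andP[h0 hK] := h0K w.
    by rewrite normrM ger0_norm// ler_wpM2r.
  - exact/intgZ/integrable_norm.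
have xge0 w : 0 <= x w by exact: ltW.
have Iux := intg_utility xge0 x_int.
pose gap i w := u (x w) + h w * (c i w - x w) - u (c i w).
have Igap i : Q i -> intg (gap i).
  move=> Qi; apply: intgB; last by apply: intg_utility; [exact: c_ge0|exact: c_int].
  by apply: intgD => //; apply: Ih; apply: intgB => //; exact: c_int.
exists gap; split => //.
- by move=> i w Qi; rewrite /gap subr_ge0; apply: gP2 => //; exact: c_ge0.
- move=> su i w Qi gap0; apply/eqP; rewrite eq_sym; apply/negPn/negP => xc.
  have := supergradient_strict su gP2 (x_gt0 w) (c_ge0 Qi w) xc.
  by move: gap0; rewrite /gap /h; lra.
have Iuc i : Q i -> intg (fun w => a i * u (c i w)).
  by move=> Qi; apply/intgZ/intg_utility; [exact: c_ge0|exact: c_int].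
have Ihc i : Q i -> intg (fun w => h w * c i w) by move=> Qi; exact/Ih/c_int.
have Ihx := Ih _ x_int.
have E i : Q i -> a i * Ex (gap i) = a i * Ex (fun w => u (x w)) +
    a i * Ex (fun w => h w * c i w) - a i * Ex (fun w => h w * x w) -
    Ex (fun w => a i * u (c i w)).
  move=> Qi.
  have Iuci : intg (fun w => u (c i w)).
    by apply: intg_utility; [exact: c_ge0|exact: c_int].
  rewrite ExZ// /gap ExB//; last first.
    by apply: intgD => //; apply: Ih; apply: intgB => //; exact: c_int.
  rewrite ExD//; last by apply: Ih; apply: intgB => //; exact: c_int.
  have -> : Ex (fun w => h w * (c i w - x w)) =
      Ex (fun w => h w * c i w) - Ex (fun w => h w * x w).
    by rewrite -ExB//; [apply: eq_Rintegral => w _; rewrite mulrBr|exact: Ihc].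
  by rewrite !mulrBr !mulrDr !mulrN; lra.
rewrite (eq_bigr _ E) !sumrB big_split/= Ex_sum// -!mulr_suml -/D.
have := budget ah h0K.
have -> : Ex (fun w => h w * (\sum_(i <- r | Q i) a i * c i w)) =
    \sum_(i <- r | Q i) a i * Ex (fun w => h w * c i w).
  transitivity (\sum_(i <- r | Q i) Ex (fun w => a i * (h w * c i w))).
    rewrite -Ex_sum; last by move=> i Qi; exact/intgZ/Ihc.
    apply: eq_Rintegral => w _; rewrite mulr_sumr; apply: eq_bigr => i _.
    by rewrite mulrCA.
  by apply: eq_bigr => i Qi; rewrite ExZ//; exact: Ihc.
lra.
Qed.

Lemma smoothing_le :
  Ex (fun w => \sum_(i <- r | Q i) a i * u (c i w)) <= D * Ex (fun w => u (x w)).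
Proof.
have [gap [gap0 _ Igap]] := smoothing_gap; apply: le_trans; rewrite lerDl.
apply: sumr_ge0 => i Qi; rewrite mulr_ge0//; first exact/ltW/a_gt0.
by apply: Rintegral_ge0 => w _; exact: gap0.
Qed.

(** The weighted gaps fill the slack in [smoothing_le]. Without slack each nonnegative gap vanishes,
    and strict concavity turns a zero gap into equality. *)
Lemma smoothing_eq : strictly_concave u ->
  D * Ex (fun w => u (x w)) <= Ex (fun w => \sum_(i <- r | Q i) a i * u (c i w)) ->
  forall i, i \in r -> Q i -> {ae P, forall w, c i w = x w}.
Proof.
move=> su opt i ir Qi; have [gap [gap0 gapx Igap le]] := smoothing_gap.
have s0 : \sum_(i <- r | Q i) a i * Ex (gap i) <= 0 by lra.
have t0 j : Q j -> 0 <= a j * Ex (gap j).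
  move=> Qj; rewrite mulr_ge0//; first exact/ltW/a_gt0.
  by apply: Rintegral_ge0 => w _; exact: gap0.
have : {ae P, forall w, gap i w = 0}.
  apply: Ex_eq0_ae; first exact: Igap.
    by apply: aeW => w; exact: gap0.
  rewrite -(pmulr_rle0 _ (a_gt0 Qi)); apply: le_trans s0.
  rewrite (perm_big _ (perm_to_rem ir))/= big_cons Qi lerDl.
  by apply: sumr_ge0.
by apply: filterS => w; exact: gapx.
Qed.

End smoothing.

End concave_utility.

(** * The auction *)

(** Extracts deterministic facts, such as the sign of a growth rate, from almost sure ones. *)
Lemma ae_exists (R : realType) (d : measure_display) (Omega : measurableType d)
    (P : probability Omega R) (Q : Omega -> Prop) :
  {ae P, forall w, Q w} -> exists w, Q w.
Proof.
move=> [N [mN PN sub]]; apply: contrapT => /forallNP nQ.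
have NT : N = setT.
  by apply/seteqP; split => // w _; apply: sub => /=; exact: nQ.
have : (P setT = 0)%E by rewrite -NT.
by rewrite (probability_setT P) => /eqP; rewrite onee_eq0.
Qed.

(** Replaces sorting by counting. The count is a sum of indicators, which makes order statistics
    measurable. *)
Lemma nth_sorted_ge (R : realType) (r : R) (s : seq R) (j : nat) :
  sorted (fun x y : R => y <= x) s -> (j < size s)%N ->
  (r <= nth 0 s j) = (j < count (fun x => r <= x)%R s)%N.
Proof.
elim: s j => [//|x s IH] j /= ss js.
have tr : transitive (fun x y : R => y <= x) by move=> y z t yz /le_trans; apply.
have := ss; rewrite (path_sortedE tr) => /andP[/allP xs ss'].
have [rx|xr] := boolP (r <= x).
  by case: j js => [//|j] js; rewrite add1n ltnS /= IH.
rewrite add0n; have -> : count (fun y => r <= y) s = 0%N.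
  apply/eqP; rewrite -leqn0 leqNgt -has_count -all_predC; apply/allP => y ys /=.
  by apply: contra xr => /le_trans; apply; exact: xs.
rewrite ltn0; apply/negbTE; apply: contra xr => /le_trans; apply.
case: j js => [//|j] /= js.
by apply: xs; exact: mem_nth.
Qed.

Section auction.
Context (R : realType) (d : measure_display) (Omega : measurableType d)
  (P : probability Omega R) (E : auction_env P).
Hypothesis HE : auction_model E.

Local Notation intg f := (P.-integrable [set: Omega] (EFin \o f)).
Local Notation Ex f := (Rintegral P [set: Omega] f).
Local Notation T := (periods E).
Local Notation b := (discount E).
Local Notation k := (mean_revenue E).
Local Notation S := (total_payment E).

Lemma discount_neq0 : b != 0.
Proof. by rewrite gt_eqF// (discount_gt0 HE). Qed.

Lemma valuation_info_sigma t : sigma_algebra [set: Omega] (valuation_info E t).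
Proof. exact: smallest_sigma_algebra. Qed.

Lemma valuation_info_measurable t : valuation_info E t `<=` measurable.
Proof.
apply: smallest_sub; first exact: sigma_algebra_measurable.
move=> _ [i [B [mB ->]]]; rewrite -[X in measurable X]setTI.
exact: measurable_funPT.
Qed.

Lemma info_subset s t : (s <= t)%N -> info E s `<=` info E t.
Proof.
move=> /subnK <-; elim: (t - s)%N => [//|n IH].
by rewrite addSn; apply: subset_trans IH _; exact: info_nondecreasing.
Qed.

Lemma total_payment_adapted t : in_periods T t -> adapted_to (info E t) (S t).
Proof.
move=> tT; apply: adapted_sum => [|i]; first exact: info_sigma.
exact: payment_info.
Qed.

Lemma payment_measurable t i : in_periods T t ->
  measurable_fun [set: Omega] (payment E t i).
Proof.
move=> tT.
exact: (adapted_measurable (info_measurable HE (t := t)) (payment_info HE i tT)).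
Qed.

Lemma total_payment_measurable t : in_periods T t -> measurable_fun [set: Omega] (S t).
Proof.
move=> tT.
exact: (adapted_measurable (info_measurable HE (t := t)) (total_payment_adapted tT)).
Qed.

Lemma ae_forall_fin (I : finType) (Q : I -> Omega -> Prop) :
  (forall i, {ae P, forall w, Q i w}) -> {ae P, forall w, forall i, Q i w}.
Proof.
move=> h; have : {ae P, forall w, forall i, i \in enum I -> Q i w}.
  elim: (enum I) => [|i s IH]; first exact: aeW.
  by apply: filterS2 (h i) IH => w hi IH j; rewrite inE => /predU1P[->//|]; exact: IH.
by apply: filterS => w hw i; apply: hw; rewrite mem_enum.
Qed.

Lemma ae_periods (Q : nat -> Omega -> Prop) :
  (forall t, in_periods T t -> {ae P, forall w, Q t w}) ->
  {ae P, forall w, forall t, in_periods T t -> Q t w}.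
Proof.
move=> h; apply: ae_foralln => t; have [tT|tT] := boolP (in_periods T t).
  by apply: filterS (h t tT) => w.
by apply: aeW => w.
Qed.

Lemma all_payment_ge0 t : in_periods T t ->
  {ae P, forall w, forall i, 0 <= payment E t i w}.
Proof. by move=> tT; apply: ae_forall_fin => i; exact: payment_ge0. Qed.

Lemma payment_le_total t w i : (forall i, 0 <= payment E t i w) ->
  payment E t i w <= S t w.
Proof.
by move=> b0; rewrite /total_payment (bigD1 i)//= lerDl sumr_ge0.
Qed.

Lemma total_payment_ge0 t : in_periods T t -> {ae P, forall w, 0 <= S t w}.
Proof.
by move=> tT; apply: filterS (all_payment_ge0 tT) => w b0; exact: sumr_ge0.
Qed.

(** [payment_mean] equates an extended expectation with a real number, so a nonnegative integrand
    has a finite integral. *)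
Lemma total_payment_intg t : in_periods T t -> intg (S t).
Proof.
move=> tT; apply: Ex_ge0_intg; [exact: total_payment_measurable|exact: total_payment_ge0|].
by have := payment_mean HE tT; rewrite unlock => ->; rewrite ltry.
Qed.

Lemma Ex_total_payment t : in_periods T t -> Ex (S t) = k.
Proof.
move=> tT; have := payment_mean HE tT.
by rewrite (expectation_Ex (total_payment_intg tT)) => -[].
Qed.

Lemma payment_intg t i : in_periods T t -> intg (payment E t i).
Proof.
move=> tT; apply: intg_le (total_payment_intg tT); first exact: payment_measurable.
apply: filterS (all_payment_ge0 tT) => w b0.
by rewrite ger0_norm//; exact: payment_le_total.
Qed.

Lemma total_payment_cond_exp s t : (1 <= s < t)%N -> (t <= T)%N ->
  is_cond_exp P (info E s) (S t) (fun=> k).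
Proof.
move=> /andP[s1]; case: t => [//|t]; rewrite ltnS => st tT.
have t1T : in_periods T t.+1 by rewrite /in_periods tT.
have tT' : in_periods T t by rewrite /in_periods (leq_trans s1 st) ltnW.
rewrite -(Ex_total_payment t1T).
apply: (@indep_cond_exp _ _ _ _ _ (valuation_info E t.+1)).
- exact: info_sigma.
- exact: info_measurable.
- exact: valuation_info_sigma.
- exact: valuation_info_measurable.
(* Independence is given between adjacent periods only; earlier information is contained in that of
   the preceding period. *)
- by move=> A B /(info_subset st) tA; exact: info_indep.
- apply: adapted_sum => [|i]; first exact: valuation_info_sigma.
  exact: payment_meas.
- exact: total_payment_intg.
- exact: total_payment_ge0.
Qed.

Lemma ae_preimage1 (A : set Omega) : measurable A -> P A = 1%E ->
  {ae P, forall w, A w}.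
Proof.
move=> mA PA; exists (~` A); split => //; first exact: measurableC.
by rewrite probability_setC// PA subee.
Qed.

Lemma valuation_bounded t i : in_periods T t ->
  {ae P, forall w, value_lo E <= valuation E t i w <= value_hi E}.
Proof.
move=> tT; have [F1 _] := value_dist_support HE.
have := valuation_law HE i tT (measurable_itv `[value_lo E, value_hi E]).
rewrite F1 /distribution /pushforward => /ae_preimage1; apply.
by rewrite -[X in measurable X]setTI; exact: measurable_funPT.
Qed.

Lemma winner_value_intg t i : in_periods T t ->
  intg (fun w => (winner E t w == Some i)%:R * valuation E t i w).
Proof.
move=> tT.
have mv : measurable_fun [set: Omega] (valuation E t i) by exact: measurable_funPT.
have IV : intg (valuation E t i).
  apply: (@intg_le _ _ _ _ _ (fun=> `|value_lo E| + `|value_hi E|)) (intg_cst _ _) => //.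
  apply: filterS (valuation_bounded i tT) => w /andP[lo hi].
  have := ler_norm (value_hi E); have := ler_norm (- value_lo E); rewrite normrN.
  by have := normr_ge0 (value_hi E); have := normr_ge0 (value_lo E); rewrite ler_norml; lra.
rewrite (_ : (fun w => _) = fun w =>
  \1_([set w | winner E t w = Some i]) w * valuation E t i w).
  by apply: intg_indic => //; apply: valuation_info_measurable; exact: winner_meas.
apply/funext => w; rewrite indicE; congr (_%:R * _).
by apply/esym; congr nat_of_bool; apply/idP/eqP; rewrite inE.
Qed.

Lemma order_value_geE t j r w : (j < bidders E)%N ->
  (r <= order_value E t j w) =
  (j < count (fun i => r <= valuation E t i w)%R (enum 'I_(bidders E)))%N.
Proof.
move=> jn; rewrite /order_value nth_sorted_ge.
- by rewrite count_sort count_map.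
- by apply: sort_sorted => x y; exact: le_total.
- by rewrite size_sort size_map size_enum_ord.
Qed.

Lemma order_value_measurable t j : (j < bidders E)%N ->
  measurable_fun [set: Omega] (order_value E t j).
Proof.
move=> jn; apply: (measurability (@RGenCInfty.G R)) => [|/= _ [_] [r] -> <-].
  exact: RGenCInfty.measurableE.
rewrite setTI; pose f w : R := \sum_(i <- enum 'I_(bidders E))
  \1_[set w | r <= valuation E t i w] w.
have fE w : f w = (count (fun i => r <= valuation E t i w)%R (enum 'I_(bidders E)))%:R.
  rewrite /f -sum1_count natr_sum [RHS]big_mkcond/=; apply: eq_bigr => i _.
  by rewrite indicE; case: ifPn => h; [rewrite mem_set|rewrite memNset//; exact/negP].
have mf : measurable_fun [set: Omega] f.
  apply: measurable_sum => i; apply: measurable_indic.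
  rewrite (_ : [set w | _] = [set: Omega] `&` valuation E t i @^-1` `[r, +oo[%classic).
    exact: measurable_funPT.
  by apply/seteqP; split => w /=; rewrite in_itv/= andbT// => -[].
rewrite (_ : _ @^-1` _ = [set: Omega] `&` f @^-1` `]j%:R, +oo[%classic).
  exact: mf.
apply/seteqP; split => w /=; rewrite !in_itv/= !andbT order_value_geE// fE ltr_nat//.
by case.
Qed.

Lemma order_value_bounded t j : (j < bidders E)%N -> in_periods T t ->
  {ae P, forall w, value_lo E <= order_value E t j w <= value_hi E}.
Proof.
move=> jn tT; have := ae_forall_fin (fun i => valuation_bounded i tT).
apply: filterS => w hw; rewrite /order_value.
set s := sort _ _; have : nth 0 s j \in s.
  by apply: mem_nth; rewrite size_sort size_map size_enum_ord.
by rewrite mem_sort => /mapP[i _ ->].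
Qed.

Lemma order_value0_ge t i w : valuation E t i w <= order_value E t 0 w.
Proof.
rewrite order_value_geE ?(leq_trans _ (two_bidders HE))//.
by rewrite -has_count; apply/hasP; exists i; rewrite ?mem_enum.
Qed.

(** The optimal reserve price earns at least as much as any [r > 0], and with reserve [r] a sale
    brings at least [r]. It remains to find an [r] at which a sale has positive probability. *)
Lemma mean_revenue_gt0 : 0 < k.
Proof.
have T1 : in_periods T 1 by rewrite /in_periods leqnn (one_period HE).
have n0 : (0 < bidders E)%N by rewrite (leq_trans _ (two_bidders HE)).
have n1 : (1 < bidders E)%N := two_bidders HE.
pose sale r := [set w | r <= order_value E 1 0 w].
have msale r : measurable (sale r).
  rewrite (_ : sale r = [set: Omega] `&` order_value E 1 0 @^-1` `[r, +oo[%classic).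
    exact: order_value_measurable.
  by apply/seteqP; split => w /=; rewrite in_itv/= andbT// => -[].
(* Otherwise the highest valuation would almost surely lie below every [n.+1%:R^-1], although
   valuations are positive. *)
have [n Psale] : exists n : nat, (0 < P (sale (n.+1%:R^-1)%R))%E.
  apply: contrapT => /forallNP h.
  have : {ae P, forall w, forall n : nat, ~ sale n.+1%:R^-1 w}.
    apply: ae_foralln => n; exists (sale n.+1%:R^-1); split => //.
      by apply/eqP; rewrite -measure_le0; have /negP := h n; rewrite -leNgt.
    by move=> w /= /contrapT.
  move=> hn.
  have [w [hw v0]] : exists w, (forall n : nat, ~ sale n.+1%:R^-1 w) /\
      0 < valuation E 1 (Ordinal n0) w.
    apply: (ae_exists (P := P)).
    by apply: filterS2 hn (valuation_gt0 HE (Ordinal n0) T1) => w.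
  have o0 := lt_le_trans v0 (order_value0_ge 1 (Ordinal n0) w).
  have [m] := ltr_add_invr o0; rewrite add0r => hm.
  by apply: (hw m); rewrite /sale/=; exact: ltW.
set r : R := n.+1%:R^-1; have r0 : 0 < r by rewrite invr_gt0 ltr0n.
apply: lt_le_trans (_ : reserve_revenue E 1 r <= _); last first.
  by rewrite (mean_revenueE HE T1); exact: reserve_optimal.
rewrite /reserve_revenue -/(sale r) /cond_mean.
have P0 : 0 < fine (P (sale r)).
  by rewrite fine_gt0// Psale/= (le_lt_trans (probability_le1 _ _))// ltry.
rewrite divfK ?gt_eqF// Rintegral_indic.
pose f w := Num.max (order_value E 1 1 w) r.
have If : intg f.
  apply: (@intg_le _ _ _ _ _ (fun=> `|value_lo E| + `|value_hi E| + r)) (intg_cst _ _).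
    by apply: measurable_maxr => //; exact: order_value_measurable.
  apply: filterS (order_value_bounded n1 T1) => w /andP[lo hi].
  have := ler_norm (value_hi E); have := ler_norm (- value_lo E); rewrite normrN.
  have := normr_ge0 (value_hi E); have := normr_ge0 (value_lo E) => ? ? ? ?.
  by rewrite ler_norml /f; apply/andP; split; rewrite ?le_max ?ge_max; lra.
apply: lt_le_trans (_ : Ex (fun w => \1_(sale r) w * r) <= _).
  have I1 : intg (\1_(sale r) : Omega -> R) by exact: integrable_indic.
  under eq_Rintegral do rewrite mulrC.
  rewrite ExZ// mulr_gt0// /Rintegral integral_indic// setIT.
  exact: P0.
apply: Ex_le; [exact/intg_indic/intg_cst|exact: intg_indic|].
by apply: aeW => w; rewrite ler_wpM2l ?indicE// le_max lexx orbT.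
Qed.

(* The value, right after the auction of period t, of all later auctions. *)
Definition continuation (t : nat) : R :=
  b * ((1 - b ^+ (T - t)) / (1 - b)) * k.

Lemma continuation1 : continuation 1 = equity_value E.
Proof. by rewrite /continuation subn1. Qed.

Lemma continuation_last : continuation T = 0.
Proof. by rewrite /continuation subnn expr0 subrr mul0r mulr0 mul0r. Qed.

Lemma continuationS t : (t < T)%N -> continuation t = b * (k + continuation t.+1).
Proof.
move=> tT; rewrite /continuation (_ : (T - t)%N = (T - t.+1).+1); last by rewrite subnSK.
have : 1 - b != 0 by rewrite subr_eq0 gt_eqF// (discount_lt1 HE).
by move=> b1; rewrite exprS; field.
Qed.

Lemma continuation_ge0 t : 0 <= continuation t.
Proof.
have b0 := discount_gt0 HE; have b1 := discount_lt1 HE.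
apply: mulr_ge0; last exact/ltW/mean_revenue_gt0.
apply: mulr_ge0; first exact: ltW.
apply: divr_ge0; last by rewrite subr_ge0 ltW.
by rewrite subr_ge0 exprn_ile1// ltW.
Qed.

Lemma continuation_gt0 t : (t < T)%N -> 0 < continuation t.
Proof.
move=> tT; rewrite continuationS// mulr_gt0//; first exact: discount_gt0.
by rewrite ltr_pwDl ?continuation_ge0// mean_revenue_gt0.
Qed.

End auction.

(** * The auctioneer's consumption *)

Section auctioneer.
Context (R : realType) (d : measure_display) (Omega : measurableType d)
  (P : probability Omega R) (E : auction_env P).
Hypothesis HE : auction_model E.

Local Notation intg f := (P.-integrable [set: Omega] (EFin \o f)).
Local Notation Ex f := (Rintegral P [set: Omega] f).
Local Notation T := (periods E).
Local Notation b := (discount E).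
Local Notation S := (total_payment E).
Local Notation V := (continuation E).
Local Notation u := (utility E).

(** Present value of one unit in each of [n] periods, the first one being paid now. *)
Definition annuity (n : nat) : R := \sum_(0 <= j < n) b ^+ j.

Lemma annuityS n : annuity n.+1 = 1 + b * annuity n.
Proof.
rewrite /annuity big_nat_recl// expr0 mulr_sumr; congr (_ + _).
by apply: eq_bigr => i _; rewrite exprS.
Qed.

Lemma annuity_ge0 n : 0 <= annuity n.
Proof. by apply: sumr_ge0 => i _; rewrite exprn_ge0// ltW// (discount_gt0 HE). Qed.

Lemma annuity_periods : annuity T = \sum_(1 <= t < T.+1) b ^+ t.-1.
Proof. by rewrite big_add1. Qed.

Lemma annuity_gt0 : 0 < annuity T.
Proof.
rewrite -(prednK (one_period HE)) annuityS.
by rewrite ltr_pwDl// mulr_ge0 ?annuity_ge0// ltW// (discount_gt0 HE).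
Qed.

Lemma in_period1 : in_periods T 1.
Proof. by rewrite /in_periods leqnn (one_period HE). Qed.

Definition wealth (w : Omega) : R := S 1 w + V 1.

(* Almost surely [wealth / annuity T]; bounded below everywhere. *)
Definition smoothed (w : Omega) : R := (Num.max (S 1 w) 0 + V 1) / annuity T.

Lemma smoothed_wealth : {ae P, forall w, annuity T * smoothed w = wealth w}.
Proof.
apply: filterS (total_payment_ge0 HE in_period1) => w /max_idPl S0.
by rewrite /smoothed S0 mulrC divfK// gt_eqF// annuity_gt0.
Qed.

Lemma smoothed_ge w : V 1 / annuity T <= smoothed w.
Proof.
by rewrite /smoothed ler_pM2r ?invr_gt0 ?annuity_gt0// lerDr le_max lexx orbT.
Qed.

Lemma smoothed_ge0 w : 0 <= smoothed w.
Proof.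
apply: le_trans (smoothed_ge w); rewrite divr_ge0//.
  exact: continuation_ge0.
exact: annuity_ge0.
Qed.

Lemma wealth_intg : intg wealth.
Proof. exact: (intgD (total_payment_intg HE in_period1) (intg_cst P (V 1))). Qed.

Lemma smoothed_adapted : adapted_to (info E 1) smoothed.
Proof.
have s1 := info_sigma HE 1.
apply: (adaptedM s1); last exact: adapted_cst.
apply: (adaptedD s1); last exact: adapted_cst.
apply: (adapted_max s1); last exact: adapted_cst.
exact/total_payment_adapted/in_period1.
Qed.

Lemma smoothed_measurable : measurable_fun [set: Omega] smoothed.
Proof. exact: (adapted_measurable (info_measurable HE (t := 1)) smoothed_adapted). Qed.

Lemma smoothed_intg : intg smoothed.
Proof.
apply: (@intg_ae _ _ _ _ (fun w => (annuity T)^-1 * wealth w)).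
- exact: smoothed_measurable.
- apply: filterS smoothed_wealth => w <-.
  by rewrite mulrA mulVf ?mul1r// gt_eqF// annuity_gt0.
- exact/intgZ/wealth_intg.
Qed.

(** The payoff of constant consumption at [smoothed], which turns out to be the auctioneer's optimum
    under both schemes. *)
Definition best_payoff : R := annuity T * Ex (fun w => u (smoothed w)).

Lemma auctioneer_payoffE c : (forall t, in_periods T t -> forall w, 0 <= c t w) ->
  (forall t, in_periods T t -> intg (c t)) ->
  auctioneer_payoff E c = (Ex (fun w => \sum_(1 <= t < T.+1) b ^+ t.-1 * u (c t w)))%:E.
Proof.
move=> c0 Ic; rewrite /auctioneer_payoff expectation_Ex//.
rewrite (_ : (fun w => _) = (fun w =>
  \sum_(1 <= t < T.+1 | in_periods T t) b ^+ t.-1 * u (c t w))); last first.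
  by apply/funext => w; rewrite big_nat.
apply: intg_sum => t tT; apply: intgZ; apply: intg_utility.
- exact: utility_concave.
- exact: utility_nondecreasing.
- exact: c0.
- exact: Ic.
Qed.

Definition smooth_consumption (_ : nat) (w : Omega) : R := smoothed w.

(** The cost at [t] of the [T - t] consumptions still to come; the first is due one period later,
    whence the factor [b]. *)
Definition smooth_savings (t : nat) (w : Omega) : R :=
  if t == 0%N then 0 else b * annuity (T - t) * smoothed w.

Lemma smooth_plan rev : {ae P, forall w, rev 1%N w = wealth w} ->
  {ae P, forall w, forall t, (2 <= t <= T)%N -> rev t w = 0} ->
  consumption_plan E rev smooth_consumption smooth_savings.
Proof.
move=> rev1 rev0; have b0 := discount_gt0 HE; split.
- move=> t /andP[t1 tT]; have sub := info_subset HE t1; have sg := info_sigma HE t.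
  split; first exact: adapted_sub sub smoothed_adapted.
  rewrite /smooth_savings; case: t t1 {tT} sub sg => // t _ sub sg.
  by apply: (adaptedZ sg); exact: adapted_sub sub smoothed_adapted.
- move=> t w _; split; first exact: smoothed_ge0.
  rewrite /smooth_savings; case: ifP => // _.
  by rewrite mulr_ge0 ?smoothed_ge0// mulr_ge0 ?annuity_ge0// ltW.
- by move=> w.
apply: filterS3 smoothed_wealth rev1 rev0 => w sw r1 r0 t /andP[t1 tT].
rewrite /smooth_consumption /smooth_savings; case: t t1 tT => // -[_ _|t _ tT] /=.
  rewrite r1 -sw mulr0 addr0 -{1}[smoothed w]mul1r -mulrDl -annuityS.
  by rewrite subn1 prednK// one_period.
rewrite r0//= add0r -{1}[smoothed w]mul1r -mulrDl -annuityS !mulrA mulVf ?gt_eqF// mul1r.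
by rewrite subnSK.
Qed.

Lemma smooth_payoff : auctioneer_payoff E smooth_consumption = best_payoff%:E.
Proof.
rewrite auctioneer_payoffE; last 2 first.
- by move=> t _ w; exact: smoothed_ge0.
- by move=> t _; exact: smoothed_intg.
congr EFin; rewrite /best_payoff -ExZ; last first.
  apply: intg_utility; [exact: utility_concave|exact: utility_nondecreasing| |].
    exact: smoothed_ge0.
  exact: smoothed_intg.
apply: eq_Rintegral => w _.
by rewrite annuity_periods mulr_suml.
Qed.

(* After consuming [c t] the auctioneer is left with assets worth [X t], which by
   the next period have become [y t.+1].  Only expectations weighted by what is
   known in period 1 are constrained: this is all that risk aversion needs. *)
Record financed (c X y : nat -> Omega -> R) : Prop := Financed {
  financed_meas : forall t, in_periods T t ->
    measurable_fun [set: Omega] (c t) /\ measurable_fun [set: Omega] (X t);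
  financed_c_ge0 : forall t, in_periods T t -> forall w, 0 <= c t w;
  financed_X_ge0 : forall t, in_periods T t -> {ae P, forall w, 0 <= X t w};
  financed_start : {ae P, forall w, c 1%N w + X 1%N w = wealth w};
  financed_next : forall t, (1 <= t < T)%N ->
    {ae P, forall w, c t.+1 w + X t.+1 w = y t.+1 w};
  financed_fair : forall t, (1 <= t < T)%N -> forall (g : Omega -> R) K,
    adapted_to (info E 1) g -> (forall w, 0 <= g w <= K) ->
    intg (fun w => g w * X t w) -> intg (fun w => g w * y t.+1 w) /\
    b * Ex (fun w => g w * y t.+1 w) <= Ex (fun w => g w * X t w)
}.

(** * Budget and optimality of financed consumption *)

Section financed_consumption.
Variables (c X y : nat -> Omega -> R).
Hypothesis F : financed c X y.

(** Integrability starts from [wealth] and moves forward: consumption and remaining assets are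
    nonnegative, so each is dominated by their sum, and [financed_fair] carries the assets to the
    next period. *)
Lemma financed_chain (g : Omega -> R) K m : adapted_to (info E 1) g ->
  (forall w, 0 <= g w <= K) -> in_periods T m ->
  [/\ forall t, (1 <= t <= m)%N -> intg (fun w => g w * c t w),
      intg (fun w => g w * X m w) &
      \sum_(1 <= t < m.+1) b ^+ t.-1 * Ex (fun w => g w * c t w) +
      b ^+ m.-1 * Ex (fun w => g w * X m w) <= Ex (fun w => g w * wealth w)].
Proof.
move=> ag gK; have mg := adapted_measurable (info_measurable HE (t := 1)) ag.
have g0 w : 0 <= g w by have /andP[] := gK w.
have split_intg t f : in_periods T t -> intg (fun w => g w * f w) ->
    {ae P, forall w, c t w + X t w = f w} ->
    [/\ intg (fun w => g w * c t w), intg (fun w => g w * X t w) &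
     Ex (fun w => g w * f w) = Ex (fun w => g w * c t w) + Ex (fun w => g w * X t w)].
  move=> tT If cX; have [mc mX] := financed_meas F tT.
  have Ic : intg (fun w => g w * c t w).
    apply: intg_le If; first exact: measurable_funM.
    apply: filterS2 cX (financed_X_ge0 F tT) => w <- X0.
    rewrite ger0_norm ?mulr_ge0 ?(financed_c_ge0 F)//.
    by rewrite ler_wpM2l// lerDl.
  have IX : intg (fun w => g w * X t w).
    apply: intg_le If; first exact: measurable_funM.
    apply: filterS2 cX (financed_X_ge0 F tT) => w <- X0.
    rewrite ger0_norm ?mulr_ge0//.
    by rewrite ler_wpM2l// lerDr (financed_c_ge0 F).
  split => //; rewrite -ExD//; apply: Ex_ae => //; first exact: intg_measurable If.
    by apply: measurable_funD; exact: measurable_funM.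
  by apply: filterS cX => w <-; rewrite mulrDr.
elim: m => [//|[_ _|m IH mT]].
  have Iw : intg (fun w => g w * wealth w).
    apply: (@intg_le _ _ _ _ _ (fun w => K * `|wealth w|)).
    - apply: measurable_funM => //; exact: intg_measurable wealth_intg.
    - by apply: aeW => w; rewrite normrM ger0_norm// ler_wpM2r//; have /andP[] := gK w.
    - exact/intgZ/integrable_norm/wealth_intg.
  have [Ic IX ->] := split_intg _ _ in_period1 Iw (financed_start F).
  split => //; last by rewrite big_nat1 expr0 !mul1r.
  by move=> t; rewrite -eqn_leq => /eqP <-.
have mm : (1 <= m.+1 < T)%N by case/andP: (mT).
have mT' : in_periods T m.+1 by case/andP: mm => _ /ltnW.
have [Ic IX le] := IH mT'.
have [Iy ley] := financed_fair F mm ag gK IX.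
have [Icm IXm eqy] := split_intg _ _ mT Iy (financed_next F mm).
split => //.
  move=> t /andP[t1]; rewrite leq_eqVlt => /predU1P[->//|tm].
  by apply: Ic; rewrite t1.
rewrite big_nat_recr//=; apply: le_trans le; rewrite -addrA lerD2l -mulrDr -eqy.
rewrite /= in ley *; rewrite exprSr -mulrA ler_wpM2l// exprn_ge0// ltW//.
exact: discount_gt0.
Qed.

Lemma financed_intg t : in_periods T t -> intg (c t) /\ intg (X t).
Proof.
move=> tT; have [||Ic IX _] := @financed_chain (fun=> 1) 1 t _ _ tT.
- by apply: adapted_cst; exact: info_sigma.
- by move=> w; rewrite ler01 lexx.
have {}Ic : intg (fun w => 1 * c t w) by apply: Ic; move: tT => /andP[-> _] /=.
split.
  by apply: eq_integrable Ic => // w _ /=; rewrite mul1r.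
by apply: eq_integrable IX => // w _ /=; rewrite mul1r.
Qed.

(** The terminal assets stay on the left: dropped, they leave the budget for smoothing; kept, they
    are shown to vanish at a strict optimum. *)
Lemma financed_budget (g : Omega -> R) K : adapted_to (info E 1) g ->
  (forall w, 0 <= g w <= K) ->
  Ex (fun w => g w * \sum_(1 <= t < T.+1 | in_periods T t) b ^+ t.-1 * c t w) +
  b ^+ T.-1 * Ex (fun w => g w * X T w) <=
  annuity T * Ex (fun w => g w * smoothed w).
Proof.
move=> ag gK; have TT : in_periods T T by rewrite /in_periods (one_period HE) leqnn.
have [Ic IX le] := financed_chain ag gK TT.
have mg := adapted_measurable (info_measurable HE (t := 1)) ag.
have -> : annuity T * Ex (fun w => g w * smoothed w) = Ex (fun w => g w * wealth w).
  rewrite -ExZ; last first.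
    apply: (@intg_le _ _ _ _ _ (fun w => K * smoothed w)).
    - by apply: measurable_funM => //; exact: smoothed_measurable.
    - apply: aeW => w; have /andP[g0 hK] := gK w.
      by rewrite normrM !ger0_norm ?smoothed_ge0// ler_wpM2r// smoothed_ge0.
    - exact/intgZ/smoothed_intg.
  apply: Ex_ae.
  - apply: measurable_funM => //; apply: measurable_funM => //.
    exact: smoothed_measurable.
  - apply: measurable_funM => //; exact: intg_measurable wealth_intg.
  - by apply: filterS smoothed_wealth => w <-; rewrite mulrCA.
apply: le_trans le; rewrite lerD2r le_eqVlt; apply/orP; left; apply/eqP.
rewrite big_nat.
transitivity (\sum_(1 <= t < T.+1 | (1 <= t < T.+1)%N)
    Ex (fun w => b ^+ t.-1 * (g w * c t w))).
  rewrite -Ex_sum => [|t tT]; last exact/intgZ/Ic.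
  apply: eq_Rintegral => w _; rewrite mulr_sumr; apply: eq_bigr => t _.
  by rewrite mulrCA.
by apply: eq_bigr => t tT; rewrite ExZ//; exact: Ic.
Qed.

Let Q t := in_periods T t.
Let a t := b ^+ t.-1.

Let a_gt0 t : Q t -> 0 < a t.
Proof. by move=> _; rewrite exprn_gt0// (discount_gt0 HE). Qed.

Let sum_a : \sum_(1 <= t < T.+1 | Q t) a t = annuity T.
Proof. by rewrite annuity_periods [RHS]big_nat. Qed.

Let budget (g : Omega -> R) K : adapted_to (info E 1) g ->
  (forall w, 0 <= g w <= K) ->
  Ex (fun w => g w * \sum_(1 <= t < T.+1 | Q t) a t * c t w) <=
  (\sum_(1 <= t < T.+1 | Q t) a t) * Ex (fun w => g w * smoothed w).
Proof.
move=> ag gK; rewrite sum_a; apply: le_trans (financed_budget ag gK).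
rewrite lerDl mulr_ge0//; first by rewrite exprn_ge0// ltW// (discount_gt0 HE).
have TT : in_periods T T by rewrite /in_periods (one_period HE) leqnn.
have mg := adapted_measurable (info_measurable HE (t := 1)) ag.
apply: Ex_ge0.
  by apply: measurable_funM => //; have [] := financed_meas F TT.
apply: filterS (financed_X_ge0 F TT) => w X0; rewrite mulr_ge0//.
by have /andP[] := gK w.
Qed.

Let payoffE : auctioneer_payoff E c =
  (Ex (fun w => \sum_(1 <= t < T.+1 | Q t) a t * u (c t w)))%:E.
Proof.
rewrite auctioneer_payoffE.
- by congr EFin; apply: eq_Rintegral => w _; rewrite big_nat.
- exact: (financed_c_ge0 F).
- by move=> t /financed_intg[].
Qed.

(** For [T = 1] the continuation is 0, so [V 1 / annuity T] is no positive lower bound for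
    [smoothed]. With a single period, monotonicity of the utility replaces the supergradient. *)
Let last_period : T = 1%N -> {ae P, forall w, c 1%N w <= smoothed w}.
Proof.
move=> T1; apply: filterS3 (financed_start F) smoothed_wealth
  (financed_X_ge0 F in_period1) => w <-.
by rewrite T1 /annuity big_nat1 expr0 mul1r => ->; rewrite lerDl.
Qed.

Let last_payoff : T = 1%N -> Ex (fun w => \sum_(1 <= t < T.+1 | Q t) a t * u (c t w)) =
  Ex (fun w => u (c 1%N w)).
Proof.
move=> T1; apply: eq_Rintegral => w _.
rewrite (_ : \sum_(_ <= t < _ | _) _ = \sum_(1 <= t < T.+1) a t * u (c t w)).
  by rewrite T1 big_nat1 /a expr0 mul1r.
by rewrite [RHS]big_nat.
Qed.

Let best_last : T = 1%N -> best_payoff = Ex (fun w => u (smoothed w)).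
Proof. by move=> T1; rewrite /best_payoff T1 /annuity big_nat1 expr0 mul1r. Qed.

Let x0_gt0 : (1 < T)%N -> 0 < V 1 / annuity T.
Proof. by move=> T1; rewrite divr_gt0 ?annuity_gt0//; exact: continuation_gt0. Qed.

Lemma financed_le : (auctioneer_payoff E c <= best_payoff%:E)%E.
Proof.
have uc := utility_concave HE; have un := utility_nondecreasing HE.
rewrite payoffE lee_fin; have := one_period HE.
rewrite leq_eqVlt => /predU1P[/esym T1|T1].
  rewrite last_payoff// best_last//; apply: Ex_le.
  - apply: intg_utility => //; first exact: (financed_c_ge0 F in_period1).
    by have [] := financed_intg in_period1.
  - apply: intg_utility => //; [exact: smoothed_ge0|exact: smoothed_intg].
  - apply: filterS (last_period T1) => w; apply: un.
    exact: (financed_c_ge0 F in_period1).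
rewrite /best_payoff -sum_a.
apply: (smoothing_le uc un (info_sigma HE 1) (info_measurable HE (t := 1)) a_gt0
  (x0 := V 1 / annuity T)) => //.
- exact: (financed_c_ge0 F).
- by move=> t /financed_intg[].
- exact: x0_gt0.
- exact: smoothed_ge.
- exact: smoothed_adapted.
- exact: smoothed_intg.
Qed.

Lemma financed_eq : strictly_concave u -> auctioneer_payoff E c = best_payoff%:E ->
  (forall t, in_periods T t -> {ae P, forall w, c t w = smoothed w}) /\
  {ae P, forall w, X T w = 0}.
Proof.
have uc := utility_concave HE; have un := utility_nondecreasing HE.
move=> su; rewrite payoffE => -[opt].
have cs t : in_periods T t -> {ae P, forall w, c t w = smoothed w}.
  move=> tT; have := one_period HE; rewrite leq_eqVlt => /predU1P[/esym T1|T1].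
    have -> : t = 1%N.
      by apply/eqP; rewrite eqn_leq andbC; move: (tT); rewrite /in_periods T1.
    move: opt; rewrite last_payoff// best_last// => opt.
    have Iu : intg (fun w => u (smoothed w)).
      by apply: intg_utility => //; [exact: smoothed_ge0|exact: smoothed_intg].
    have Iuc : intg (fun w => u (c 1%N w)).
      apply: intg_utility => //; first exact: (financed_c_ge0 F in_period1).
      by have [] := financed_intg in_period1.
    have : {ae P, forall w, u (smoothed w) - u (c 1%N w) = 0}.
      apply: Ex_eq0_ae; first exact: intgB.
        apply: filterS (last_period T1) => w cs; rewrite subr_ge0 un//.
        exact: (financed_c_ge0 F in_period1).
      by rewrite ExB// opt subrr.
    apply: filterS2 (last_period T1) => w; rewrite le_eqVlt => /predU1P[->//|lt].
    have := strictly_concave_increasing un su (financed_c_ge0 F in_period1 w) lt.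
    by lra.
  apply: (smoothing_eq uc un (info_sigma HE 1) (info_measurable HE (t := 1)) a_gt0
    (r := index_iota 1 T.+1) (x0 := V 1 / annuity T)) => //.
  - exact: (financed_c_ge0 F).
  - by move=> i /financed_intg[].
  - exact: x0_gt0.
  - exact: smoothed_ge.
  - exact: smoothed_adapted.
  - exact: smoothed_intg.
  - by rewrite sum_a opt.
  - by rewrite mem_index_iota.
split => //.
have TT : in_periods T T by rewrite /in_periods (one_period HE) leqnn.
have IX : intg (X T) by have [] := financed_intg TT.
apply: Ex_eq0_ae => //; first exact: (financed_X_ge0 F).
have ag : adapted_to (info E 1) (fun=> 1 : R) by apply: adapted_cst; exact: info_sigma.
(* With consumption equal to [smoothed], the budget at weight 1 is exhausted and leaves nothing for
   [X T]. *)
have := @financed_budget (fun=> 1) 1 ag.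
move=> /(_ (fun=> ltac:(by rewrite ler01 lexx))).
under eq_Rintegral do rewrite mul1r.
under [X in _ + _ * X]eq_Rintegral do rewrite mul1r.
under [X in _ <= _ * X]eq_Rintegral do rewrite mul1r.
have -> : Ex (fun w => \sum_(1 <= t < T.+1 | in_periods T t) b ^+ t.-1 * c t w) =
    annuity T * Ex smoothed.
  rewrite Ex_sum => [|t /financed_intg[Ic _]]; last exact: intgZ.
  rewrite annuity_periods mulr_suml [RHS]big_nat.
  apply: eq_bigr => t tT; have [Ic _] := financed_intg tT.
  rewrite ExZ//; congr (_ * _); apply: Ex_ae; last exact: cs.
    by have [] := financed_meas F tT.
  exact: smoothed_measurable.
by rewrite gerDl pmulr_rle0// exprn_gt0// (discount_gt0 HE).
Qed.

End financed_consumption.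

End auctioneer.

(** * Token prices without recycling *)

Section token_processes.
Context (R : realType) (d : measure_display) (Omega : measurableType d)
  (P : probability Omega R) (E : auction_env P).
Hypothesis HE : auction_model E.

Local Notation T := (periods E).

Variables (pol : token_policy R) (p : nat -> Omega -> R).
Hypothesis p_adapted : forall t, in_periods T t -> adapted_to (info E t) (p t).
Hypothesis burning : forall t, in_periods T t -> recycling pol t = -1.

Lemma bidder_tokensS (i : 'I_(bidders E)) q t w : (1 <= t)%N ->
  bidder_tokens pol p i q t.+1 w = (1 + growth pol t) *
    (bidder_tokens pol p i q t w + q t w - tokens_due p t i w).
Proof. by case: t. Qed.

Section adapted_holdings.
Variable i : 'I_(bidders E).

Lemma tokens_due_adapted t : in_periods T t -> adapted_to (info E t) (tokens_due p t i).
Proof.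
move=> tT; apply: (adapted_div (info_sigma HE t)); last exact: p_adapted.
exact: payment_info.
Qed.

(** Holdings carried into [t.+1] are already known at [t]. This predictability later lets the next
    supply be pulled out of an expectation given period [t]. *)
Lemma bidder_tokensS_adapted q t :
  (forall t, in_periods T t -> adapted_to (info E t) (q t)) ->
  in_periods T t -> adapted_to (info E t) (bidder_tokens pol p i q t.+1).
Proof.
move=> aq; elim: t => [//|t IH tT]; have st := info_sigma HE t.+1.
have at1 : adapted_to (info E t.+1) (bidder_tokens pol p i q t.+1).
  case: t IH tT st => [_ _ st|t IH tT st]; first exact: adapted_cst st _.
  apply: adapted_sub (info_subset HE (leqnSn t.+1)) _; apply: IH.
  by case/andP: tT => _ /ltnW.
have -> : bidder_tokens pol p i q t.+2 = fun w => (1 + growth pol t.+1) *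
    (bidder_tokens pol p i q t.+1 w + q t.+1 w - tokens_due p t.+1 i w).
  by apply/funext => w; rewrite bidder_tokensS.
apply: (adaptedZ st); apply: (adaptedB st); last exact: tokens_due_adapted.
by apply: (adaptedD st) => //; exact: aq.
Qed.

Lemma bidder_tokens_adapted q t :
  (forall t, in_periods T t -> adapted_to (info E t) (q t)) ->
  in_periods T t -> adapted_to (info E t) (bidder_tokens pol p i q t).
Proof.
move=> aq; case: t => [//|[_|t tT]]; first exact: adapted_cst (info_sigma HE 1) _.
apply: adapted_sub (info_subset HE (leqnSn t.+1)) _.
by apply: bidder_tokensS_adapted => //; case/andP: tT => _ /ltnW.
Qed.

End adapted_holdings.

Lemma auctioneer_tokensS Q t w : in_periods T t ->
  auctioneer_tokens E pol p Q t.+1 w =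
  (1 + growth pol t) * (auctioneer_tokens E pol p Q t w + Q t w).
Proof.
move=> tT; have := burning tT; case: t tT => // t tT /= ->.
by rewrite addrN mul0r addr0.
Qed.

Lemma auctioneer_tokensS_adapted Q t :
  (forall t, in_periods T t -> adapted_to (info E t) (Q t)) ->
  in_periods T t -> adapted_to (info E t) (auctioneer_tokens E pol p Q t.+1).
Proof.
move=> aQ; elim: t => [//|t IH tT]; have st := info_sigma HE t.+1.
have at1 : adapted_to (info E t.+1) (auctioneer_tokens E pol p Q t.+1).
  case: t IH tT st => [_ _ st|t IH tT st]; first exact: adapted_cst st _.
  apply: adapted_sub (info_subset HE (leqnSn t.+1)) _; apply: IH.
  by case/andP: tT => _ /ltnW.
have -> : auctioneer_tokens E pol p Q t.+2 = fun w =>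
    (1 + growth pol t.+1) * (auctioneer_tokens E pol p Q t.+1 w + Q t.+1 w).
  by apply/funext => w; rewrite auctioneer_tokensS.
by apply: (adaptedZ st); apply: (adaptedD st) => //; exact: aQ.
Qed.

Lemma auctioneer_tokens_adapted Q t :
  (forall t, in_periods T t -> adapted_to (info E t) (Q t)) ->
  in_periods T t -> adapted_to (info E t) (auctioneer_tokens E pol p Q t).
Proof.
move=> aQ; case: t => [//|[_|t tT]]; first exact: adapted_cst (info_sigma HE 1) _.
apply: adapted_sub (info_subset HE (leqnSn t.+1)) _.
by apply: auctioneer_tokensS_adapted => //; case/andP: tT => _ /ltnW.
Qed.

End token_processes.

(** * Bidders' and auctioneer's plans at fair token prices *)

Section fair_token_prices.
Context (R : realType) (d : measure_display) (Omega : measurableType d)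
  (P : probability Omega R) (E : auction_env P).
Hypothesis HE : auction_model E.

Local Notation intg f := (P.-integrable [set: Omega] (EFin \o f)).
Local Notation Ex f := (Rintegral P [set: Omega] f).
Local Notation T := (periods E).
Local Notation b := (discount E).
Local Notation k := (mean_revenue E).
Local Notation S := (total_payment E).
Local Notation V := (continuation E).

(** The bidder's benchmark: objects won less payments, every investment just breaking even. *)
Definition auction_payoff (i : 'I_(bidders E)) : R :=
  \sum_(1 <= t < T.+1) b ^+ t.-1 *
    (Ex (fun w => (winner E t w == Some i)%:R * valuation E t i w) -
     Ex (payment E t i)).

Lemma bidder_payoffE i (flow : nat -> Omega -> R) :
  (forall t, in_periods T t -> intg (flow t)) ->
  bidder_payoff i flow = (auction_payoff i +
    \sum_(1 <= t < T.+1) b ^+ t.-1 * (Ex (flow t) + Ex (payment E t i)))%:E.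
Proof.
move=> If; rewrite /bidder_payoff.
have It t : in_periods T t -> intg (fun w => b ^+ t.-1 *
    ((winner E t w == Some i)%:R * valuation E t i w + flow t w)).
  by move=> tT; apply/intgZ/intgD; [exact: winner_value_intg|exact: If].
rewrite (_ : (fun w => _) = (fun w => \sum_(1 <= t < T.+1 | in_periods T t)
    b ^+ t.-1 * ((winner E t w == Some i)%:R * valuation E t i w + flow t w)));
  last by apply/funext => w; rewrite big_nat.
rewrite expectation_Ex; last exact: intg_sum.
rewrite Ex_sum// /auction_payoff -big_split/= [in RHS]big_nat; congr EFin.
apply: eq_bigr => t tT; have Iw := winner_value_intg HE i tT; have Ift := If t tT.
rewrite ExZ; last exact: intgD.
by rewrite ExD// -mulrDr; congr (_ * _); lra.
Qed.

Variable pol : token_policy R.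

(* Without recycling, a price system is pinned down up to the supply of tokens: the
   supply is always worth the current payments plus the [continuation], and
   its value after payments is carried over to the next period. *)
Record fair_prices (p : nat -> Omega -> R) : Prop := FairPrices {
  fair_supply_gt0 : 0 < initial_supply pol;
  fair_growth : forall t, (1 <= t < T)%N -> 0 < 1 + growth pol t;
  fair_recycling : forall t, in_periods T t -> recycling pol t = -1;
  fair_adapted : forall t, in_periods T t -> adapted_to (info E t) (p t);
  fair_start : {ae P, forall w, p 1%N w * initial_supply pol = wealth E w};
  fair_next : forall t, (1 <= t < T)%N -> {ae P, forall w,
    (1 + growth pol t) * V t * p t.+1 w = (S t.+1 w + V t.+1) * p t w}
}.

Variable p : nat -> Omega -> R.
Hypothesis fp : fair_prices p.

Lemma fair_ge0 t : in_periods T t -> {ae P, forall w, 0 <= p t w}.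
Proof.
elim: t => [//|[_ _|t IH tT]].
  apply: filterS2 (fair_start fp) (total_payment_ge0 HE (in_period1 HE)) => w pw S0.
  rewrite -(pmulr_lge0 _ (fair_supply_gt0 fp)) pw /wealth addr_ge0//.
  exact: continuation_ge0.
have tt : (1 <= t.+1 < T)%N by case/andP: (tT).
have tT' : in_periods T t.+1 by case/andP: tt => _ /ltnW.
apply: filterS3 (IH tT') (fair_next fp tt) (total_payment_ge0 HE tT) => w p0 pn S0.
have c0 : 0 < (1 + growth pol t.+1) * V t.+1.
  by rewrite mulr_gt0 ?(fair_growth fp)//; apply: continuation_gt0 => //; case/andP: tt.
rewrite -(pmulr_rge0 _ c0) pn mulr_ge0// addr_ge0//.
exact: continuation_ge0.
Qed.

(** Positivity comes from [V t], so the last period is excluded: there the price vanishes when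
    nobody pays. *)
Lemma fair_gt0 t : (1 <= t < T)%N -> {ae P, forall w, 0 < p t w}.
Proof.
elim: t => [//|[_ tT|t IH tT]].
  apply: filterS2 (fair_start fp) (total_payment_ge0 HE (in_period1 HE)) => w pw S0.
  rewrite -(pmulr_lgt0 _ (fair_supply_gt0 fp)) pw /wealth ltr_pwDr//.
  by apply: continuation_gt0 => //.
have tt : (1 <= t.+1 < T)%N by case/andP: (tT) => _ /ltnW.
have tT' : in_periods T t.+2 by case/andP: tT => _ /ltnW.
apply: filterS3 (IH tt) (fair_next fp tt) (total_payment_ge0 HE tT') => w p0 pn S0.
have c0 : 0 < (1 + growth pol t.+1) * V t.+1.
  by rewrite mulr_gt0 ?(fair_growth fp)//; apply: continuation_gt0 => //; case/andP: tt.
rewrite -(pmulr_rgt0 _ c0) pn mulr_gt0// ltr_pwDr//.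
by apply: continuation_gt0 => //; case/andP: tT.
Qed.

(** Makes the convention on division by 0 in [tokens_due] harmless: a zero price forces the total
    payment, and hence each nonnegative payment, to be 0. *)
Lemma fair_zero t : in_periods T t ->
  {ae P, forall w, p t w = 0 -> forall i, payment E t i w = 0}.
Proof.
move=> tT.
have S0 : {ae P, forall w, p t w = 0 -> S t w = 0}.
  case: t tT => // -[_|t tT].
    apply: filterS2 (fair_start fp) (total_payment_ge0 HE (in_period1 HE)).
    move=> w pw S0 p0; move: pw; rewrite p0 mul0r /wealth => /esym/eqP.
    rewrite paddr_eq0//; last exact: continuation_ge0.
    by case/andP => /eqP.
  have tt : (1 <= t.+1 < T)%N by case/andP: (tT).
  apply: filterS3 (fair_gt0 tt) (fair_next fp tt) (total_payment_ge0 HE tT).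
  move=> w p0 pn S0 pt0; move: pn; rewrite pt0 mulr0 => /esym/eqP.
  rewrite mulf_eq0 (gt_eqF p0) orbF.
  rewrite paddr_eq0//; last exact: continuation_ge0.
  by case/andP => /eqP.
apply: filterS2 S0 (all_payment_ge0 HE tT) => w S0 b0 /S0 /eqP.
rewrite /total_payment psumr_eq0// => /allP h i.
by apply/eqP/h; rewrite mem_index_enum.
Qed.

Lemma fair_measurable t : in_periods T t -> measurable_fun [set: Omega] (p t).
Proof.
move=> tT; apply: (adapted_measurable (info_measurable HE (t := t))).
exact: (fair_adapted fp).
Qed.

(** The martingale property of tokens, which grow by [1 + growth pol t] when carried over.
    [fair_next] expresses the next price through [S t.+1], whose conditional mean is [k], and
    [b * (k + V t.+1) = V t] cancels the constants. The weight may be unbounded, as token holdings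
    are. *)
Lemma fair_transfer t h : (1 <= t < T)%N -> adapted_to (info E t) h ->
  {ae P, forall w, 0 <= h w} -> intg (fun w => h w * p t w) ->
  intg (fun w => h w * p t.+1 w) /\
  b * ((1 + growth pol t) * Ex (fun w => h w * p t.+1 w)) = Ex (fun w => h w * p t w).
Proof.
move=> tt ah h0 Ihp; have st := info_sigma HE t; have mt := info_measurable HE (t := t).
have tT : in_periods T t by case/andP: tt => t1 /ltnW t2; rewrite /in_periods t1.
have tT' : in_periods T t.+1 by case/andP: tt.
have [t1 t2] := andP tt.
have cS := total_payment_cond_exp HE (s := t) (t := t.+1).
have {}cS := cS (ltac:(by rewrite t1 ltnSn)) t2.
have hp0 : {ae P, forall w, 0 <= h w * p t w}.
  by apply: filterS2 h0 (fair_ge0 tT) => w *; exact: mulr_ge0.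
have ahp : adapted_to (info E t) (fun w => h w * p t w).
  by apply: (adaptedM st) => //; exact: (fair_adapted fp).
have Ik : intg (fun w => h w * p t w * k).
  by apply: eq_integrable (intgZ k Ihp) => // w _ /=; rewrite mulrC.
have [IS ES] := pull_out_intg st mt cS (total_payment_intg HE tT')
  (total_payment_ge0 HE tT') ahp hp0 Ik.
set c := (1 + growth pol t) * V t.
have g0 : 0 < 1 + growth pol t by exact: (fair_growth fp).
have V0 : 0 < V t by exact: continuation_gt0.
have c0 : c != 0 by rewrite gt_eqF// mulr_gt0.
have ISV : intg (fun w => c^-1 * (h w * p t w * S t.+1 w + V t.+1 * (h w * p t w))).
  by apply/intgZ/intgD => //; exact: intgZ.
have eqn : {ae P, forall w, c^-1 * (h w * p t w * S t.+1 w + V t.+1 * (h w * p t w)) =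
    h w * p t.+1 w}.
  apply: filterS (fair_next fp tt) => w pn.
  by apply: (mulfI c0); rewrite mulVKf// [RHS]mulrCA /c pn; ring.
have mhp : measurable_fun [set: Omega] (fun w => h w * p t.+1 w).
  by apply: measurable_funM; [exact: adapted_measurable ah|exact: fair_measurable].
split; first exact: intg_ae eqn ISV.
rewrite -(Ex_ae (intg_measurable ISV) mhp eqn) ExZ; last first.
  by apply: intgD => //; exact: intgZ.
rewrite ExD//; last exact: intgZ.
rewrite ES ExZ//.
have -> : Ex (fun w => h w * p t w * k) = k * Ex (fun w => h w * p t w).
  by rewrite -ExZ//; apply: eq_Rintegral => w _; rewrite mulrC.
rewrite -mulrDl mulrA mulrA /c invfM mulrA mulrA.
have -> : b * (1 + growth pol t) / (1 + growth pol t) / V t * (k + V t.+1) = 1.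
  rewrite mulfK ?gt_eqF// mulrAC -continuationS//.
  by rewrite divff// gt_eqF.
by rewrite mul1r.
Qed.

Section bidder.
Variable i : 'I_(bidders E).

Lemma due_paid t : in_periods T t ->
  {ae P, forall w, p t w * tokens_due p t i w = payment E t i w}.
Proof.
move=> tT; apply: filterS (fair_zero tT) => w pz; rewrite /tokens_due.
have [p0|p0] := eqVneq (p t w) 0; first by rewrite p0 mul0r pz.
by rewrite mulrC divfK.
Qed.

(** Trading gains telescope: the tokens left after payment keep their expected discounted value, so
    gains so far are offset by the value still held. The liquidity constraint makes the holding a
    nonnegative weight, as [fair_transfer] requires. *)
Lemma bidder_plan_le q m : bidder_token_plan pol p i q -> in_periods T m ->
  let h t w := bidder_tokens pol p i q t w + q t w - tokens_due p t i w in
  intg (fun w => h m w * p m w) /\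
  \sum_(1 <= t < m.+1) b ^+ t.-1 * (Ex (token_flow p q t) + Ex (payment E t i)) <=
  - (b ^+ m.-1 * Ex (fun w => h m w * p m w)).
Proof.
move=> [plan constr] + h.
have aq t : in_periods T t -> adapted_to (info E t) (q t) by move=> /plan[].
have Iq t : in_periods T t -> intg (token_flow p q t) by move=> /plan[].
have h0 t : in_periods T t -> {ae P, forall w, 0 <= h t w}.
  move=> tT; apply: filterS constr => w /(_ t tT); rewrite /h; lra.
have ah t : in_periods T t -> adapted_to (info E t) (h t).
  move=> tT; have st := info_sigma HE t.
  apply: (adaptedB st); last exact: (tokens_due_adapted HE (fair_adapted fp)).
  apply: (adaptedD st); last exact: aq.
  exact: (bidder_tokens_adapted HE pol (fair_adapted fp)).
have mhp t : in_periods T t -> measurable_fun [set: Omega] (fun w => h t w * p t w).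
  move=> tT; apply: measurable_funM; last exact: fair_measurable.
  exact: (adapted_measurable (info_measurable HE (t := t)) (ah t tT)).
have flowE t : in_periods T t -> {ae P, forall w,
    p t w * bidder_tokens pol p i q t w - (token_flow p q t w + payment E t i w) =
    h t w * p t w}.
  move=> tT; apply: filterS (due_paid tT) => w due.
  by rewrite /token_flow -due /h; ring.
elim: m => [//|[_ _|m IH mT]].
  have T1 := in_period1 HE.
  have I1 : intg (fun w => - (token_flow p q 1 w + payment E 1 i w)).
    by apply/intgN/intgD; [exact: Iq|exact: payment_intg].
  have E1 : {ae P, forall w, - (token_flow p q 1 w + payment E 1 i w) = h 1%N w * p 1%N w}.
    by apply: filterS (flowE 1%N T1) => w <-; rewrite mulr0 sub0r.
  split; first exact: intg_ae (mhp _ T1) E1 I1.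
  rewrite big_nat1 expr0 !mul1r -(Ex_ae (intg_measurable I1) (mhp _ T1) E1) ExN.
    by rewrite opprK ExD//; [exact: Iq|exact: payment_intg].
  by apply: intgD; [exact: Iq|exact: payment_intg].
have mm : (1 <= m.+1 < T)%N by case/andP: (mT).
have mT' : in_periods T m.+1 by case/andP: mm => _ /ltnW.
have [Ihp le] := IH mT'.
have [Ihp' Ehp'] := fair_transfer mm (ah _ mT') (h0 _ mT') Ihp.
set a := (1 + growth pol m.+1).
have Iflow : intg (fun w => token_flow p q m.+2 w + payment E m.+2 i w).
  by apply/intgD; [exact: Iq|exact: payment_intg].
have I1 : intg (fun w => a * (h m.+1 w * p m.+2 w) -
    (token_flow p q m.+2 w + payment E m.+2 i w)).
  by apply: intgB => //; exact: intgZ.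
have E1 : {ae P, forall w, a * (h m.+1 w * p m.+2 w) -
    (token_flow p q m.+2 w + payment E m.+2 i w) = h m.+2 w * p m.+2 w}.
  apply: filterS (flowE _ mT) => w <-; rewrite bidder_tokensS// -/(h m.+1 w) /a.
  by congr (_ - _); ring.
split; first exact: intg_ae (mhp _ mT) E1 I1.
have EE := Ex_ae (intg_measurable I1) (mhp _ mT) E1.
rewrite ExB// ?ExZ// in EE; last exact: intgZ.
rewrite ExD// in EE; [|exact: Iq|exact: payment_intg].
rewrite big_nat_recr//= -EE.
move: le; rewrite /= -Ehp' -/a exprSr => le.
have := le; set u := Ex (fun w => h m.+1 w * p m.+2 w).
set y := Ex _ + Ex _; set z := b ^+ m.
have -> : - (z * b * (a * u - y)) = - (z * (b * (a * u))) + z * b * y by ring.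
by rewrite lerD2r.
Qed.

Lemma bidder_plan_payoff_le q : bidder_token_plan pol p i q ->
  (bidder_payoff i (token_flow p q) <= (auction_payoff i)%:E)%E.
Proof.
move=> plan; have [plan1 constr] := plan.
rewrite bidder_payoffE => [|t /plan1[]//]; rewrite lee_fin gerDl.
have TT : in_periods T T by rewrite /in_periods (one_period HE) leqnn.
have [Ihp le] := bidder_plan_le plan TT.
apply: le_trans le _; rewrite oppr_le0 mulr_ge0//.
  by rewrite exprn_ge0// ltW// (discount_gt0 HE).
apply: Ex_ge0; first exact: intg_measurable Ihp.
apply: filterS2 constr (fair_ge0 TT) => w /(_ T TT) c p0.
by rewrite mulr_ge0//; lra.
Qed.

(** Never carrying tokens over attains the upper bound, so every optimal plan has the benchmark
    payoff. *)
Lemma pay_as_you_go_plan : bidder_token_plan pol p i (fun t => tokens_due p t i) /\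
  bidder_payoff i (token_flow p (fun t => tokens_due p t i)) = (auction_payoff i)%:E.
Proof.
have flowE t : in_periods T t ->
    {ae P, forall w, - payment E t i w = token_flow p (fun t => tokens_due p t i) t w}.
  by move=> tT; apply: filterS (due_paid tT) => w <-.
have mflow t : in_periods T t ->
    measurable_fun [set: Omega] (token_flow p (fun t => tokens_due p t i) t).
  move=> tT; apply: measurable_funN; apply: measurable_funM.
    exact: fair_measurable.
  apply: (adapted_measurable (info_measurable HE (t := t))).
  exact: (tokens_due_adapted HE (fair_adapted fp)).
have Ipay t : in_periods T t -> intg (fun w => - payment E t i w).
  by move=> tT; apply: intgN; exact: payment_intg.
have Iflow t : in_periods T t -> intg (token_flow p (fun t => tokens_due p t i) t).
  by move=> tT; exact: intg_ae (mflow t tT) (flowE t tT) (Ipay t tT).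
split.
  split.
    move=> t tT; split; last exact: Iflow.
    exact: (tokens_due_adapted HE (fair_adapted fp)).
  apply: aeW => w t /andP[]; case: t => // t _ _.
  suff -> : bidder_tokens pol p i (fun t => tokens_due p t i) t.+1 w = 0 by rewrite subr0.
  elim: t => [//|t IH]; rewrite bidder_tokensS// IH add0r.
  by rewrite subrr mulr0.
rewrite bidder_payoffE// big_nat big1 ?addr0// => t tT.
rewrite -(Ex_ae (intg_measurable (Ipay t tT)) (mflow t tT) (flowE t tT)).
rewrite ExN; last exact: payment_intg.
by rewrite addNr mulr0.
Qed.

Lemma bidder_optimal_payoff q : bidder_token_plan pol p i q ->
  (forall q', bidder_token_plan pol p i q' ->
    (bidder_payoff i (token_flow p q') <= bidder_payoff i (token_flow p q))%E) ->
  bidder_payoff i (token_flow p q) = (auction_payoff i)%:E.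
Proof.
move=> plan opt; apply/eqP; rewrite eq_le bidder_plan_payoff_le//=.
by have [plan0 <-] := pay_as_you_go_plan; exact: opt.
Qed.

End bidder.

(** Assets are the tokens held after trading plus the safe savings, so a sale changes their
    composition but not their value. Fairness holds for tokens by [fair_transfer] and for savings
    because their return is [b^-1]. *)
Lemma token_plan_financed Q c s : auctioneer_token_plan E pol p Q c s ->
  financed E c
    (fun t w => p t w * (auctioneer_tokens E pol p Q t w + Q t w) + s t w)
    (fun t w => p t w * auctioneer_tokens E pol p Q t w + b^-1 * s t.-1 w).
Proof.
move=> [aQ H0 [acs cs0 s0 bud]].
pose H t w := auctioneer_tokens E pol p Q t w + Q t w.
have aH t : in_periods T t -> adapted_to (info E t) (H t).
  move=> tT; apply: (adaptedD (info_sigma HE t)); last exact: aQ.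
  exact: (auctioneer_tokens_adapted HE p (fair_recycling fp)).
have mm t (f : Omega -> R) : adapted_to (info E t) f -> measurable_fun [set: Omega] f.
  exact: (adapted_measurable (info_measurable HE (t := t))).
have H0t t : in_periods T t -> {ae P, forall w, 0 <= H t w}.
  by move=> tT; apply: filterS H0 => w; exact.
split.
- move=> t tT; have [/mm mc /mm ms] := acs t tT; split => //.
  apply: measurable_funD => //; apply: measurable_funM; first exact: fair_measurable.
  exact: mm (aH t tT).
- by move=> t tT w; have [] := cs0 t w tT.
- move=> t tT; apply: filterS2 (fair_ge0 tT) (H0t t tT) => w p0 Ht.
  by rewrite addr_ge0 ?mulr_ge0//; have [] := cs0 t w tT.
- apply: filterS2 bud (fair_start fp) => w /(_ 1%N (in_period1 HE)) + <-.
  by rewrite s0 mulr0 /token_revenue/=; lra.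
- move=> t /andP[t1 tT]; have tT' : in_periods T t.+1 by rewrite /in_periods tT.
  apply: filterS bud => w /(_ t.+1 tT'); rewrite /token_revenue/= addrCA => ->.
  by lra.
move=> t tt g K ag gK IX; have [t1 t2] := andP tt.
have {}IX : intg (fun w => g w * (p t w * H t w + s t w)) := IX.
have tT : in_periods T t by rewrite /in_periods t1 ltnW.
have tT' : in_periods T t.+1 by rewrite /in_periods t2.
have g0 w : 0 <= g w by have /andP[] := gK w.
have st := info_sigma HE t.
have ag' := adapted_sub (info_subset HE t1) ag.
have [/mm mc /mm ms] := acs t tT.
have pH0 : {ae P, forall w, 0 <= p t w * H t w}.
  by apply: filterS2 (fair_ge0 tT) (H0t t tT) => w *; exact: mulr_ge0.
have s0' w : 0 <= s t w by have [] := cs0 t w tT.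
have IgH : intg (fun w => (g w * H t w) * p t w).
  apply: intg_le IX.
    apply: measurable_funM; last exact: fair_measurable.
    by apply: measurable_funM; [exact: mm ag|exact: mm (aH t tT)].
  apply: filterS pH0 => w pH.
  have -> : g w * H t w * p t w = g w * (p t w * H t w) by ring.
  by rewrite ger0_norm ?(mulr_ge0 (g0 w) pH)// ler_wpM2l// lerDl.
have Igs : intg (fun w => g w * s t w).
  apply: intg_le IX; first by apply: measurable_funM => //; exact: mm ag.
  apply: filterS pH0 => w pH.
  by rewrite ger0_norm ?mulr_ge0// ler_wpM2l// lerDr.
have agH : adapted_to (info E t) (fun w => g w * H t w).
  by apply: (adaptedM st) => //; exact: aH.
have gH0 : {ae P, forall w, 0 <= g w * H t w}.
  by apply: filterS (H0t t tT) => w ?; exact: mulr_ge0.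
have [IgH' EgH'] := fair_transfer tt agH gH0 IgH.
have yE w : g w * (p t.+1 w * auctioneer_tokens E pol p Q t.+1 w + b^-1 * s t.+1.-1 w) =
    (1 + growth pol t) * (g w * H t w * p t.+1 w) + b^-1 * (g w * s t w).
  by rewrite (auctioneer_tokensS p (fair_recycling fp))// -/(H t w) /=; ring.
have I1 : intg (fun w => (1 + growth pol t) * (g w * H t w * p t.+1 w)) by exact: intgZ.
have I2 : intg (fun w => b^-1 * (g w * s t w)) by exact: intgZ.
split.
  have := intgD I1 I2; apply: eq_integrable => // w _ /=.
  by rewrite yE.
under eq_Rintegral do rewrite yE.
rewrite ExD// !ExZ// mulrDr EgH' mulVKf ?discount_neq0//.
rewrite -ExD//.
rewrite le_eqVlt; apply/orP; left; apply/eqP.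
by apply: eq_Rintegral => w _; rewrite /H; ring.
Qed.

Definition sell_all (t : nat) (_ : Omega) : R :=
  if t == 1%N then - initial_supply pol else 0.

Lemma sell_all_holdings t w : in_periods T t ->
  auctioneer_tokens E pol p sell_all t w + sell_all t w = 0.
Proof.
elim: t => [//|[_ _|t IH tT]]; first by rewrite /= /sell_all/= subrr.
have tT' : in_periods T t.+1 by case/andP: tT => _ /ltnW.
by rewrite (auctioneer_tokensS p (fair_recycling fp))// IH// mulr0 add0r /sell_all.
Qed.

Lemma sell_all_plan :
  auctioneer_token_plan E pol p sell_all (smooth_consumption E) (smooth_savings E).
Proof.
split.
- by move=> t tT; exact: adapted_cst (info_sigma HE t) _.
- by apply: aeW => w t tT; rewrite sell_all_holdings.
apply: (smooth_plan HE).
  by apply: filterS (fair_start fp) => w <-; rewrite /token_revenue /sell_all/= mulrN opprK.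
apply: aeW => w [//|[//|t]] _.
by rewrite /token_revenue /sell_all/= mulr0 oppr0.
Qed.

(** [best_payoff] bounds every plan and [sell_all] attains it, so optimality becomes an equation. *)
Lemma token_optimalP Q c s : auctioneer_token_optimal E pol p Q c s <->
  auctioneer_token_plan E pol p Q c s /\ auctioneer_payoff E c = (best_payoff E)%:E.
Proof.
have le Q' c' s' : auctioneer_token_plan E pol p Q' c' s' ->
    (auctioneer_payoff E c' <= (best_payoff E)%:E)%E.
  by move=> /token_plan_financed; exact: financed_le.
split=> -[plan opt]; split => //; last by move=> Q' c' s' /le; rewrite opt.
apply/eqP; rewrite eq_le (le _ _ _ plan)/= -(smooth_payoff HE).
exact: opt sell_all_plan.
Qed.

Lemma sell_all_optimal :
  auctioneer_token_optimal E pol p sell_all (smooth_consumption E) (smooth_savings E) /\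
  holds_no_tokens E pol p sell_all.
Proof.
split; first by apply/token_optimalP; split; [exact: sell_all_plan|exact: smooth_payoff].
by apply: aeW => w t; exact: sell_all_holdings.
Qed.

(** Since tokens received are burnt, an auctioneer who keeps none after trading has none to sell
    later; all revenue falls into period 1. *)
Lemma no_tokens_revenue Q : holds_no_tokens E pol p Q ->
  {ae P, forall w, forall t, in_periods T t ->
    token_revenue p Q t w = if t == 1%N then wealth E w else 0}.
Proof.
move=> nt; apply: filterS2 nt (fair_start fp) => w nt pw t tT.
have QA := nt t tT; rewrite /token_revenue.
case: t tT QA => // -[_|t tT] /=.
  by move=> /eqP; rewrite addrC addr_eq0 => /eqP ->; rewrite mulrN opprK.
have tT' : in_periods T t.+1 by case/andP: tT => _ /ltnW.
rewrite -/(auctioneer_tokens E pol p Q t.+2 w) => QA.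
have : auctioneer_tokens E pol p Q t.+2 w + Q t.+2 w = 0 := QA.
rewrite (auctioneer_tokensS p (fair_recycling fp))// nt// mulr0 add0r => ->.
by rewrite mulr0 oppr0.
Qed.

End fair_token_prices.

(** * Equity *)

Section equity.
Context (R : realType) (d : measure_display) (Omega : measurableType d)
  (P : probability Omega R) (E : auction_env P).
Hypothesis HE : auction_model E.

Local Notation intg f := (P.-integrable [set: Omega] (EFin \o f)).
Local Notation Ex f := (Rintegral P [set: Omega] f).
Local Notation T := (periods E).
Local Notation b := (discount E).
Local Notation k := (mean_revenue E).
Local Notation S := (total_payment E).
Local Notation V := (equity_value E).

Lemma geometric_annuity n : (1 - b) * annuity E n = 1 - b ^+ n.
Proof.
elim: n => [|n IH]; first by rewrite /annuity big_nil mulr0 expr0 subrr.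
by rewrite annuityS mulrDr mulrCA IH exprS; ring.
Qed.

Lemma equity_value_annuity : V = b * annuity E T.-1 * k.
Proof.
have b1 : 1 - b != 0 by rewrite subr_eq0 gt_eqF// (discount_lt1 HE).
by rewrite /equity_value -geometric_annuity [X in b * X]mulrAC mulfV// mul1r.
Qed.

Lemma wealthE w : wealth E w = S 1 w + V.
Proof. by rewrite /wealth continuation1. Qed.

Section payoff.
Variables (e y : Omega -> R).
Hypothesis ye : equity_admissible E e y.

Lemma dividend_intg t : (2 <= t <= T)%N ->
  intg (fun w => y w * S t w) /\ Ex (fun w => y w * S t w) = k * Ex y.
Proof.
move=> /andP[t2 tT]; have [ay y0 Iy _] := ye.
have tT' : in_periods T t by rewrite /in_periods tT (leq_trans _ t2).
have cS := total_payment_cond_exp HE (s := 1) (t := t) t2 tT.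
have Ik : intg (fun w => y w * k).
  by apply: eq_integrable (intgZ k Iy) => // w _ /=; rewrite mulrC.
have [IS ->] := pull_out_intg (info_sigma HE 1) (info_measurable HE (t := 1)) cS
  (total_payment_intg HE tT') (total_payment_ge0 HE tT') ay y0 Ik.
split=> //; rewrite -ExZ//; apply: eq_Rintegral => w _; exact: mulrC.
Qed.

Lemma equity_flow_intg i t : in_periods T t -> intg (equity_flow e y i t) /\
  Ex (equity_flow e y i t) + Ex (payment E t i) =
  if t == 1%N then - Ex (fun w => y w * e w) else k * Ex y.
Proof.
move=> tT; have [_ _ _ Iye] := ye; rewrite /equity_flow.
have Ip := payment_intg HE i tT.
have [->|t1] := eqVneq t 1%N; rewrite ?eqxx /=.
  have I1 : intg (fun w => - payment E 1 i w) by exact/intgN/payment_intg/in_period1.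
  split; first exact: intgD I1 (intgN Iye).
  rewrite ExD//; last exact: intgN.
  by rewrite !ExN//; [lra|exact/payment_intg/in_period1].
have t2 : (2 <= t <= T)%N.
  by move: tT => /andP[]; rewrite leq_eqVlt eq_sym (negbTE t1)/= => -> ->.
have [IS ES] := dividend_intg t2.
split; first exact: intgD (intgN Ip) IS.
by rewrite ExD//; [rewrite ES ExN//; lra|exact: intgN].
Qed.

Lemma equity_payoffE (i : 'I_(bidders E)) : bidder_payoff i (equity_flow e y i) =
  (auction_payoff i + (V * Ex y - Ex (fun w => y w * e w)))%:E.
Proof.
rewrite (bidder_payoffE HE) => [|t /(equity_flow_intg i)[]//].
congr EFin; congr (_ + _); rewrite big_nat.
rewrite (eq_bigr (fun t => b ^+ t.-1 *
   (if t == 1%N then - Ex (fun w => y w * e w) else k * Ex y))); last first.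
  by move=> t /(equity_flow_intg i)[_ ->].
rewrite -big_nat big_ltn ?ltnS ?(one_period HE)//= expr0 mul1r addrC.
congr (_ - _); rewrite equity_value_annuity /annuity big_add1 /=.
rewrite -{1}(prednK (one_period HE)) big_add1/= !mulr_sumr !mulr_suml.
by apply: eq_bigr => t _; rewrite /= exprS; ring.
Qed.

End payoff.

Lemma cst_admissible e y0 : {ae P, forall w, e w = V} -> measurable_fun [set: Omega] e ->
  0 <= y0 -> equity_admissible E e (fun=> y0).
Proof.
move=> eV me y0ge; split.
- exact: adapted_cst (info_sigma HE 1) _.
- exact: aeW.
- exact: intg_cst.
- apply: (@intg_ae _ _ _ _ (fun=> y0 * V)); last exact: intg_cst.
    exact: measurable_funM.
  by apply: filterS eV => w ->.
Qed.

Lemma fair_equity_payoff e y (i : 'I_(bidders E)) :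
  {ae P, forall w, e w = V} -> equity_admissible E e y ->
  bidder_payoff i (equity_flow e y i) = (auction_payoff i)%:E.
Proof.
move=> eV ye; rewrite equity_payoffE//; have [ay _ Iy Iye] := ye.
suff -> : Ex (fun w => y w * e w) = V * Ex y by rewrite subrr addr0.
rewrite -ExZ//; apply: Ex_ae; [exact: intg_measurable Iye| |].
  exact: intg_measurable (intgZ V Iy).
by apply: filterS eV => w ->; rewrite mulrC.
Qed.

Lemma equity_price e x c s : equity_equilibrium (E := E) e x c s ->
  {ae P, forall w, e w = V}.
Proof.
move=> [ae sx opt _ _]; have s1 := info_sigma HE 1.
have m1 := info_measurable HE (t := 1).
have me := adapted_measurable m1 ae.
have aV : adapted_to (info E 1) (fun=> V) by exact: adapted_cst.
have loc (y : Omega -> R) (i : 'I_(bidders E)) : equity_admissible E e y ->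
    V * Ex y - Ex (fun w => y w * e w) <= V * Ex (x i) - Ex (fun w => x i w * e w).
  move=> ye; have [xe /(_ y ye)] := opt i.
  by rewrite !equity_payoffE// lee_fin lerD2l.
(* A single bidder can always buy more, so underpricing already contradicts that bidder's
   optimality. *)
have low : {ae P, forall w, V <= e w}.
  have n0 : (0 < bidders E)%N by rewrite (leq_trans _ (two_bidders HE)).
  pose i := Ordinal n0; have [[ax x0 Ix Ixe] _] := opt i.
  have GA : info E 1 [set w | e w < V] by exact: adapted_lt.
  (* The weight keeps the additional expenditure [z * e] bounded. *)
  pose z w := \1_([set w | e w < V]) w / (1 + `|e w|).
  have d0 w : 0 < 1 + `|e w| by rewrite ltr_pwDl.
  have z0 w : 0 <= z w by rewrite /z divr_ge0 ?indicE// ltW.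
  have az : adapted_to (info E 1) z.
    apply: (adapted_div s1); first exact: adapted_indic.
    apply: (adaptedD s1); first exact: adapted_cst.
    by apply: (adapted_comp s1 (u := fun y => `|y|)) => //; exact: measurable_normr.
  have mz := adapted_measurable m1 az.
  have z1 w : z w * (1 + `|e w|) <= 1.
    by rewrite /z divfK ?gt_eqF// indicE; case: (_ \in _).
  have Iz : intg z.
    apply: intg_le (intg_cst P 1) => //; apply: aeW => w; rewrite ger0_norm//.
    by have := z1 w; have := mulr_ge0 (z0 w) (normr_ge0 (e w)); lra.
  have Ize : intg (fun w => z w * e w).
    apply: intg_le (intg_cst P 1); first exact: measurable_funM.
    by apply: aeW => w; rewrite normrM (ger0_norm (z0 w)); have := z1 w; have := z0 w; lra.
  have Ixze : intg (fun w => (x i w + z w) * e w).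
    by apply: eq_integrable (intgD Ixe Ize) => // w _ /=; rewrite mulrDl.
  have /loc - /(_ i) : equity_admissible E e (fun w => x i w + z w).
    split => //; first exact: adaptedD.
      by apply: filterS x0 => w ?; rewrite addr_ge0.
    exact: intgD.
  rewrite ExD//.
  have -> : Ex (fun w => (x i w + z w) * e w) =
      Ex (fun w => x i w * e w) + Ex (fun w => z w * e w).
    by rewrite -ExD//; apply: eq_Rintegral => w _; rewrite mulrDl.
  move=> h.
  have IzV : intg (fun w => V * z w - z w * e w) by apply: intgB => //; exact: intgZ.
  have : {ae P, forall w, V * z w - z w * e w = 0}.
    apply: Ex_eq0_ae => //.
      apply: aeW => w; rewrite (mulrC V) -mulrBr /z indicE.
      case: (boolP (w \in _)) => [|_]; last by rewrite !mul0r.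
      rewrite inE/= => eV; rewrite mulr_ge0 ?divr_ge0// ?ltW//.
      by rewrite subr_gt0.
    by rewrite ExB// ?ExZ//; [lra|exact: intgZ].
  apply: filterS => w; rewrite (mulrC V) -mulrBr => /eqP; rewrite mulf_eq0.
  have [eV|//] := ltP (e w) V.
  rewrite /z indic_in// mul1r invr_eq0 gt_eqF//= subr_eq0 => /eqP h2.
  by move: eV; rewrite h2 ltxx.
(* Holdings cannot be negative, so overpricing only forces each [x i] to vanish there; the
   contradiction then comes from the shares summing to 1. *)
have high : {ae P, forall w, forall i, x i w * \1_([set w | V < e w]) w = 0}.
  apply: ae_forall_fin => i; have [[ax x0 Ix Ixe] _] := opt i.
  have GA : info E 1 [set w | e w <= V] by exact: adapted_le.
  have mA := m1 _ GA.
  have I1 : intg (fun w => \1_([set w | e w <= V]) w * x i w) by exact: intg_indic.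
  have I2 : intg (fun w => \1_([set w | e w <= V]) w * x i w * e w).
    by apply: eq_integrable (intg_indic mA Ixe) => // w _ /=; rewrite mulrA.
  have /loc - /(_ i) : equity_admissible E e (fun w => \1_([set w | e w <= V]) w * x i w).
    split => //.
      by apply: (adaptedM s1) => //; exact: adapted_indic.
    exact: ae_indic_ge0.
  move=> h.
  pose f w := (x i w * e w - \1_([set w | e w <= V]) w * x i w * e w) -
    V * (x i w - \1_([set w | e w <= V]) w * x i w).
  have fE w : f w = x i w * \1_([set w | V < e w]) w * (e w - V).
    rewrite /f; have [eV|eV] := leP (e w) V.
      rewrite indic_in// indic_out/=; last by apply/negP; rewrite -leNgt.
      by ring.
    rewrite indic_out ?indic_in//=; last by apply/negP; rewrite -ltNge.
    by ring.
  have If : intg f by apply: intgB; [exact: intgB|exact/intgZ/intgB].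
  have : {ae P, forall w, f w = 0}.
    apply: Ex_eq0_ae => //.
      apply: filterS x0 => w x0; rewrite fE; have [eV|eV] := leP (e w) V.
        by rewrite indic_out ?mulr0 ?mul0r//=; apply/negP; rewrite -leNgt.
      by rewrite indic_in// mulr1 mulr_ge0// subr_ge0 ltW.
    rewrite ExB; [|exact: intgB|exact/intgZ/intgB].
    by rewrite ExZ; [rewrite !ExB//; lra|exact: intgB].
  apply: filterS => w; rewrite fE => /eqP; rewrite mulf_eq0 => /predU1P[//|].
  rewrite subr_eq0 => /eqP eV; rewrite indic_out ?mulr0//= eV.
  by rewrite ltxx.
apply: filterS3 low high sx => w le hi sx; apply/eqP; rewrite eq_le le andbT leNgt.
apply/negP => lt; move: sx; rewrite big1.
  by move/eqP; rewrite eq_sym oner_eq0.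
by move=> i _; have := hi i; rewrite indic_in// mulr1.
Qed.

Lemma fair_equity_revenue e x : {ae P, forall w, e w = V} ->
  {ae P, forall w, \sum_i x i w = 1} ->
  {ae P, forall w, forall t, in_periods T t ->
    equity_revenue (E := E) e x t w = if t == 1%N then wealth E w else 0}.
Proof.
move=> eV sx; apply: filterS2 eV sx => w eV sx t tT; rewrite /equity_revenue sx !mul1r.
by case: eqP => [->|_]; rewrite ?subrr// eV wealthE.
Qed.

(** With all revenue in period 1 the auctioneer's assets are its savings alone, and these are fair
    because their return is [b^-1]. *)
Lemma consumption_financed rev c s :
  {ae P, forall w, forall t, in_periods T t ->
    rev t w = if t == 1%N then wealth E w else 0} ->
  consumption_plan E rev c s ->
  financed E c s (fun t w => b^-1 * s t.-1 w).
Proof.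
move=> revE [acs cs0 s0 bud].
have mm t (f : Omega -> R) : adapted_to (info E t) f -> measurable_fun [set: Omega] f.
  exact: (adapted_measurable (info_measurable HE (t := t))).
split.
- by move=> t tT; have [/mm mc /mm ms] := acs t tT.
- by move=> t tT w; have [] := cs0 t w tT.
- by move=> t tT; apply: aeW => w; have [] := cs0 t w tT.
- apply: filterS2 revE bud => w /(_ 1%N (in_period1 HE)) revw /(_ 1%N (in_period1 HE)) ->.
  by rewrite revw/= s0 mulr0 addr0.
- move=> t /andP[t1 tT]; have tT' : in_periods T t.+1 by rewrite /in_periods tT.
  apply: filterS2 revE bud => w /(_ _ tT') revw /(_ _ tT') ->.
  by rewrite revw; case: t t1 {tT tT' revw} => // t _ /=; rewrite add0r.
move=> t /andP[t1 tT] g K ag gK IX.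
have sE w : g w * (b^-1 * s t.+1.-1 w) = b^-1 * (g w * s t w) by rewrite mulrCA.
split.
  by have := intgZ b^-1 IX; apply: eq_integrable => // w _; rewrite /= mulrCA.
under eq_Rintegral do rewrite sE.
by rewrite ExZ// mulVKf// discount_neq0.
Qed.

Lemma equity_auctioneer_le e x c s : {ae P, forall w, e w = V} ->
  {ae P, forall w, \sum_i x i w = 1} ->
  consumption_plan E (equity_revenue (E := E) e x) c s ->
  (auctioneer_payoff E c <= (best_payoff E)%:E)%E.
Proof.
move=> eV sx plan.
exact: (financed_le HE (consumption_financed (fair_equity_revenue eV sx) plan)).
Qed.

Lemma equity_equilibriumI e x c s : adapted_to (info E 1) e ->
  {ae P, forall w, e w = V} -> {ae P, forall w, \sum_i x i w = 1} ->
  (forall i, equity_admissible E e (x i)) ->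
  consumption_plan E (equity_revenue (E := E) e x) c s ->
  auctioneer_payoff E c = (best_payoff E)%:E ->
  equity_equilibrium (E := E) e x c s.
Proof.
move=> ae eV sx xe plan best; split => //.
  move=> i; split => // y ye.
  by rewrite !fair_equity_payoff.
by move=> c' s' plan'; rewrite best; exact: equity_auctioneer_le plan'.
Qed.

Lemma equity_equilibrium_auctioneer e x c s : equity_equilibrium (E := E) e x c s ->
  auctioneer_payoff E c = (best_payoff E)%:E.
Proof.
move=> eq; have eV := equity_price eq; have [_ sx _ plan opt] := eq.
apply/eqP; rewrite eq_le (equity_auctioneer_le eV sx plan)/= -(smooth_payoff HE).
have revE := fair_equity_revenue eV sx.
apply: opt (smooth_savings E) _; apply: (smooth_plan HE).
  by apply: filterS revE => w /(_ _ (in_period1 HE)).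
apply: filterS revE => w revE [//|[//|t]] tT.
by rewrite revE.
Qed.

Lemma equity_equilibrium_bidder e x c s (i : 'I_(bidders E)) :
  equity_equilibrium (E := E) e x c s ->
  bidder_payoff i (equity_flow e (x i) i) = (auction_payoff i)%:E.
Proof.
move=> eq; have [_ _ opt _ _] := eq; have [xe _] := opt i.
exact: fair_equity_payoff (equity_price eq) xe.
Qed.

(** At the fair price any admissible division is optimal. The equal one also serves to turn tokens
    into equity: a bidder may trade tokens in every period but shares only once, so only aggregate
    flows are matched. *)
Definition equal_shares (_ : 'I_(bidders E)) (_ : Omega) : R := (bidders E)%:R^-1.

Lemma equal_shares_sum w : \sum_i equal_shares i w = 1.
Proof.
rewrite sumr_const card_ord -[_ *+ _]mulr_natr mulVf// pnatr_eq0 -lt0n.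
by rewrite (leq_trans _ (two_bidders HE)).
Qed.

Lemma equal_shares_equilibrium rev c s :
  {ae P, forall w, forall t, in_periods T t ->
    rev t w = if t == 1%N then wealth E w else 0} ->
  consumption_plan E rev c s -> auctioneer_payoff E c = (best_payoff E)%:E ->
  equity_equilibrium (E := E) (fun=> V) equal_shares c s.
Proof.
move=> revE [acs cs0 s0 bud] best.
have sx : {ae P, forall w, \sum_i equal_shares i w = 1}.
  by apply: aeW => w; exact: equal_shares_sum.
apply: equity_equilibriumI => //.
- exact: adapted_cst (info_sigma HE 1) _.
- exact: aeW.
- move=> i; apply: cst_admissible => //; first exact: aeW.
have eqE : {ae P, forall w, V = V} by exact: aeW.
split => //; apply: filterS3 bud revE (fair_equity_revenue eqE sx).
by move=> w bud revE eqE' t tT; rewrite bud// revE// eqE'.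
Qed.

End equity.

(** * Prices in a token equilibrium *)

Section token_equilibrium_prices.
Context (R : realType) (d : measure_display) (Omega : measurableType d)
  (P : probability Omega R) (E : auction_env P).
Hypothesis HE : auction_model E.

Local Notation intg f := (P.-integrable [set: Omega] (EFin \o f)).
Local Notation Ex f := (Rintegral P [set: Omega] f).
Local Notation T := (periods E).
Local Notation b := (discount E).
Local Notation k := (mean_revenue E).
Local Notation S := (total_payment E).
Local Notation V := (continuation E).

Variables (pol : token_policy R) (p pe Q : nat -> Omega -> R)
  (q : 'I_(bidders E) -> nat -> Omega -> R) (c s : nat -> Omega -> R).
Hypothesis Hpol : valid_policy T pol.
Hypothesis burning : forall t, in_periods T t -> recycling pol t = -1.
Hypothesis eqm : token_equilibrium pol p pe Q q c s.

Local Notation M := (token_supply pol p Q q).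

Let p_adapted t : in_periods T t -> adapted_to (info E t) (p t).
Proof. by case/(price_adapted eqm). Qed.

Let p_intg t : in_periods T t -> intg (p t).
Proof. by case/(price_adapted eqm). Qed.

Lemma supply_adapted t : in_periods T t -> adapted_to (info E t) (M t.+1).
Proof.
move=> tT; have st := info_sigma HE t; apply: (adaptedD st).
  apply: (auctioneer_tokensS_adapted HE p burning) => // t' t'T.
  by have [[aQ _ _] _] := auctioneer_optimal eqm; exact: aQ.
apply: (adapted_sum st) => i.
apply: (bidder_tokensS_adapted HE pol p_adapted) => // t' t'T.
by have [[/(_ t' t'T)[]]] := bidders_optimal eqm i.
Qed.

Lemma supply1 w : M 1 w = initial_supply pol.
Proof. by rewrite /token_supply /= big1 ?addr0. Qed.

Lemma supply_next t : in_periods T t -> {ae P, forall w,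
  M t.+1 w = (1 + growth pol t) * (M t w - S t w / p t w)}.
Proof.
move=> tT; apply: filterS (market_clearing eqm) => w /(_ t tT) mc.
rewrite /token_supply (auctioneer_tokensS p burning)//.
under eq_bigr => i _ do rewrite bidder_tokensS ?(andP tT).1//.
rewrite -mulr_sumr -mulrDr; congr (_ * _).
rewrite sumrB big_split/= /tokens_due -mulr_suml -/(total_payment E t w).
move: mc; set q' := \sum_(i < bidders E) q i t w; lra.
Qed.

Lemma supply_price t : in_periods T t -> {ae P, forall w,
  [/\ 0 < M t w, 0 <= S t w, S t w / M t w <= p t w &
      p t w = Num.max (S t w / M t w) (b * (1 + growth pol t) * pe t w)]}.
Proof.
move=> tT; apply: filterS3 (supply_gt0 eqm) (price_eq eqm) (total_payment_ge0 HE tT).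
move=> w /(_ t tT) M0 /(_ t tT) pw S0; split => //.
by rewrite pw le_max lexx.
Qed.

Lemma price_ge0 t : in_periods T t -> {ae P, forall w, 0 <= p t w}.
Proof.
move=> tT; apply: filterS (supply_price tT) => w [M0 S0 + _]; apply: le_trans.
by rewrite divr_ge0// ltW.
Qed.

Lemma expected_price_ge0 t : in_periods T t -> {ae P, forall w, 0 <= pe t w}.
Proof.
move=> tT; have := tT => /andP[t1]; rewrite leq_eqVlt => /predU1P[tE|tlt].
  have cp := price_expected eqm tT.
  have p0 : p t.+1 = (fun=> 0) by apply/funext => w; rewrite tE (price_end eqm).
  apply: (cond_exp_ge0 (info_sigma HE t) (info_measurable HE (t := t)) cp).
    by rewrite p0; exact: intg_cst.
  by rewrite p0; exact: aeW.
have tT' : in_periods T t.+1 by rewrite /in_periods tlt.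
apply: (cond_exp_ge0 (info_sigma HE t) (info_measurable HE (t := t))
  (price_expected eqm tT)); [exact: p_intg|exact: price_ge0].
Qed.

(** The price is at least [S t / M t], so the tokens due never exceed the supply; at a zero price
    this bound also gives [S t = 0]. *)
Lemma burnt_le t : in_periods T t -> {ae P, forall w,
  S t w / p t w <= M t w /\ p t w * (S t w / p t w) = S t w}.
Proof.
move=> tT; apply: filterS2 (supply_price tT) (price_ge0 tT) => w [M0 S0 Sp _].
rewrite le_eqVlt => /predU1P[/esym p0|p0].
  have S00 : S t w = 0.
    apply/eqP; rewrite eq_le S0 andbT.
    by rewrite p0 ler_pdivrMr// mul0r in Sp.
  by rewrite p0 S00 !mul0r; split => //; exact: ltW.
split.
- by rewrite ler_pdivrMr// -ler_pdivrMl// mulrC.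
- by rewrite mulrC divfK// gt_eqF.
Qed.

(** A growth rate of -1 would annihilate the supply, which must be positive in the next period; one
    outcome decides, the rate being deterministic. *)
Lemma growth_gt0 t : (1 <= t < T)%N -> 0 < 1 + growth pol t.
Proof.
move=> /andP[t1 tT]; have tT0 : in_periods T t by rewrite /in_periods t1 ltnW.
have tT' : in_periods T t.+1 by rewrite /in_periods tT.
have [w [M' [M1 b1]]] : exists w, 0 < M t.+1 w /\
    M t.+1 w = (1 + growth pol t) * (M t w - S t w / p t w) /\
    S t w / p t w <= M t w.
  apply: (ae_exists (P := P)).
  apply: filterS3 (supply_price tT') (supply_next tT0) (burnt_le tT0).
  by move=> w [? _ _ _] ? [? _].
have [_ /(_ t tT0)[g1 _]] := Hpol.
rewrite lt_neqAle; apply/andP; split; last lra.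
by apply/eqP => g0; move: M'; rewrite M1 -g0 mul0r ltxx.
Qed.

(* Tokens that are left over must not all be spent, which rules out that the
   price is determined by the payments of the period alone. *)
Lemma price_expectation t : (1 <= t < T)%N ->
  {ae P, forall w, p t w = b * (1 + growth pol t) * pe t w}.
Proof.
move=> tt; have g0 := growth_gt0 tt; have [t1 tT] := andP tt.
have tT0 : in_periods T t by rewrite /in_periods t1 ltnW.
have tT' : in_periods T t.+1 by rewrite /in_periods tT.
have bg0 : 0 < b * (1 + growth pol t) by rewrite mulr_gt0// (discount_gt0 HE).
have left : {ae P, forall w, S t w / p t w < M t w}.
  apply: filterS2 (supply_price tT') (supply_next tT0) => w [M' _ _ _] M1.
  by move: M'; rewrite M1 pmulr_rgt0// subr_gt0.
apply: filterS3 (supply_price tT0) (expected_price_ge0 tT0) left => w [M0 S0 Sp pw] pe0 lt.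
have bpe0 : 0 <= b * (1 + growth pol t) * pe t w by rewrite mulr_ge0// ltW.
have [bS|//] := leP (b * (1 + growth pol t) * pe t w) (S t w / M t w); last first.
  by move=> bS; rewrite pw; apply/max_idPr/ltW.
have pE : p t w = S t w / M t w by rewrite pw; apply/max_idPl.
have [S00|S00] := eqVneq (S t w) 0.
  rewrite pE S00 mul0r; apply/eqP; rewrite eq_le bpe0.
  by move: bS; rewrite S00 mul0r => ->.
by move: lt; rewrite pE invf_div mulrCA mulfV// mulr1 ltxx.
Qed.

(** The price after [T] is 0, so its conditional expectation vanishes, though only almost surely,
    and payments alone set the price. *)
Lemma last_price : {ae P, forall w, p T w * M T w = S T w}.
Proof.
have TT : in_periods T T by rewrite /in_periods (one_period HE) leqnn.
have [ape Ipe _] := price_expected eqm TT; have st := info_sigma HE T.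
have pe0 : {ae P, forall w, pe T w = 0}.
  apply: (adapted_ae_eq st (info_measurable HE (t := T)) ape) => //.
  - exact: adapted_cst.
  - exact: intg_cst.
  move=> A GA; rewrite (cond_expE (price_expected eqm TT) GA).
  by apply: eq_Rintegral => w _; rewrite (price_end eqm).
apply: filterS2 (supply_price TT) pe0 => w [M0 S0 Sp pw] pe0.
move: pw; rewrite pe0 mulr0; have /max_idPl -> : 0 <= S T w / M T w.
  by rewrite divr_ge0// ltW.
by move=> ->; rewrite divfK// gt_eqF.
Qed.

(* Backward induction: the expected value of next period's supply is known. *)
Lemma supply_value t : in_periods T t ->
  {ae P, forall w, p t w * M t w = S t w + V t}.
Proof.
move=> /andP[t1 tT]; move: t1; rewrite -(subKn tT).
have : (T - t <= T)%N by exact: leq_subr.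
elim: (T - t)%N => [_ _|n IH nT n1].
  by apply: filterS last_price => w; rewrite subn0 continuation_last addr0.
set m := (T - n.+1)%N in n1 *.
have mE : (T - n)%N = m.+1 by rewrite /m subnSK.
have mT : (m < T)%N by rewrite -mE leq_subr.
have := IH (ltnW nT); rewrite mE => /(_ isT) {}IH.
have mm : (1 <= m < T)%N by rewrite n1.
have mT0 : in_periods T m by rewrite /in_periods n1 ltnW.
have mT' : in_periods T m.+1 by rewrite /in_periods mT.
have sm := info_sigma HE m; have mi := info_measurable HE (t := m).
have cp := price_expected eqm mT0; have [ape Ipe _] := cp.
have aM := supply_adapted mT0.
have M0 : {ae P, forall w, 0 <= M m.+1 w}.
  by apply: filterS (supply_price mT') => w [/ltW].
have ISV : intg (fun w => S m.+1 w + V m.+1).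
  exact: intgD (total_payment_intg HE mT') (intg_cst P _).
have mMp : measurable_fun [set: Omega] (fun w => M m.+1 w * p m.+1 w).
  apply: measurable_funM; first exact: adapted_measurable aM.
  exact: intg_measurable (p_intg mT').
have IHs : {ae P, forall w, S m.+1 w + V m.+1 = M m.+1 w * p m.+1 w}.
  by apply: filterS IH => w <-; rewrite mulrC.
have IMp := intg_ae mMp IHs ISV.
(* The induction hypothesis makes [M m.+1 * p m.+1] integrable; the reverse direction passes this on
   to the expected price. *)
have [IMpe _] := pull_out_intg_rev sm mi cp (p_intg mT') (price_ge0 mT') aM M0 IMp.
(* [M m.+1] is known at [m], so this is the conditional mean of [S m.+1 + V m.+1]. *)
have known : {ae P, forall w, M m.+1 w * pe m w = k + V m.+1}.
  apply: (adapted_ae_eq sm mi) => //.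
  - exact: adaptedM.
  - exact: adapted_cst.
  - exact: intg_cst.
  move=> A GA; have mA := mi _ GA.
  have aAM : adapted_to (info E m) (fun w => \1_A w * M m.+1 w).
    by apply: (adaptedM sm) => //; exact: adapted_indic.
  have I1 : intg (fun w => \1_A w * M m.+1 w * pe m w).
    by apply: eq_integrable (intg_indic mA IMpe) => // w _ /=; rewrite mulrA.
  have [_ E1] := pull_out_intg sm mi cp (p_intg mT') (price_ge0 mT') aAM
    (ae_indic_ge0 A M0) I1.
  transitivity (Ex (fun w => \1_A w * M m.+1 w * pe m w)).
    by apply: eq_Rintegral => w _; rewrite mulrA.
  rewrite -E1; transitivity (Ex (fun w => \1_A w * (S m.+1 w + V m.+1))).
    apply: Ex_ae.
    - apply: measurable_funM; last exact: intg_measurable (p_intg mT').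
      exact: adapted_measurable aAM.
    - exact: measurable_indicM mA (intg_measurable ISV).
    - by apply: filterS IHs => w ->; rewrite mulrA.
  have cS := total_payment_cond_exp HE (s := m) (t := m.+1).
  have {}cS := cS (ltac:(by rewrite n1 ltnSn)) mT.
  have I2 : intg (fun w => \1_A w * S m.+1 w) by exact/intg_indic/total_payment_intg.
  have I3 : intg (fun w => \1_A w * V m.+1) by exact/intg_indic/intg_cst.
  have I4 : intg (fun w => \1_A w * k) by exact/intg_indic/intg_cst.
  transitivity (Ex (fun w => \1_A w * S m.+1 w) + Ex (fun w => \1_A w * V m.+1)).
    by rewrite -ExD//; apply: eq_Rintegral => w _; rewrite mulrDr.
  rewrite -(cond_expE cS GA) -ExD//.
  by apply: eq_Rintegral => w _; rewrite mulrDr.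
apply: filterS2 (filterI known (supply_next mT0))
  (filterI (price_expectation mm) (burnt_le mT0)).
move=> w [kn M1] [pw [_ b1]].
have g0 := growth_gt0 mm.
(* The unburnt tokens are worth the discounted expected value of the next supply,
   [b * (k + V m.+1)], which is [V m]; the growth factor cancels. *)
have : (1 + growth pol m) * (p m w * M m w - S m w) = (1 + growth pol m) * V m.
  rewrite (continuationS HE mT) -kn -{1}b1.
  have -> : (1 + growth pol m) * (p m w * M m w - p m w * (S m w / p m w)) =
    p m w * ((1 + growth pol m) * (M m w - S m w / p m w)) by ring.
  by rewrite -M1 {1}pw; ring.
by move/(mulfI (lt0r_neq0 g0)); lra.
Qed.

Lemma token_equilibrium_fair : fair_prices E pol p.
Proof.
split => //.
- by case: Hpol.
- exact: growth_gt0.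
- apply: filterS (supply_value (in_period1 HE)) => w.
  by rewrite supply1.
move=> t tt; have [t1 tT] := andP tt.
have tT0 : in_periods T t by rewrite /in_periods t1 ltnW.
have tT' : in_periods T t.+1 by rewrite /in_periods tT.
apply: filterS2 (filterI (supply_value tT0) (supply_next tT0))
  (filterI (supply_value tT') (burnt_le tT0)).
move=> w [v1 M1] [v2 [_ b1]].
have -> : (1 + growth pol t) * V t = p t w * M t.+1 w.
  have -> : V t = p t w * M t w - p t w * (S t w / p t w) by rewrite v1 b1; ring.
  by rewrite M1; ring.
by rewrite -v2; ring.
Qed.

End token_equilibrium_prices.

(** * Strict risk aversion determines the timing of revenues *)

Section strict_risk_aversion.
Context (R : realType) (d : measure_display) (Omega : measurableType d)
  (P : probability Omega R) (E : auction_env P).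
Hypothesis HE : auction_model E.

Local Notation intg f := (P.-integrable [set: Omega] (EFin \o f)).
Local Notation Ex f := (Rintegral P [set: Omega] f).
Local Notation T := (periods E).
Local Notation b := (discount E).
Local Notation k := (mean_revenue E).
Local Notation S := (total_payment E).
Local Notation V := (continuation E).

(* [Z] is a position in the risky revenue of period [t.+1], chosen at [t]; a payoff
   known at [t] agrees with its own conditional expectation. *)
Lemma risky_position_void t (N Z : Omega -> R) v : (1 <= t < T)%N ->
  ~ {ae P, forall w, S t.+1 w = k} ->
  adapted_to (info E t) N -> adapted_to (info E t) Z ->
  intg N -> intg Z -> {ae P, forall w, 0 <= Z w} ->
  {ae P, forall w, N w = (S t.+1 w + v) * Z w} -> {ae P, forall w, Z w = 0}.
Proof.
move=> tt risky aN aZ IN IZ Z0 NZ; have [t1 tT] := andP tt.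
have tT0 : in_periods T t by rewrite /in_periods t1 ltnW.
have tT' : in_periods T t.+1 by rewrite /in_periods tT.
have st := info_sigma HE t; have mt := info_measurable HE (t := t).
have cS := total_payment_cond_exp HE (s := t) (t := t.+1).
have {}cS := cS (ltac:(by rewrite t1 ltnSn)) tT.
have IS := total_payment_intg HE tT'; have S0 := total_payment_ge0 HE tT'.
have pull h : adapted_to (info E t) h -> {ae P, forall w, 0 <= h w} -> intg h ->
    intg (fun w => h w * S t.+1 w) /\ Ex (fun w => h w * S t.+1 w) = k * Ex h.
  move=> ah h0 Ih.
  have Ik : intg (fun w => h w * k).
    by apply: eq_integrable (intgZ k Ih) => // w _ /=; rewrite mulrC.
  have [Ih' ->] := pull_out_intg st mt cS IS S0 ah h0 Ik.
  by split=> //; rewrite -ExZ//; apply: eq_Rintegral => w _; rewrite mulrC.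
have NkZ : {ae P, forall w, N w = (k + v) * Z w}.
  apply: (adapted_ae_eq st mt aN) => //; [exact: adaptedZ|exact: intgZ|].
  move=> A GA; have mA := mt _ GA.
  have aAZ : adapted_to (info E t) (fun w => \1_A w * Z w).
    by apply: (adaptedM st) => //; exact: adapted_indic.
  have IAZ : intg (fun w => \1_A w * Z w) by exact: intg_indic.
  have [I1 E1] := pull _ aAZ (ae_indic_ge0 A Z0) IAZ.
  have I2 : intg (fun w => \1_A w * Z w * S t.+1 w + v * (\1_A w * Z w)).
    by apply: intgD => //; exact: intgZ.
  transitivity (Ex (fun w => \1_A w * Z w * S t.+1 w + v * (\1_A w * Z w))).
    apply: Ex_ae.
    - exact: measurable_indicM mA (intg_measurable IN).
    - exact: intg_measurable I2.
    - by apply: filterS NZ => w ->; ring.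
  rewrite ExD// ?E1 ?ExZ//; last exact: intgZ.
  rewrite -mulrDl -ExZ//; apply: eq_Rintegral => w _; ring.
have SkZ : {ae P, forall w, Z w != 0 -> S t.+1 w = k}.
  apply: filterS2 NZ NkZ => w -> /eqP.
  by rewrite -subr_eq0 -mulrBl mulf_eq0 => /orP[/eqP h _|->//]; lra.
(* [A] is known at [t] and [B] depends on the valuations of [t.+1], so they are independent. Their
   intersection is null, hence one of them is null, and riskiness excludes [B]. *)
pose A := [set w | 0 < Z w]; pose B := S t.+1 @^-1` (~` [set k]).
have GA : info E t A by apply: (adapted_lt st) => //; exact: adapted_cst.
have mk : measurable (~` [set k] : set R) by exact: measurableC.
have GB : valuation_info E t.+1 B.
  have sv := @valuation_info_sigma _ _ _ _ E t.+1.
  suff : adapted_to (valuation_info E t.+1) (S t.+1) by exact.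
  by apply: (adapted_sum sv) => i; exact: payment_meas.
have PAB : P (A `&` B) = 0%E.
  apply/eqP; rewrite -measure_le0.
  have [C [mC PC sub]] := SkZ.
  rewrite -PC; apply: le_measure; rewrite ?inE//.
    by apply: measurableI; [exact: mt|exact: (valuation_info_measurable GB)].
  move=> w [/= Aw Bw]; apply: sub => /=; apply/not_implyP; split => //.
  by rewrite gt_eqF.
move: PAB; rewrite (info_indep HE tT0 tT' GA GB) => /eqP.
rewrite mule_eq0 => /orP[/eqP PA|/eqP PB].
  have : {ae P, forall w, ~ A w}.
    by exists A; split => //; [exact: mt|move=> w /= /contrapT].
  apply: filterS2 Z0 => w Z0 /negP; rewrite -leNgt => Z1.
  by apply/eqP; rewrite eq_le Z0 Z1.
exfalso; apply: risky; exists B; split => //.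
  exact: (valuation_info_measurable GB).
Qed.

Variables (pol : token_policy R) (p Q c s : nat -> Omega -> R).
Hypothesis fp : fair_prices E pol p.
Hypothesis opt : auctioneer_token_optimal E pol p Q c s.
Hypothesis averse : strictly_averse E.

Let H t w := auctioneer_tokens E pol p Q t w + Q t w.

(** Backward induction from [X T = 0]. Optimal consumption is [smoothed] in every period, so what
    the tokens must bring in next period is known one period ahead, whereas their value then depends
    on a risky auction. *)
Lemma averse_holdings t : in_periods T t -> {ae P, forall w,
  p t w * H t w = 0 /\ s t w = b * annuity E (T - t) * smoothed E w}.
Proof.
have [plan best] := (token_optimalP HE fp Q c s).1 opt.
have fin := token_plan_financed HE fp plan.
have [cs XT] := financed_eq HE fin averse.1 best.
have [aQ H0 [acs cs0 s0 bud]] := plan.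
have aH m : in_periods T m -> adapted_to (info E m) (H m).
  move=> mT; apply: (adaptedD (info_sigma HE m)); last exact: aQ.
  exact: (auctioneer_tokens_adapted HE p (fair_recycling fp)).
have pH0 m : in_periods T m -> {ae P, forall w, 0 <= p m w * H m w}.
  by move=> mT; apply: filterS2 H0 (fair_ge0 HE fp mT) => w /(_ m mT) ? ?; exact: mulr_ge0.
move=> /andP[t1 tT]; move: t1; rewrite -(subKn tT).
have : (T - t <= T)%N by exact: leq_subr.
elim: (T - t)%N => [_ _|n IH nT n1].
  rewrite subn0; have TT : in_periods T T by rewrite /in_periods (one_period HE) leqnn.
  apply: filterS2 XT (pH0 T TT) => w /eqP X0 pH; rewrite subnn /annuity big_nil mulr0 mul0r.
  have [_ sT] := cs0 T w TT.
  by move: X0; rewrite paddr_eq0// => /andP[/eqP -> /eqP ->].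
set m := (T - n.+1)%N in n1 *.
have mE : (T - n)%N = m.+1 by rewrite /m subnSK.
have mT : (m < T)%N by rewrite -mE leq_subr.
have := IH (ltnW nT); rewrite mE => /(_ isT) {}IH.
have mm : (1 <= m < T)%N by rewrite n1.
have mT0 : in_periods T m by rewrite /in_periods n1 ltnW.
have mT' : in_periods T m.+1 by rewrite /in_periods mT.
have sm := info_sigma HE m; have mi := info_measurable HE (t := m).
have V0 : 0 < V m by exact: continuation_gt0.
have [am as_] := acs m mT0.
have [_ IX] := financed_intg HE fin mT0.
have Is : intg (s m).
  apply: intg_le IX; first exact: adapted_measurable as_.
  apply: filterS (pH0 m mT0) => w pH; have [_ sge] := cs0 m w mT0.
  by rewrite ger0_norm// lerDr.
have IpH : intg (fun w => p m w * H m w).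
  have := intgB IX Is; apply: eq_integrable => // w _ /=.
  by rewrite /H; congr EFin; ring.
(* [Z] is the fraction of all later auctions that the tokens represent; [N] is the cost of consuming
   [smoothed] from [m.+1] on, less the proceeds of savings. *)
pose Z w := (V m)^-1 * (p m w * H m w).
pose N w := annuity E (T - m) * smoothed E w - b^-1 * s m w.
have aZ : adapted_to (info E m) Z.
  apply: (adaptedZ sm); apply: (adaptedM sm); last exact: aH.
  exact: (fair_adapted fp).
have aN : adapted_to (info E m) N.
  apply: (adaptedB sm); last exact: adaptedZ.
  apply: (adaptedZ sm); exact: adapted_sub (info_subset HE n1) (smoothed_adapted HE).
have IN : intg N by apply: intgB; [exact/intgZ/smoothed_intg|exact: intgZ].
have NZ : {ae P, forall w, N w = (S m.+1 w + V m.+1) * Z w}.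
  apply: filterS3 IH (filterI (fair_next fp mm) (cs _ mT')) (financed_next fin mm).
  move=> w [pH sE] [pn cE] bw.
  have : smoothed E w + s m.+1 w =
      (1 + growth pol m) * (p m.+1 w * H m w) + b^-1 * s m w.
    move: bw; rewrite cE -/(H m.+1 w) pH add0r => ->.
    by rewrite (auctioneer_tokensS p (fair_recycling fp))// -/(H m w) /=; ring.
  rewrite sE /N; have -> : (T - m = (T - m.+1).+1)%N by rewrite subnSK.
  rewrite annuityS => h.
  have -> : (1 + b * annuity E (T - m.+1)) * smoothed E w - b^-1 * s m w =
    (1 + growth pol m) * (p m.+1 w * H m w).
    by move: h; lra.
  rewrite /Z; apply: (mulfI (lt0r_neq0 V0)).
  have -> : V m * ((1 + growth pol m) * (p m.+1 w * H m w)) =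
    ((1 + growth pol m) * V m * p m.+1 w) * H m w by ring.
  rewrite pn; have -> : V m * ((S m.+1 w + V m.+1) * ((V m)^-1 * (p m w * H m w))) =
    V m * ((V m)^-1 * ((S m.+1 w + V m.+1) * (p m w * H m w))) by ring.
  by rewrite mulVKf ?lt0r_neq0// mulrA.
have risky := averse.2 m.+1 (ltac:(by rewrite ltnS n1)).
have Z0 : {ae P, forall w, 0 <= Z w}.
  by apply: filterS (pH0 m mT0) => w ?; rewrite mulr_ge0// invr_ge0 ltW.
have Zv := risky_position_void mm risky aN aZ IN (intgZ _ IpH) Z0 NZ.
apply: filterS2 Zv NZ => w Zw; rewrite Zw mulr0 /N => /eqP; rewrite subr_eq0 => /eqP h.
split.
  by move: Zw => /eqP; rewrite /Z mulf_eq0 invr_eq0 gt_eqF//= => /eqP.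
by rewrite -mulrA h mulVKf// discount_neq0.
Qed.

Lemma averse_revenue : {ae P, forall w, forall t, in_periods T t ->
  token_revenue p Q t w = if t == 1%N then wealth E w else 0}.
Proof.
apply: ae_periods => -[//|[_|t tT]].
  apply: filterS2 (averse_holdings (in_period1 HE)) (fair_start fp) => w [+ _] <-.
  by rewrite /H /token_revenue/=; lra.
have tt : (1 <= t.+1 < T)%N by case/andP: (tT).
have tT0 : in_periods T t.+1 by case/andP: tt => _ /ltnW.
apply: filterS3 (averse_holdings tT) (averse_holdings tT0) (fair_gt0 HE fp tt).
move=> w [+ _] [/eqP + _] p0; rewrite mulf_eq0 (gt_eqF p0)/= => + /eqP H0.
rewrite {1}/H (auctioneer_tokensS p (fair_recycling fp))// -/(H t.+1 w) H0 mulr0 add0r.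
by rewrite /token_revenue => ->; rewrite oppr0.
Qed.

End strict_risk_aversion.

(** * From equity to tokens *)

Section token_equilibrium_construction.
Context (R : realType) (d : measure_display) (Omega : measurableType d)
  (P : probability Omega R) (E : auction_env P).
Hypothesis HE : auction_model E.

Local Notation intg f := (P.-integrable [set: Omega] (EFin \o f)).
Local Notation T := (periods E).
Local Notation b := (discount E).
Local Notation S := (total_payment E).
Local Notation V := (continuation E).

Variable pol : token_policy R.
Hypothesis Hpol : valid_policy T pol.
Hypothesis burning : forall t, in_periods T t -> recycling pol t = -1.
Hypothesis growing : forall t, (1 <= t < T)%N -> -1 < growth pol t.
Variables (e : Omega -> R) (x : 'I_(bidders E) -> Omega -> R)
  (c s : nat -> Omega -> R).
Hypothesis eqm : equity_equilibrium e x c s.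

(* The supply of tokens when the price makes it worth [S t + V t]. *)
Fixpoint supply (t : nat) (w : Omega) : R :=
  match t with
  | 0 => 0
  | t'.+1 =>
      if t' == 0%N then initial_supply pol
      else (1 + growth pol t') * V t' * supply t' w / (S t' w + V t')
  end.

Definition price (t : nat) (w : Omega) : R :=
  if in_periods T t then (S t w + V t) / supply t w else 0.

(** Tokens must earn the safe return up to growth, which dictates this value; after the last auction
    they are worthless. *)
Definition expected_price (t : nat) (w : Omega) : R :=
  if (t < T)%N then (b * (1 + growth pol t))^-1 * price t w else 0.

(** Keeps the holding at the fraction [x i] of the supply. The bidder buys the tokens due and sells
    the fraction [x i] of all tokens to be burnt; that sale is the dividend [x i * S t]. *)
Definition purchases (i : 'I_(bidders E)) (t : nat) (w : Omega) : R :=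
  (if t == 1%N then x i w * initial_supply pol else 0) +
  (payment E t i w - x i w * S t w) / price t w.

Lemma priceE t w : in_periods T t -> price t w = (S t w + V t) / supply t w.
Proof. by rewrite /price => ->. Qed.

Lemma supplyS t w : (1 <= t)%N ->
  supply t.+1 w = (1 + growth pol t) * V t * supply t w / (S t w + V t).
Proof. by case: t. Qed.

Let M1_gt0 : 0 < initial_supply pol. Proof. by case: Hpol. Qed.

Let g_gt0 t : (1 <= t < T)%N -> 0 < 1 + growth pol t.
Proof. by move=> /growing; lra. Qed.

Lemma supply_pos t : in_periods T t -> {ae P, forall w, 0 < supply t w}.
Proof.
elim: t => [//|[_ _|t IH tT]]; first exact: aeW.
have tt : (1 <= t.+1 < T)%N by case/andP: (tT).
have tT0 : in_periods T t.+1 by case/andP: tt => _ /ltnW.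
have V0 : 0 < V t.+1 by apply: continuation_gt0 => //; case/andP: tt.
apply: filterS2 (IH tT0) (total_payment_ge0 HE tT0) => w m0 S0.
rewrite supplyS// divr_gt0//; last by rewrite ltr_pwDr.
exact: mulr_gt0 (mulr_gt0 (g_gt0 tt) V0) m0.
Qed.

Lemma supply_known t : in_periods T t -> adapted_to (info E t) (supply t).
Proof.
elim: t => [//|[_ _|t IH tT]]; first exact: adapted_cst (info_sigma HE 1) _.
have tT0 : in_periods T t.+1 by case/andP: tT => _ /ltnW.
apply: adapted_sub (info_subset HE (leqnSn t.+1)) _.
have st := info_sigma HE t.+1.
have -> : supply t.+2 = fun w => (1 + growth pol t.+1) * V t.+1 * supply t.+1 w /
    (S t.+1 w + V t.+1) by apply/funext => w; rewrite supplyS.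
apply: (adapted_div st); first by apply: (adaptedZ st); exact: IH.
by apply: (adaptedD st); [exact: total_payment_adapted|exact: adapted_cst].
Qed.

Lemma price_fair : fair_prices E pol price.
Proof.
split => //.
- move=> t tT; have st := info_sigma HE t.
  have -> : price t = fun w => (S t w + V t) / supply t w.
    by apply/funext => w; rewrite priceE.
  apply: (adapted_div st); last exact: supply_known.
  by apply: (adaptedD st); [exact: total_payment_adapted|exact: adapted_cst].
- by apply: aeW => w; rewrite (priceE _ (in_period1 HE)) divfK// gt_eqF.
move=> t tt; have [t1 tT] := andP tt.
have tT0 : in_periods T t by rewrite /in_periods t1 ltnW.
have tT' : in_periods T t.+1 by rewrite /in_periods tT.
have V0 : 0 < V t by exact: continuation_gt0.
apply: filterS2 (supply_pos tT0) (total_payment_ge0 HE tT0) => w m0 S0.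
rewrite !priceE// supplyS//; field.
rewrite !gt_eqF ?g_gt0// ?andbT//.
by rewrite ltr_pwDr.
Qed.

Let fp := price_fair.

(** Prices involve quotients by a random supply, so integrability is inherited from period 1 through
    [fair_transfer] with weight 1. *)
Lemma price_intg t : in_periods T t -> intg (price t).
Proof.
elim: t => [//|[_ _|t IH tT]].
  have := intgZ (initial_supply pol)^-1 (wealth_intg HE); apply: eq_integrable => // w _.
  by rewrite /= (priceE _ (in_period1 HE)) mulrC.
have tt : (1 <= t.+1 < T)%N by case/andP: (tT).
have tT0 : in_periods T t.+1 by case/andP: tt => _ /ltnW.
have one : intg (fun w => 1 * price t.+1 w).
  by apply: eq_integrable (IH tT0) => // w _ /=; rewrite mul1r.
have st := info_sigma HE t.+1.
have [+ _] := fair_transfer HE fp tt (adapted_cst st 1) (aeW P (fun=> ler01)) one.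
by apply: eq_integrable => // w _ /=; rewrite mul1r.
Qed.

Lemma price_cond_exp t : in_periods T t ->
  is_cond_exp P (info E t) (price t.+1) (expected_price t).
Proof.
move=> tT; have st := info_sigma HE t; have mt := info_measurable HE (t := t).
have := tT => /andP[t1]; rewrite leq_eqVlt => /predU1P[tE|tlt].
  have -> : expected_price t = fun=> 0.
    by apply/funext => w; rewrite /expected_price tE ltnn.
  have -> : price t.+1 = fun=> 0.
    by apply/funext => w; rewrite /price /in_periods tE ltnn andbF.
  by split => //; [exact: adapted_cst|exact: intg_cst].
have tt : (1 <= t < T)%N by rewrite t1.
have eE : expected_price t = fun w => (b * (1 + growth pol t))^-1 * price t w.
  by apply/funext => w; rewrite /expected_price tlt.
have bg : b * (1 + growth pol t) != 0.
  by rewrite mulf_neq0 ?discount_neq0// gt_eqF// g_gt0.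
rewrite eE; split.
- by apply: (adaptedZ st); exact: (fair_adapted fp).
- by apply: intgZ; exact: price_intg.
move=> A GA; have mA := mt _ GA.
have IA : intg (fun w => \1_A w * price t w) by apply: intg_indic => //; exact: price_intg.
have A0 : {ae P, forall w, 0 <= \1_A w :> R} by apply: aeW => w; rewrite indicE.
have [_ EA] := fair_transfer HE fp tt (adapted_indic st GA) A0 IA.
rewrite (Rintegral_indic P A (price t.+1)).
rewrite (Rintegral_indic P A (fun w => (b * (1 + growth pol t))^-1 * price t w)).
apply: (mulfI bg); rewrite -[RHS]mulrA EA -ExZ; last first.
  by apply: intg_indic => //; apply: intgZ; exact: price_intg.
apply: eq_Rintegral => w _; rewrite [in LHS](mulrCA (\1_A w)).
by rewrite mulVKf.
Qed.

Let eV := equity_price HE eqm.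

Lemma purchases_flow : {ae P, forall w, forall t, in_periods T t ->
  forall i, token_flow price (purchases i) t w = equity_flow e (x i) i t w}.
Proof.
apply: ae_periods => t tT.
apply: filterS3 eV (filterI (fair_start fp) (fair_zero HE fp tT))
  (total_payment_ge0 HE (in_period1 HE)) => w ew [pw pz] S10 i.
have zero : price t w = 0 -> payment E t i w = 0 /\ S t w = 0.
  by move=> /pz h; rewrite h; split => //; rewrite /total_payment big1.
rewrite /token_flow /purchases /equity_flow.
(* At a zero price nobody pays; in period 1 the whole wealth, hence also the equity price, is then
   0. *)
have [p0|p0] := eqVneq (price t w) 0.
  have [-> S0] := zero p0; rewrite p0 mul0r !oppr0 add0r S0.
  case: eqP => [t1|_]; last by rewrite mulr0.
  have : equity_value E = 0.
    move: pw; rewrite -t1 p0 mul0r wealthE -t1 S0 add0r => <- //.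
  by rewrite ew => ->; rewrite mulr0 oppr0.
rewrite mulrDr [price t w * (_ / _)]mulrCA mulfV// mulr1.
case: eqP => [t1|_]; last by ring.
have -> : price t w * (x i w * initial_supply pol) = x i w * wealth E w.
  by rewrite -pw t1; ring.
by rewrite wealthE ew t1; ring.
Qed.

Lemma purchases_adapted i t : in_periods T t -> adapted_to (info E t) (purchases i t).
Proof.
move=> tT; have st := info_sigma HE t; have [_ _ opt _ _] := eqm.
have [[ax _ _ _] _] := opt i.
have t1 : (1 <= t)%N by case/andP: tT.
have axt := adapted_sub (info_subset HE t1) ax.
apply: (adaptedD st).
  case: (t == 1%N); last exact: adapted_cst.
  by apply: (adaptedM st) => //; exact: adapted_cst.
apply: (adapted_div st); last exact: (fair_adapted fp).
apply: (adaptedB st); first exact: payment_info.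
by apply: (adaptedM st) => //; exact: total_payment_adapted.
Qed.

Lemma supply_after t : in_periods T t -> {ae P, forall w,
  0 <= supply t w - S t w / price t w /\
  ((t < T)%N -> supply t.+1 w = (1 + growth pol t) * (supply t w - S t w / price t w))}.
Proof.
move=> tT; apply: filterS2 (supply_pos tT) (total_payment_ge0 HE tT) => w m0 S0.
have t1 : (1 <= t)%N by case/andP: tT.
have V0 := continuation_ge0 HE t.
(* The denominator can vanish only in the last period, where the continuation is 0. *)
have [SV|SV] := eqVneq (S t w + V t) 0.
  have S00 : S t w = 0 by lra.
  split; first by rewrite S00 mul0r subr0 ltW.
  by move=> tlt; have := continuation_gt0 HE tlt; lra.
have eq1 : supply t w - S t w / price t w = V t * supply t w / (S t w + V t).
  by rewrite priceE//; field; rewrite SV gt_eqF.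
rewrite eq1; split.
  by rewrite divr_ge0// ?addr_ge0// mulr_ge0// ltW.
by move=> _; rewrite supplyS// !mulrA.
Qed.

Lemma purchases_holdings : {ae P, forall w, forall t, in_periods T t ->
  forall i, bidder_tokens pol price i (purchases i) t w =
    if t == 1%N then 0 else x i w * supply t w}.
Proof.
have := ae_periods supply_after; apply: filterS => w after.
elim=> [//|t IH tT i]; case: t IH tT => [//|t IH tT].
have tt : (1 <= t.+1 < T)%N by case/andP: (tT).
have tT0 : in_periods T t.+1 by case/andP: tt => _ /ltnW.
have [_ /(_ (andP tt).2) ->] := after _ tT0.
rewrite bidder_tokensS// (IH tT0)/= /purchases /tokens_due.
case: t {IH tT tT0 tt} => [|t] /=; ring.
Qed.

Lemma purchases_plan i : bidder_token_plan pol price i (purchases i).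
Proof.
have [_ _ opt _ _] := eqm; have [xe _] := opt i; have [_ x0 _ _] := xe.
split.
  move=> t tT; split; first exact: purchases_adapted.
  have [If _] := equity_flow_intg HE xe i tT.
  apply: intg_ae If.
    apply: measurable_funN; apply: measurable_funM; first exact: (fair_measurable HE fp tT).
    exact: (adapted_measurable (info_measurable HE (t := t)) (purchases_adapted i tT)).
  by apply: filterS purchases_flow => w /(_ t tT) ->.
apply: filterS3 x0 purchases_holdings (ae_periods supply_after) => w x0 hold after t tT.
rewrite hold//; have [m0 _] := after t tT; rewrite -subr_ge0.
have -> : purchases i t w - (tokens_due price t i w -
    (if t == 1%N then 0 else x i w * supply t w)) =
    x i w * (supply t w - S t w / price t w).
  rewrite /purchases /tokens_due; case: eqP => [->|_] /=; ring.
exact: mulr_ge0.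
Qed.

Lemma purchases_payoff i :
  bidder_payoff i (token_flow price (purchases i)) = (auction_payoff i)%:E.
Proof.
have [_ _ opt _ _] := eqm; have [xe _] := opt i.
have [plan _] := purchases_plan i.
rewrite -(equity_equilibrium_bidder HE i eqm).
rewrite !(bidder_payoffE HE); last 2 first.
- by move=> t /(equity_flow_intg HE xe i)[].
- by move=> t /plan[].
congr (_ + _)%:E; rewrite big_nat [RHS]big_nat; apply: eq_bigr => t tT.
have [_ If] := plan t tT; have [If' _] := equity_flow_intg HE xe i tT.
congr (_ * (_ + _)); apply: Ex_ae.
- exact: intg_measurable If.
- exact: intg_measurable If'.
- by apply: filterS purchases_flow => w /(_ t tT) ->.
Qed.

Lemma sell_all_tokens t w : in_periods T t ->
  auctioneer_tokens E pol price (sell_all pol) t w =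
  if t == 1%N then initial_supply pol else 0.
Proof.
move=> tT; have /eqP := sell_all_holdings fp w tT.
by rewrite addr_eq0 => /eqP ->; rewrite /sell_all; case: ifP => _; rewrite ?opprK ?oppr0.
Qed.

Lemma token_supplyE : {ae P, forall w, forall t, in_periods T t ->
  token_supply pol price (sell_all pol) purchases t w = supply t w}.
Proof.
have [_ sx _ _ _] := eqm.
apply: filterS2 sx purchases_holdings => w sx hold t tT.
rewrite /token_supply sell_all_tokens//.
under eq_bigr => i _ do rewrite hold//.
case: eqP => [->|_]; first by rewrite big1 ?addr0.
by rewrite -mulr_suml sx mul1r add0r.
Qed.

Lemma constructed_revenue : {ae P, forall w, forall t, in_periods T t ->
  token_revenue price (sell_all pol) t w = equity_revenue e x t w}.
Proof.
have [_ sx _ _ _] := eqm; have [_ none] := sell_all_optimal HE fp.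
apply: filterS2 (no_tokens_revenue fp none) (fair_equity_revenue eV sx).
by move=> w h1 h2 t tT; rewrite h1// h2.
Qed.

Lemma constructed_equilibrium :
  token_equilibrium pol price expected_price (sell_all pol) purchases c s.
Proof.
have [_ sx opt plan _] := eqm; split.
- by move=> t tT; split; [exact: (fair_adapted fp)|exact: price_intg].
- by move=> w; rewrite /price /in_periods ltnn andbF.
- exact: price_cond_exp.
- apply: filterS2 token_supplyE (ae_periods supply_pos) => w sE sp t tT.
  by rewrite sE//; exact: sp.
- apply: filterS2 token_supplyE (filterI (ae_periods supply_pos)
    (ae_periods (total_payment_ge0 HE))) => w sE [sp S0] t tT.
  have m0 := sp t tT; rewrite sE// /expected_price.
  have V0 := continuation_ge0 HE t.
  have Sm0 : 0 <= S t w / supply t w by rewrite divr_ge0 ?S0// ltW.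
  have := tT => /andP[t1]; rewrite leq_eqVlt => /predU1P[tE|tlt].
    have -> : (t < T)%N = false by rewrite tE ltnn.
    have VT : V t = 0 by rewrite tE continuation_last.
    by rewrite mulr0; have /max_idPl -> := Sm0; rewrite priceE// VT addr0.
  have g0 : 0 < 1 + growth pol t by apply: g_gt0; rewrite t1.
  rewrite tlt mulVKf; last by rewrite mulf_neq0 ?discount_neq0// gt_eqF.
  (* Before the last period the continuation term equals the price, and [S t + V t] is at least
     [S t]. *)
  apply/esym/max_idPr; rewrite priceE// ler_pM2r ?invr_gt0//.
  by rewrite lerDl.
- apply: filterS sx => w sx t tT; rewrite /purchases big_split/= -mulr_suml.
  rewrite sumrB -/(total_payment E t w) -mulr_suml sx mul1r subrr mul0r addr0 /sell_all.
  case: eqP => _; last by rewrite big1 ?addr0.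
  by rewrite -mulr_suml sx mul1r addNr.
- move=> i; split; first exact: purchases_plan.
  by move=> q' /(bidder_plan_payoff_le HE fp); rewrite purchases_payoff.
apply/(token_optimalP HE fp); split; last exact: (equity_equilibrium_auctioneer HE eqm).
split.
- by move=> t tT; exact: adapted_cst (info_sigma HE t) _.
- by apply: aeW => w t tT; rewrite (sell_all_holdings fp).
have [acs cs0 s0 bud] := plan; split => //.
apply: filterS2 bud constructed_revenue => w bud revE t tT.
by rewrite bud// revE.
Qed.

End token_equilibrium_construction.

Theorem mainTheorem4 (R : realType) (d : measure_display)
    (Omega : measurableType d) (P : probability Omega R) (E : auction_env P)
    (HE : auction_model E) :
  (* the dollar-based auction with an equity issue has an equilibrium *)
  (exists e x c s, equity_equilibrium (E := E) e x c s) /\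
  (* in every such equilibrium: investors are indifferent, the price of equity,
     and the auctioneer's revenues *)
  (forall e x c s, equity_equilibrium (E := E) e x c s ->
     [/\ forall (i : 'I_(bidders E)) (y : Omega -> R), equity_admissible E e y ->
           bidder_payoff i (equity_flow e y i) =
           bidder_payoff i (equity_flow e (fun _ => 0) i),
         {ae P, forall w, e w = equity_value E},
         {ae P, forall w, equity_revenue e x 1 w =
                          total_payment E 1 w + equity_value E} &
         {ae P, forall w, forall t, (2 <= t <= periods E)%N ->
                          equity_revenue e x t w = 0}]) /\
  (* comparison with the token-based auction in which payments are burned *)
  (forall pol : token_policy R, valid_policy (periods E) pol ->
     (forall t, in_periods (periods E) t -> recycling pol t = -1) ->
     [/\ (* every equilibrium with equity is an equilibrium with tokens *)
         (forall t, (1 <= t < periods E)%N -> -1 < growth pol t) ->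
         forall e x c s, equity_equilibrium (E := E) e x c s ->
         exists p pe Q q,
           [/\ token_equilibrium (E := E) pol p pe Q q c s,
               sells_when_indifferent E pol p Q &
               {ae P, forall w, forall t, in_periods (periods E) t ->
                  token_revenue p Q t w = equity_revenue e x t w /\
                  forall i, token_flow p (q i) t w =
                            equity_flow e (x i) i t w}],
         (* every equilibrium with tokens is one with equity *)
         forall p pe Q q c s, token_equilibrium (E := E) pol p pe Q q c s ->
         sells_when_indifferent E pol p Q \/ strictly_averse E ->
         exists e x,
           equity_equilibrium (E := E) e x c s /\
           {ae P, forall w, forall t, in_periods (periods E) t ->
              token_revenue p Q t w = equity_revenue e x t w /\
              \sum_i token_flow p (q i) t w =
              \sum_i equity_flow e (x i) i t w} &
         (* everyone's payoff is the same, however ties are broken *)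
         forall e x c s, equity_equilibrium (E := E) e x c s ->
         forall p pe Q q c' s', token_equilibrium (E := E) pol p pe Q q c' s' ->
           auctioneer_payoff E c' = auctioneer_payoff E c /\
           forall i, bidder_payoff i (token_flow p (q i)) =
                     bidder_payoff i (equity_flow e (x i) i)]).
Proof.
have T1 := in_period1 HE.
have split_rev (rev : nat -> Omega -> R) :
    {ae P, forall w, forall t, in_periods (periods E) t ->
      rev t w = if t == 1%N then wealth E w else 0} ->
    {ae P, forall w, rev 1%N w = wealth E w} /\
    {ae P, forall w, forall t, (2 <= t <= periods E)%N -> rev t w = 0}.
  move=> revE; split; apply: filterS revE => w revE; first exact: revE.
  by case=> [//|[//|t]] tT; rewrite revE.
split.
  pose rev t (w : Omega) := if t == 1%N then wealth E w else 0.
  have revE : {ae P, forall w, forall t, in_periods (periods E) t ->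
      rev t w = if t == 1%N then wealth E w else 0} by exact: aeW.
  have [rev1 rev0] := split_rev rev revE.
  exists (fun=> equity_value E), (@equal_shares _ _ _ _ E), (smooth_consumption E),
    (smooth_savings E).
  apply: (equal_shares_equilibrium HE revE); last exact: smooth_payoff.
  exact: smooth_plan.
split.
  move=> e x c s eqm; have eV := equity_price HE eqm; have [_ sx _ _ _] := eqm.
  have [rev1 rev0] := split_rev _ (fair_equity_revenue eV sx).
  split => //.
    move=> i y ye; rewrite !(fair_equity_payoff HE)//.
    apply: cst_admissible => //; have [ae _ _ _ _] := eqm.
    exact: (adapted_measurable (info_measurable HE (t := 1)) ae).
  by apply: filterS rev1 => w ->; rewrite wealthE.
move=> pol Hpol burning; split.
- move=> growing e x c s eqm.
  exists (@price _ _ _ _ E pol), (@expected_price _ _ _ _ E pol), (sell_all pol),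
    (purchases pol x).
  split.
  + exact: (constructed_equilibrium HE Hpol burning growing eqm).
  + move=> _.
    exact: (sell_all_optimal HE (price_fair HE Hpol burning growing)).2.
  + apply: filterS2 (constructed_revenue HE Hpol burning growing eqm)
      (purchases_flow HE Hpol burning growing eqm) => w h1 h2 t tT.
    by split; [exact: h1|exact: h2].
- move=> p pe Q q c s eqm ties.
  have fp := token_equilibrium_fair HE Hpol burning eqm.
  have opt := auctioneer_optimal eqm.
  have revE : {ae P, forall w, forall t, in_periods (periods E) t ->
      token_revenue p Q t w = if t == 1%N then wealth E w else 0}.
    (* Selling everything at once is optimal, so the premise of the tie-breaking rule holds; under
       strict aversion no rule is invoked. *)
    case: ties => [sell|averse]; last exact: (averse_revenue HE fp opt averse).
    apply: (no_tokens_revenue fp); apply: sell.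
    exists (sell_all pol), (smooth_consumption E), (smooth_savings E).
    exact: sell_all_optimal.
  have [[_ _ plan] best] := (token_optimalP HE fp Q c s).1 opt.
  have sx w := equal_shares_sum HE w.
  exists (fun=> equity_value E), (@equal_shares _ _ _ _ E).
  split; first exact: (equal_shares_equilibrium HE revE plan best).
  have revE' := fair_equity_revenue (x := @equal_shares _ _ _ _ E)
    (aeW P (fun w : Omega => erefl (equity_value E))) (aeW P sx).
  apply: filterS3 revE revE' (market_clearing eqm) => w h1 h2 mc t tT.
  have rr : token_revenue p Q t w =
      equity_revenue (E := E) (fun=> equity_value E) (@equal_shares _ _ _ _ E) t w.
    by rewrite h1// h2.
  split => //.
  (* By market clearing, what the bidders spend on tokens is what the auctioneer receives. *)
  have -> : \sum_i token_flow p (q i) t w = - token_revenue p Q t w.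
    rewrite /token_flow /token_revenue sumrN -mulr_sumr opprK.
    by move/eqP: (mc t tT); rewrite addrC addr_eq0 => /eqP ->; rewrite mulrN opprK.
  rewrite rr /equity_flow /equity_revenue big_split/= sumrN.
  rewrite -/(total_payment E t w) opprD; congr (_ + _).
  by case: ifP => _; rewrite ?sumrN mulr_suml ?opprK.
move=> e x c s eqm p pe Q q c' s' tok.
have fp := token_equilibrium_fair HE Hpol burning tok.
split.
  rewrite (equity_equilibrium_auctioneer HE eqm).
  by have [] := (token_optimalP HE fp Q c' s').1 (auctioneer_optimal tok).
move=> i; rewrite (equity_equilibrium_bidder HE i eqm).
have [plan opt] := bidders_optimal tok i.
exact: (bidder_optimal_payoff HE fp plan opt).
Qed.
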